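(* Let $v\in\mathbb{R}$, and let $(\rho_L,\alpha_L)\in\mathbb{R}_+^*\times\mathbb{R}$ and $(\rho_R,\alpha_R)\in\mathbb{R}_+^*\times\mathbb{R}$ be such that $\alpha_L>c\rho_L$ and $(\rho_R,\alpha_R)\notin\Omega_-^{sup}$. Then there is exactly one pair $((\rho_-,\alpha_-),(\rho_+,\alpha_+))\in V_-(\rho_L,\alpha_L,v)\times V_+(\rho_R,\alpha_R,v)$ such that $((\rho_-,\alpha_-+v\rho_-),(\rho_+,\alpha_++v\rho_+))\in\mathcal{G}_D(v)$.
   Context: $c>0$ is a fixed constant. The drag force $D:\mathbb{R}_+^*\times\mathbb{R}\to\mathbb{R}$, $(\rho,\alpha)\mapsto D(\rho,\alpha)$, is $\mathcal{C}^1$, has the same sign as $\alpha$ ($D>0$ for $\alpha>0$, $D<0$ for $\alpha<0$, $D(\rho,0)=0$), is an increasing function of $\alpha$, and $|D|$ is a decreasing (in the non-strict sense) function of $\rho$. Euler Riemann solution. For $(\rho_a,q_a),(\rho_b,q_b)\in\mathbb{R}_+^*\times\mathbb{R}$, $W(x/t;(\rho_a,q_a),(\rho_b,q_b))$ denotes the unique self-similar entropy solution of the isothermal Euler equations $\partial_t\rho+\partial_x q=0$, $\partial_t q+\partial_x(q^2/\rho+c^2\rho)=0$ with initial data $(\rho_a,q_a)$ for $x<0$ and $(\rho_b,q_b)$ for $x>0$; $W(v_-;\cdot)$ and $W(v_+;\cdot)$ are its left and right limits at $x/t=v$. Accessible sets. $U_-(\rho_L,q_L,v)=\{W(v_-;(\rho_L,q_L),(\underline\rho,\underline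 q)):(\underline\rho,\underline q)\in\mathbb{R}_+^*\times\mathbb{R}\}$, $U_+(\rho_R,q_R,v)=\{W(v_+;(\bar\rho,\bar q),(\rho_R,q_R)):(\bar\rho,\bar q)\in\mathbb{R}_+^*\times\mathbb{R}\}$, and $V_-(\rho_L,\alpha_L,v)=\{(\rho,q-v\rho):(\rho,q)\in U_-(\rho_L,\alpha_L+v\rho_L,v)\}$, $V_+(\rho_R,\alpha_R,v)=\{(\rho,q-v\rho):(\rho,q)\in U_+(\rho_R,\alpha_R+v\rho_R,v)\}$. $\Omega_-^{sup}$ is the set of states $(\rho,\alpha)\in V_-(\rho_L,\alpha_L,v)$ with $\alpha<-c\rho$. For $\alpha\neq 0$ let $F_\alpha(\rho)=\int_{|\alpha|/c}^{\rho}\frac{1}{|D(r,\alpha)|}\left(c^2-\frac{\alpha^2}{r^2}\right)dr$. Germ. $\mathcal{G}_D(v)$ is the set of pairs $((\rho_-,q_-),(\rho_+,q_+))\in(\mathbb{R}_+^*\times\mathbb{R})^2$ such that $q_--v\rho_-=q_+-v\rho_+=:\alpha$ and one of the following holds: - $\alpha=0$, $\rho_-=\rho_+$ and $q_-=q_+$; - $\alpha>0$, $(\frac{\alpha}{c}-\rho_+)(\frac{\alpha}{c}-\rho_-)\ge0$ and $F_\alpha(\rho_-)-F_\alpha(\rho_+)=1$; - $\alpha<0$, $(\frac{|\alpha|}{c}-\rho_+)(\frac{|\alpha|}{c}-\rho_-)\ge0$ and $F_\alpha(\rho_+)-F_\alpha(\rho_-)=1$; - $c\rho_-<\alpha$,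 $\rho_+\ge\frac{\alpha}{c}$ and there exist $\rho\in[\rho_-,\frac{\alpha}{c})$ and $\theta\in[0,1]$ with $F_\alpha(\rho_-)-F_\alpha(\rho)=\theta$ and $F_\alpha\left(\frac{\alpha^2}{c^2\rho}\right)-F_\alpha(\rho_+)=1-\theta$; - $\alpha<-c\rho_+$, $\rho_-\ge\frac{|\alpha|}{c}$ and there exist $\rho\in[\rho_+,\frac{|\alpha|}{c})$ and $\theta\in[0,1]$ with $F_\alpha(\rho_+)-F_\alpha(\rho)=\theta$ and $F_\alpha\left(\frac{\alpha^2}{c^2\rho}\right)-F_\alpha(\rho_-)=1-\theta$. *)

(* Defs.v *)
From Stdlib Require Import Reals.
From Coquelicot Require Import Coquelicot.

Open Scope R_scope.

Definition C1_on (dom : R -> R -> Prop) (f : R -> R -> R) : Prop :=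
  exists f1 f2 : R -> R -> R,
    forall x y : R, dom x y ->
      is_derive (fun s => f s y) x (f1 x y) /\
      is_derive (fun s => f x s) y (f2 x y) /\
      continuous (fun p : R * R => f1 (fst p) (snd p)) (x, y) /\
      continuous (fun p : R * R => f2 (fst p) (snd p)) (x, y).

(** Both monotonicity requirements are non-strict.  [D rho alpha] is only
    meaningful for [0 < rho]. *)
Record drag_force (D : R -> R -> R) : Prop := {
  drag_C1 : C1_on (fun rho _ => 0 < rho) D;
  drag_pos : forall rho alpha, 0 < rho -> 0 < alpha -> 0 < D rho alpha;
  drag_neg : forall rho alpha, 0 < rho -> alpha < 0 -> D rho alpha < 0;
  drag_zero : forall rho, 0 < rho -> D rho 0 = 0;
  drag_incr : forall rho alpha1 alpha2,
    0 < rho -> alpha1 <= alpha2 -> D rho alpha1 <= D rho alpha2;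
  drag_abs_decr : forall rho1 rho2 alpha,
    0 < rho1 -> rho1 <= rho2 -> Rabs (D rho2 alpha) <= Rabs (D rho1 alpha)
}.

(** Fluid states are pairs [(rho, q)]. *)

Definition momentum_flux (c : R) (U : R * R) : R :=
  snd U ^ 2 / fst U + c ^ 2 * fst U.

(** The mechanical energy of the isothermal gas (pressure law [c^2 rho]), which
    is its strictly convex mathematical entropy, and the associated flux. *)
Definition energy (c : R) (U : R * R) : R :=
  snd U ^ 2 / (2 * fst U) + c ^ 2 * fst U * ln (fst U).

Definition energy_flux (c : R) (U : R * R) : R :=
  snd U / fst U * (energy c U + c ^ 2 * fst U).

Definition riemann_data (Ua Ub : R * R) (x : R) : R * R :=
  if Rlt_dec x 0 then Ua else Ub.

(** [phi t x] is a C^1 function on R^2 with support in the square [-K,K]^2;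
    only its restriction to [0 <= t] is used below. *)
Definition test_function (K : R) (phi : R -> R -> R) : Prop :=
  0 < K /\
  C1_on (fun _ _ => True) phi /\
  (forall t x : R, K < Rabs t \/ K < Rabs x -> phi t x = 0).

(** The integral over t > 0 of [eta(u) phi_t + G(u) phi_x], plus the initial
    term, for the self-similar field [u(t,x) = w(x/t)].  The integrals stop at
    the bound [K] of the support of [phi]. *)
Definition weak_balance (eta G : R * R -> R) (w : R -> R * R) (Ua Ub : R * R)
    (K : R) (phi : R -> R -> R) : R :=
  RInt (fun t =>
    RInt (fun x =>
        eta (w (x / t)) * Derive (fun s => phi s x) t
        + G (w (x / t)) * Derive (fun y => phi t y) x)
      (- K) K) 0 K
  + RInt (fun x => eta (riemann_data Ua Ub x) * phi 0 x) (- K) K.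

(** [(t, x) |-> w (x / t)] is an entropy weak solution of the isothermal Euler
    equations with initial data [Ua] for [x < 0] and [Ub] for [x > 0].  It takes
    its values in a compact subset of the open half-plane [0 < rho] and has
    one-sided limits at every [x / t]; hence all the integrals involved are
    Riemann integrals of integrable functions. *)
Record riemann_solution (c : R) (Ua Ub : R * R) (w : R -> R * R) : Prop := {
  rs_bounds : exists m M : R, 0 < m /\
    forall xi, m <= fst (w xi) <= M /\ Rabs (snd (w xi)) <= M;
  rs_left_limit : forall xi, exists U, filterlim w (at_left xi) (locally U);
  rs_right_limit : forall xi, exists U, filterlim w (at_right xi) (locally U);
  rs_mass : forall K phi, test_function K phi ->
    weak_balance fst snd w Ua Ub K phi = 0;
  rs_momentum : forall K phi, test_function K phi ->
    weak_balance snd (momentum_flux c) w Ua Ub K phi = 0;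
  rs_entropy : forall K phi, test_function K phi ->
    (forall t x, 0 <= t -> 0 <= phi t x) ->
    0 <= weak_balance (energy c) (energy_flux c) w Ua Ub K phi
}.

Definition U_minus (c : R) (UL : R * R) (v : R) (U : R * R) : Prop :=
  exists (Ub : R * R) (w : R -> R * R),
    0 < fst Ub /\ riemann_solution c UL Ub w /\
    filterlim w (at_left v) (locally U).

Definition U_plus (c : R) (UR : R * R) (v : R) (U : R * R) : Prop :=
  exists (Ua : R * R) (w : R -> R * R),
    0 < fst Ua /\ riemann_solution c Ua UR w /\
    filterlim w (at_right v) (locally U).

Definition V_minus (c rhoL alphaL v : R) (S : R * R) : Prop :=
  exists rho q : R,
    U_minus c (rhoL, alphaL + v * rhoL) v (rho, q) /\ S = (rho, q - v * rho).

Definition V_plus (c rhoR alphaR v : R) (S : R * R) : Prop :=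
  exists rho q : R,
    U_plus c (rhoR, alphaR + v * rhoR) v (rho, q) /\ S = (rho, q - v * rho).

Definition Omega_minus_sup (c rhoL alphaL v : R) (S : R * R) : Prop :=
  V_minus c rhoL alphaL v S /\ snd S < - c * fst S.

(** The integral is oriented: it is minus the integral over
    [[rho, |alpha|/c]] when [rho < |alpha|/c]. *)
Definition F (c : R) (D : R -> R -> R) (alpha rho : R) : R :=
  RInt (fun r => 1 / Rabs (D r alpha) * (c ^ 2 - alpha ^ 2 / r ^ 2))
    (Rabs alpha / c) rho.

Definition germ (c : R) (D : R -> R -> R) (v : R) (Um Up : R * R) : Prop :=
  let '(rhom, qm) := Um in
  let '(rhop, qp) := Up in
  let alpha := qm - v * rhom in
  0 < rhom /\ 0 < rhop /\ alpha = qp - v * rhop /\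
  ( (alpha = 0 /\ rhom = rhop /\ qm = qp)
    \/
    (0 < alpha /\ 0 <= (alpha / c - rhop) * (alpha / c - rhom) /\
     F c D alpha rhom - F c D alpha rhop = 1)
    \/
    (alpha < 0 /\ 0 <= (Rabs alpha / c - rhop) * (Rabs alpha / c - rhom) /\
     F c D alpha rhop - F c D alpha rhom = 1)
    \/
    (c * rhom < alpha /\ alpha / c <= rhop /\
     exists rho theta : R,
       rhom <= rho < alpha / c /\ 0 <= theta <= 1 /\
       F c D alpha rhom - F c D alpha rho = theta /\
       F c D alpha (alpha ^ 2 / (c ^ 2 * rho)) - F c D alpha rhop = 1 - theta)
    \/
    (alpha < - c * rhop /\ Rabs alpha / c <= rhom /\
     exists rho theta : R,
       rhop <= rho < Rabs alpha / c /\ 0 <= theta <= 1 /\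
       F c D alpha rhop - F c D alpha rho = theta /\
       F c D alpha (alpha ^ 2 / (c ^ 2 * rho)) - F c D alpha rhom
         = 1 - theta) ).

(** From [(rho, alpha)] to [(rho, q)], where [alpha = q - v rho]. *)
Definition unshift (v : R) (S : R * R) : R * R := (fst S, snd S + v * fst S).

(* Main.v *)
Require Import Defs.
From Stdlib Require Import Reals Lra Lia Classical ClassicalEpsilon.
From Coquelicot Require Import Coquelicot.

Open Scope R_scope.

(** The proof determines the accessible sets, and then solves the coupling
    problem by monotonicity.

    Structure of the Riemann solutions.  Let [w (x / t)] be an entropy
    solution.  In the frame of the ray of speed [xi] the mass flux
    [alpha = q - xi rho] and the momentum flux [P = alpha^2 / rho + c^2 rho] are
    continuous functions of [xi], even across shocks, with right derivatives
    [- rho] and [- 2 alpha]; the energy inequality reduces to the compression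
    of the gas across each jump ([profile_of_solution]).  Now
    [P - 2 c alpha = (alpha - c rho)^2 / rho] and
    [P + 2 c alpha = (alpha + c rho)^2 / rho] are continuous, nonnegative, and
    have right derivatives [- 2 (alpha - c rho)] and [- 2 (alpha + c rho)].
    As the entropy condition excludes jumps from negative to positive values,
    each of [alpha - c rho] and [alpha + c rho] is positive, then zero, then
    negative ([sign_zones]).  Where neither vanishes the state is constant,
    and where one of them vanishes the density is exponential in [xi]: the
    solution consists of three constant states separated by a slow and a fast
    wave, each one a shock or a rarefaction fan ([two_wave_structure]).
    Conversely every such field is an entropy solution ([two_wave_solution]),
    and two states are always connected by one of them
    ([riemann_middle_density]).

    Accessible sets.  The traces on the left of the particle are thus described
    explicitly by the wave curve [phi] of the left state ([V_minus_iff]); those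
    on the right follow by reflection ([V_plus_iff]).

    Coupling with a positive mass flux [a].  A subsonic left trace has density
    [p] with [a = p (phi p)], which decreases with [p]; a subsonic right trace
    has density [q], an increasing function of [a]; and the germ requires
    [F_a p - F_a q = 1].  As [a] increases, [p] decreases, [q] increases and the
    slope of [F_a] decreases ([F_gap_decr]), so that the gap of [F] decreases
    strictly: there is at most one solution.  The gap tends to infinity as [a]
    tends to [0], whence existence ([positive_exists]), unless the left state is
    supersonic and the gap is still at least [1] at its own flux.  In that case
    the left state is the trace, [a] is its flux, and the position of a shock
    inside the particle, or the absence of one, replaces the parameter [a]:
    as [|D|] decreases with the density, [F_conj_gap] makes the resulting gap
    monotone.  In all cases a coupled pair can be compared with a subsonic one
    ([representative]).

    Sign of the flux.  Let [zL] and [zR] be the densities at which the wave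
    curves of the left and right states reach the velocity of the particle.  The
    flux is positive, zero or negative according to the sign of [zL - zR].
    Negative fluxes are reduced to positive ones by the reflection
    [D (rho, alpha) -> - D (rho, - alpha)] ([coupled_mirror]). *)

(** * Continuity of real expressions *)

(* Restores the type [R] of an equation stated in a carrier that unfolds to it. *)
Ltac eqR := match goal with |- @eq _ ?x ?y => change (@eq R x y) end.

Section RealContinuity.
Context {U : UniformSpace}.
Implicit Types (f g : U -> R) (x : U).

Lemma cont_plus f g x : continuous f x -> continuous g x -> continuous (fun y => f y + g y) x.
Proof. apply (continuous_plus (V := R_NormedModule)). Qed.

Lemma cont_minus f g x : continuous f x -> continuous g x -> continuous (fun y => f y - g y) x.
Proof. apply (continuous_minus (V := R_NormedModule)). Qed.

Lemma cont_opp f x : continuous f x -> continuous (fun y => - f y) x.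
Proof. apply (continuous_opp (V := R_NormedModule)). Qed.

Lemma cont_mult f g x : continuous f x -> continuous g x -> continuous (fun y => f y * g y) x.
Proof. apply (continuous_mult (K := R_AbsRing)). Qed.

Lemma cont_inv f x : continuous f x -> f x <> 0 -> continuous (fun y => / f y) x.
Proof.
  intros hf h0. apply (continuous_comp f Rinv); [assumption|].
  apply continuity_pt_filterlim. apply continuity_pt_inv; [|assumption].
  apply derivable_continuous_pt, derivable_pt_id.
Qed.

Lemma cont_div f g x : continuous f x -> continuous g x -> g x <> 0 ->
  continuous (fun y => f y / g y) x.
Proof. intros hf hg h0. apply cont_mult; [assumption|]. apply cont_inv; assumption. Qed.

Lemma cont_pow f n x : continuous f x -> continuous (fun y => f y ^ n) x.
Proof.
  intros hf. induction n; simpl; [apply continuous_const|]. apply cont_mult; assumption.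
Qed.

Lemma cont_exp f x : continuous f x -> continuous (fun y => exp (f y)) x.
Proof.
  intros hf. apply (continuous_comp f exp); [assumption|].
  apply continuity_pt_filterlim, derivable_continuous_pt, derivable_pt_exp.
Qed.

Lemma cont_ln f x : continuous f x -> 0 < f x -> continuous (fun y => ln (f y)) x.
Proof.
  intros hf h0. apply (continuous_comp f ln); [assumption|].
  apply (ex_derive_continuous (V := R_NormedModule)). eexists. apply is_derive_Reals. apply derivable_pt_lim_ln; assumption.
Qed.

Lemma cont_sqrt f x : continuous f x -> continuous (fun y => sqrt (f y)) x.
Proof.
  intros hf. apply (continuous_comp f sqrt); [assumption|]. apply continuous_sqrt.
Qed.

Lemma cont_abs f x : continuous f x -> continuous (fun y => Rabs (f y)) x.
Proof.
  intros hf. apply (continuous_comp f Rabs); [assumption|]. apply continuous_Rabs.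
Qed.

Lemma cont_max f g x : continuous f x -> continuous g x -> continuous (fun y => Rmax (f y) (g y)) x.
Proof.
  intros hf hg.
  apply continuous_ext with (fun y => (f y + g y + Rabs (f y - g y)) / 2).
  - intros y. eqR. unfold Rmax. destruct (Rle_dec (f y) (g y)).
    + rewrite Rabs_left1 by lra. lra.
    + rewrite Rabs_pos_eq by lra. lra.
  - apply cont_div; [|apply continuous_const|lra].
    apply cont_plus; [apply cont_plus; assumption|]. apply cont_abs, cont_minus; assumption.
Qed.

Lemma cont_min f g x : continuous f x -> continuous g x -> continuous (fun y => Rmin (f y) (g y)) x.
Proof.
  intros hf hg.
  apply continuous_ext with (fun y => - Rmax (- f y) (- g y)).
  - intros y. eqR. rewrite <- Ropp_Rmin. ring.
  - apply cont_opp, cont_max; apply cont_opp; assumption.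
Qed.

End RealContinuity.

(* The head symbol is matched first, so that constants are never unfolded. *)
Ltac cont :=
  repeat (first [ assumption | apply continuous_const | apply continuous_id
                | apply continuous_fst | apply continuous_snd
                | match goal with
                  | |- continuous (fun y => Rplus _ _) _ => apply cont_plus
                  | |- continuous (fun y => Rminus _ _) _ => apply cont_minus
                  | |- continuous (fun y => Ropp _) _ => apply cont_opp
                  | |- continuous (fun y => Rmult _ _) _ => apply cont_mult
                  | |- continuous (fun y => pow _ _) _ => apply cont_pow
                  | |- continuous (fun y => exp _) _ => apply cont_exp
                  | |- continuous (fun y => sqrt _) _ => apply cont_sqrt
                  | |- continuous (fun y => Rabs _) _ => apply cont_abs
                  | |- continuous (fun y => Rmax _ _) _ => apply cont_max
                  | |- continuous (fun y => Rmin _ _) _ => apply cont_min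
                  | |- continuous (fun y => Rdiv _ _) _ => apply cont_div
                  | |- continuous (fun y => Rinv _) _ => apply cont_inv
                  | |- continuous (fun y => ln _) _ => apply cont_ln
                  | |- continuous (Rplus ?k) ?x => change (continuous (fun y => Rplus k y) x)
                  | |- continuous (Rminus ?k) ?x => change (continuous (fun y => Rminus k y) x)
                  | |- continuous (Rmult ?k) ?x => change (continuous (fun y => Rmult k y) x)
                  | |- continuous (Rdiv ?k) ?x => change (continuous (fun y => Rdiv k y) x)
                  | |- continuous (Rmax ?k) ?x => change (continuous (fun y => Rmax k y) x)
                  | |- continuous (Rmin ?k) ?x => change (continuous (fun y => Rmin k y) x)
                  | |- continuous Ropp ?x => change (continuous (fun y => Ropp y) x)
                  | |- continuous exp ?x => change (continuous (fun y => exp y) x)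
                  | |- continuous sqrt ?x => change (continuous (fun y => sqrt y) x)
                  | |- continuous Rabs ?x => change (continuous (fun y => Rabs y) x)
                  | |- continuous Rinv ?x => change (continuous (fun y => Rinv y) x)
                  | |- continuous ln ?x => change (continuous (fun y => ln y) x)
                  end ]).

(** * One-sided limits and integrability *)

(** Local-to-global principle on a segment: the supremum of the points reachable
    from [a] is reachable, and is not less than [b]. *)
Lemma interval_induction (Q : R -> R -> Prop) (a b : R) :
  a <= b ->
  (forall x y z, x <= y -> y <= z -> Q x y -> Q y z -> Q x z) ->
  (forall x, a <= x <= b -> exists d, 0 < d /\
     forall y z, a <= y -> z <= b -> x - d < y -> y <= x -> x <= z -> z < x + d -> Q y z) ->
  Q a b.
Proof.
  intros hab hglue hloc.
  set (E := fun y => a <= y <= b /\ Q a y).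
  destruct (completeness E) as [s [hs1 hs2]].
  { exists b. intros y [hy _]. lra. }
  { exists a. split; [lra|]. destruct (hloc a) as [d [hd h]]; [lra|].
    apply h; lra. }
  assert (has : a <= s).
  { apply hs1. split; [lra|]. destruct (hloc a) as [d [hd h]]; [lra|].
    apply h; lra. }
  assert (hsb : s <= b) by (apply hs2; intros y [hy _]; lra).
  destruct (hloc s) as [d [hd h]]; [lra|].
  assert (hy : exists y, E y /\ s - d < y).
  { apply NNPP. intros hn. assert (s <= s - d); [|lra].
    apply hs2. intros y hy. destruct (Rle_dec y (s - d)); [assumption|].
    exfalso. apply hn. exists y. split; [assumption|lra]. }
  destruct hy as [y [hy1 hy2]].
  pose proof (hs1 y hy1) as hy3. destruct hy1 as [hy1 hy4].
  set (z := Rmin b (s + d / 2)).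
  assert (hz : s <= z /\ z <= b /\ z <= s + d/2).
  { unfold z. unfold Rmin. destruct (Rle_dec b (s + d/2)); lra. }
  assert (hz2 : Q a z).
  { apply (hglue a y z); try lra; [assumption|]. apply h; lra. }
  destruct (Rle_lt_dec b (s + d/2)) as [hb|hb].
  - replace b with z; [assumption|]. unfold z. rewrite Rmin_left; lra.
  - exfalso. assert (z <= s); [|unfold z in *; rewrite Rmin_right in * by lra; lra].
    apply hs1. split; [lra|assumption].
Qed.

Lemma right_limit_eps (f : R -> R) (x l : R) :
  filterlim f (at_right x) (locally l) <->
  forall e, 0 < e -> exists d, 0 < d /\ forall y, x < y < x + d -> Rabs (f y - l) < e.
Proof.
  split.
  - intros h e he. destruct (proj1 (filterlim_locally f l) h (mkposreal e he)) as [d hd].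
    exists d. split; [apply cond_pos|]. intros y hy. apply hd; [|lra].
    change (Rabs (y - x) < d). rewrite Rabs_pos_eq; lra.
  - intros h. apply filterlim_locally. intros e.
    destruct (h e (cond_pos e)) as [d [hd hy]]. exists (mkposreal d hd).
    intros y hb hxy. change (Rabs (y - x) < d) in hb. apply hy.
    apply Rabs_def2 in hb. lra.
Qed.

Lemma left_limit_eps (f : R -> R) (x l : R) :
  filterlim f (at_left x) (locally l) <->
  forall e, 0 < e -> exists d, 0 < d /\ forall y, x - d < y < x -> Rabs (f y - l) < e.
Proof.
  split.
  - intros h e he. destruct (proj1 (filterlim_locally f l) h (mkposreal e he)) as [d hd].
    exists d. split; [apply cond_pos|]. intros y hy. apply hd; [|lra].
    change (Rabs (y - x) < d). rewrite Rabs_left; lra.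
  - intros h. apply filterlim_locally. intros e.
    destruct (h e (cond_pos e)) as [d [hd hy]]. exists (mkposreal d hd).
    intros y hb hxy. change (Rabs (y - x) < d) in hb. apply hy.
    apply Rabs_def2 in hb. lra.
Qed.

Lemma continuous_eps (f : R -> R) (x : R) :
  continuous f x <->
  forall e, 0 < e -> exists d, 0 < d /\ forall y, Rabs (y - x) < d -> Rabs (f y - f x) < e.
Proof.
  split.
  - intros h e he. destruct (proj1 (filterlim_locally f (f x)) h (mkposreal e he)) as [d hd].
    exists d. split; [apply cond_pos|]. intros y hy. apply hd. exact hy.
  - intros h. apply filterlim_locally. intros e.
    destruct (h e (cond_pos e)) as [d [hd hy]]. exists (mkposreal d hd).
    intros y hb. apply hy. exact hb.
Qed.

(** The fields under study only have one-sided limits; this is the class in which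
    their integrals are taken. *)
Definition regulated (f : R -> R) : Prop :=
  forall x, (exists l, filterlim f (at_left x) (locally l)) /\
            (exists l, filterlim f (at_right x) (locally l)).

(** Near each point a regulated function is close to one constant on the left
    and to another one on the right; such approximations are patched together. *)
Lemma regulated_uniform_approx (f : R -> R) (a b e : R) :
  regulated f -> a <= b -> 0 < e ->
  exists g, ex_RInt g a b /\ forall x, a <= x <= b -> Rabs (f x - g x) <= e.
Proof.
  intros hf hab he.
  apply (interval_induction
    (fun u v => exists g, ex_RInt g u v /\ forall x, u <= x <= v -> Rabs (f x - g x) <= e));
    [assumption| |].
  - intros x y z hxy hyz [g1 [h1 k1]] [g2 [h2 k2]].
    exists (fun t => if Rle_dec t y then g1 t else g2 t). split.
    + apply ex_RInt_Chasles with y.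
      * apply ex_RInt_ext with g1; [|assumption]. intros t. rewrite Rmin_left, Rmax_right by lra.
        intros ht. destruct (Rle_dec t y); [reflexivity|lra].
      * apply ex_RInt_ext with g2; [|assumption]. intros t. rewrite Rmin_left, Rmax_right by lra.
        intros ht. destruct (Rle_dec t y); [lra|reflexivity].
    + intros t ht. destruct (Rle_dec t y); [apply k1|apply k2]; lra.
  - intros x _. destruct (hf x) as [[l hl] [r hr]].
    destruct (proj1 (left_limit_eps f x l) hl e he) as [d1 [hd1 k1]].
    destruct (proj1 (right_limit_eps f x r) hr e he) as [d2 [hd2 k2]].
    exists (Rmin d1 d2). split; [apply Rmin_pos; assumption|].
    pose proof (Rmin_l d1 d2). pose proof (Rmin_r d1 d2).
    intros y z _ _ hy1 hy2 hz1 hz2.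
    exists (fun t => if Rlt_dec t x then l else if Rlt_dec x t then r else f x). split.
    + apply ex_RInt_Chasles with x.
      * apply ex_RInt_ext with (fun _ => l); [|apply ex_RInt_const].
        intros t. rewrite Rmin_left, Rmax_right by lra. intros ht.
        destruct (Rlt_dec t x); [reflexivity|lra].
      * apply ex_RInt_ext with (fun _ => r); [|apply ex_RInt_const].
        intros t. rewrite Rmin_left, Rmax_right by lra. intros ht.
        destruct (Rlt_dec t x); [lra|]. destruct (Rlt_dec x t); [reflexivity|lra].
    + intros t ht. destruct (Rlt_dec t x); [left; apply k1; lra|].
      destruct (Rlt_dec x t); [left; apply k2; lra|].
      replace t with x by lra. rewrite Rminus_diag, Rabs_R0. lra.
Qed.

(** Uniform limits of integrable functions are integrable. *)
Lemma ex_RInt_regulated_le (f : R -> R) (a b : R) :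
  a <= b -> regulated f -> ex_RInt f a b.
Proof.
  intros hab hf.
  assert (hg : forall n : nat, exists g, ex_RInt g a b /\
     forall x, a <= x <= b -> Rabs (f x - g x) <= / (INR n + 1)).
  { intros n. apply regulated_uniform_approx; try assumption.
    apply Rinv_0_lt_compat. pose proof (pos_INR n). lra. }
  (* Outside [a,b] the approximants are replaced by [f], so that they
     converge uniformly on the whole line. *)
  assert (hg' : forall n : nat, exists g, ex_RInt g a b /\
     forall x, Rabs (f x - g x) <= / (INR n + 1)).
  { intros n. destruct (hg n) as [g [h1 h2]].
    exists (fun x => if Rle_dec a x then if Rle_dec x b then g x else f x else f x).
    split.
    - apply ex_RInt_ext with g; [|assumption]. intros t.
      rewrite Rmin_left, Rmax_right by lra. intros ht.
      destruct (Rle_dec a t); [|lra]. destruct (Rle_dec t b); [reflexivity|lra].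
    - intros x. assert (0 <= / (INR n + 1)).
      { left. apply Rinv_0_lt_compat. pose proof (pos_INR n). lra. }
      destruct (Rle_dec a x); [destruct (Rle_dec x b)|]; try (apply h2; lra);
      rewrite Rminus_diag, Rabs_R0; assumption. }
  set (G := fun n : nat => proj1_sig (constructive_indefinite_description _ (hg' n))).
  assert (hG : forall n, ex_RInt (G n) a b /\ forall x, Rabs (f x - G n x) <= / (INR n + 1)).
  { intros n. unfold G. apply (proj2_sig (constructive_indefinite_description _ (hg' n))). }
  destruct (filterlim_RInt G a b eventually eventually_filter f (fun n => RInt (G n) a b))
    as [I [_ hI]].
  - intros n. apply RInt_correct. apply hG.
  - apply filterlim_locally. intros e.
    destruct (archimed_cor1 e (cond_pos e)) as [N [hN hN0]].
    exists N. intros n hn t.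
    change (Rabs (G n t - f t) < e). rewrite Rabs_minus_sym.
    eapply Rle_lt_trans; [apply hG|]. eapply Rlt_trans; [|exact hN].
    apply Rinv_lt_contravar.
    + apply Rmult_lt_0_compat; [apply (lt_INR 0); lia | pose proof (pos_INR n); lra].
    + apply Rle_lt_trans with (INR n); [apply le_INR; lia | lra].
  - exists I. exact hI.
Qed.

Lemma ex_RInt_regulated (f : R -> R) (a b : R) : regulated f -> ex_RInt f a b.
Proof.
  intros hf. destruct (Rle_dec a b).
  - apply ex_RInt_regulated_le; assumption.
  - apply ex_RInt_swap. apply ex_RInt_regulated_le; [lra|assumption].
Qed.

Lemma regulated_continuous (f : R -> R) : (forall x, continuous f x) -> regulated f.
Proof.
  intros h x. split; exists (f x); apply filterlim_filter_le_1 with (2 := h x);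
  apply filter_le_within.
Qed.

Lemma regulated_mult (f g : R -> R) :
  regulated f -> regulated g -> regulated (fun x => f x * g x).
Proof.
  intros hf hg x. destruct (hf x) as [[l1 h1] [r1 k1]]. destruct (hg x) as [[l2 h2] [r2 k2]].
  split; [exists (l1 * l2)|exists (r1 * r2)];
  (eapply filterlim_comp_2; [eassumption|eassumption|apply (filterlim_mult (K := R_AbsRing))]).
Qed.

Lemma regulated_plus (f g : R -> R) :
  regulated f -> regulated g -> regulated (fun x => f x + g x).
Proof.
  intros hf hg x. destruct (hf x) as [[l1 h1] [r1 k1]]. destruct (hg x) as [[l2 h2] [r2 k2]].
  split; [exists (l1 + l2)|exists (r1 + r2)];
  (eapply filterlim_comp_2; [eassumption|eassumption|apply (filterlim_plus (V := R_NormedModule))]).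
Qed.

Lemma regulated_minus (f g : R -> R) :
  regulated f -> regulated g -> regulated (fun x => f x - g x).
Proof.
  intros hf hg.
  assert (h : regulated (fun x => f x + (-1) * g x)).
  { apply regulated_plus; [assumption|]. apply regulated_mult; [|assumption].
    apply regulated_continuous. intros x. apply continuous_const. }
  intros x. destruct (h x) as [[l hl] [r hr]]. split; [exists l|exists r];
  (eapply filterlim_ext; [|eassumption]; intros y; simpl; ring).
Qed.

Lemma regulated_scale (f : R -> R) (k : R) :
  0 < k -> regulated f -> regulated (fun x => f (k * x)).
Proof.
  intros hk hf x. destruct (hf (k * x)) as [[l hl] [r hr]].
  split; [exists l|exists r].
  - apply left_limit_eps. intros e he. destruct (proj1 (left_limit_eps _ _ _) hl e he) as [d [hd h]].
    exists (d / k). split; [apply Rdiv_lt_0_compat; assumption|].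
    intros y hy. apply h. replace d with (k * (d / k)) by (field; lra). split; [rewrite <- Rmult_minus_distr_l|]; apply Rmult_lt_compat_l; lra.
  - apply right_limit_eps. intros e he. destruct (proj1 (right_limit_eps _ _ _) hr e he) as [d [hd h]].
    exists (d / k). split; [apply Rdiv_lt_0_compat; assumption|].
    intros y hy. apply h. replace d with (k * (d / k)) by (field; lra). split; [|rewrite <- Rmult_plus_distr_l]; apply Rmult_lt_compat_l; lra.
Qed.

(** * Right derivatives *)

Definition right_derive (f : R -> R) (x l : R) : Prop :=
  forall e, 0 < e -> exists d, 0 < d /\
    forall h, 0 < h < d -> Rabs (f (x + h) - f x - l * h) <= e * h.

Lemma right_derive_is_derive (f : R -> R) (x l : R) : is_derive f x l -> right_derive f x l.
Proof.
  intros h e he. apply is_derive_Reals in h. destruct (h e he) as [d hd].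
  exists d. split; [apply cond_pos|]. intros k hk.
  specialize (hd k). assert (hk0 : k <> 0) by lra. specialize (hd hk0).
  rewrite Rabs_pos_eq in hd by lra. specialize (hd ltac:(lra)).
  replace (f (x + k) - f x - l * k) with (((f (x+k) - f x)/k - l) * k) by (field; lra).
  rewrite Rabs_mult, (Rabs_pos_eq k) by lra. apply Rmult_le_compat_r; lra.
Qed.

Lemma right_derive_plus (f g : R -> R) (x l m : R) :
  right_derive f x l -> right_derive g x m -> right_derive (fun y => f y + g y) x (l + m).
Proof.
  intros hf hg e he. destruct (hf (e/2)) as [d1 [hd1 h1]]; [lra|].
  destruct (hg (e/2)) as [d2 [hd2 h2]]; [lra|].
  exists (Rmin d1 d2). split; [apply Rmin_pos; assumption|].
  intros h hh. pose proof (Rmin_l d1 d2). pose proof (Rmin_r d1 d2).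
  specialize (h1 h ltac:(lra)). specialize (h2 h ltac:(lra)).
  replace (f (x+h) + g (x+h) - (f x + g x) - (l+m)*h)
    with ((f (x+h) - f x - l*h) + (g (x+h) - g x - m*h)) by ring.
  eapply Rle_trans; [apply Rabs_triang|]. lra.
Qed.

Lemma right_derive_scal (f : R -> R) (x l k : R) :
  right_derive f x l -> right_derive (fun y => k * f y) x (k * l).
Proof.
  intros hf e he. destruct (hf (e / (Rabs k + 1))) as [d [hd h]].
  { apply Rdiv_lt_0_compat; [assumption|]. pose proof (Rabs_pos k). lra. }
  exists d. split; [assumption|]. intros y hy. specialize (h y hy).
  replace (k * f (x+y) - k * f x - k*l*y) with (k * (f (x+y) - f x - l*y)) by ring.
  rewrite Rabs_mult. pose proof (Rabs_pos k).
  apply Rle_trans with (Rabs k * (e / (Rabs k + 1) * y)); [apply Rmult_le_compat_l; assumption|].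
  assert (Rabs k / (Rabs k + 1) <= 1).
  { apply Rle_div_l; lra. }
  replace (Rabs k * (e / (Rabs k + 1) * y)) with ((Rabs k / (Rabs k + 1)) * (e * y)) by (field; lra).
  assert (0 <= e * y) by (apply Rmult_le_pos; lra). nra.
Qed.

Lemma right_derive_minus (f g : R -> R) (x l m : R) :
  right_derive f x l -> right_derive g x m -> right_derive (fun y => f y - g y) x (l - m).
Proof.
  intros hf hg. pose proof (right_derive_plus _ _ _ _ _ hf (right_derive_scal _ _ _ (-1) hg)) as h.
  intros e he. destruct (h e he) as [d [hd k]]. exists d. split; [assumption|].
  intros y hy. specialize (k y hy). simpl in k.
  replace (f (x+y) - g (x+y) - (f x - g x) - (l-m)*y)
   with (f (x + y) + -1 * g (x + y) - (f x + -1 * g x) - (l + -1 * m) * y) by ring. assumption.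
Qed.

Lemma right_derive_ext (f g : R -> R) (x l : R) (e0 : R) :
  0 < e0 -> (forall y, x <= y < x + e0 -> f y = g y) ->
  right_derive f x l -> right_derive g x l.
Proof.
  intros he0 hfg hf e he. destruct (hf e he) as [d [hd h]].
  exists (Rmin d e0). split; [apply Rmin_pos; assumption|].
  pose proof (Rmin_l d e0). pose proof (Rmin_r d e0).
  intros y hy. rewrite <- !hfg by lra. apply h. lra.
Qed.

Lemma right_derive_comp (g f : R -> R) (x l m : R) :
  right_derive f x l -> is_derive g (f x) m -> right_derive (fun y => g (f y)) x (m * l).
Proof.
  intros hf hg e he. apply is_derive_Reals in hg.
  set (M := Rabs l + 1). assert (hM : 0 < M) by (unfold M; pose proof (Rabs_pos l); lra).
  destruct (hg (e / (2 * M))) as [d1 hd1]; [apply Rdiv_lt_0_compat; lra|].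
  destruct (hf 1) as [d2 [hd2 h2]]; [lra|].
  destruct (hf (e / (2 * (Rabs m + 1)))) as [d3 [hd3 h3]].
  { apply Rdiv_lt_0_compat; [lra|]. pose proof (Rabs_pos m); lra. }
  exists (Rmin (Rmin d2 d3) (d1 / M)). split.
  { repeat apply Rmin_pos; try assumption. apply Rdiv_lt_0_compat; [apply cond_pos|assumption]. }
  intros h hh.
  pose proof (Rmin_l (Rmin d2 d3) (d1/M)). pose proof (Rmin_r (Rmin d2 d3) (d1/M)).
  pose proof (Rmin_l d2 d3). pose proof (Rmin_r d2 d3).
  specialize (h2 h ltac:(lra)). specialize (h3 h ltac:(lra)).
  set (k := f (x + h) - f x) in *.
  assert (hk : Rabs k <= M * h).
  { replace k with ((k - l * h) + l * h) by ring. eapply Rle_trans; [apply Rabs_triang|].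
    rewrite Rabs_mult, (Rabs_pos_eq h) by lra. unfold M. nra. }
  assert (hkd : Rabs k < d1).
  { eapply Rle_lt_trans; [exact hk|]. replace (pos d1) with (M * (d1/M)) by (field; lra).
    apply Rmult_lt_compat_l; lra. }
  assert (hg1 : Rabs (g (f (x+h)) - g (f x) - m * k) <= e / (2*M) * Rabs k).
  { destruct (Req_dec k 0) as [hk0|hk0].
    - rewrite hk0, Rabs_R0. unfold k in hk0. replace (f (x+h)) with (f x) by lra.
      rewrite Rmult_0_r, Rmult_0_r. replace (g (f x) - g (f x) - 0) with 0 by ring. rewrite Rabs_R0; lra.
    - specialize (hd1 k hk0 hkd). replace (f (x+h)) with (f x + k) by (unfold k; ring).
      replace (g (f x + k) - g (f x) - m * k) with (((g (f x + k) - g (f x))/k - m) * k) by (field; assumption).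
      rewrite Rabs_mult. apply Rmult_le_compat_r; [apply Rabs_pos|lra]. }
  replace (g (f (x+h)) - g (f x) - m * l * h) with
    ((g (f (x+h)) - g (f x) - m*k) + m * (k - l*h)) by ring.
  eapply Rle_trans; [apply Rabs_triang|].
  rewrite Rabs_mult.
  assert (hA : e / (2*M) * Rabs k <= e / 2 * h).
  { replace (e/2*h) with (e/(2*M) * (M * h)) by (field; lra).
    apply Rmult_le_compat_l; [|assumption]. left. apply Rdiv_lt_0_compat; lra. }
  assert (hB : Rabs m * Rabs (k - l*h) <= e/2*h).
  { pose proof (Rabs_pos m). apply Rle_trans with ((Rabs m + 1) * Rabs (k - l*h)).
    - apply Rmult_le_compat_r; [apply Rabs_pos|lra].
    - replace (e/2*h) with ((Rabs m + 1) * (e / (2*(Rabs m + 1)) * h)) by (field; lra).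
      apply Rmult_le_compat_l; lra. }
  lra.
Qed.

(** The product rule, by polarization. *)
Lemma right_derive_mult (f g : R -> R) (x l m : R) :
  right_derive f x l -> right_derive g x m ->
  right_derive (fun y => f y * g y) x (l * g x + f x * m).
Proof.
  intros hf hg.
  assert (hsq : forall h k, right_derive h x k -> right_derive (fun y => (h y) ^ 2) x (2 * h x * k)).
  { intros h k hh. apply (right_derive_comp (fun z => z ^ 2)); [assumption|].
    auto_derive; [trivial|ring]. }
  apply (right_derive_ext (fun y => / 4 * ((f y + g y) ^ 2 - (f y - g y) ^ 2)) _ x _ 1);
    [lra|intros; field|].
  replace (l * g x + f x * m) with
    (/ 4 * (2 * (f x + g x) * (l + m) - 2 * (f x - g x) * (l - m))) by field.
  apply right_derive_scal, right_derive_minus.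
  - apply (hsq (fun y => f y + g y)), right_derive_plus; assumption.
  - apply (hsq (fun y => f y - g y)), right_derive_minus; assumption.
Qed.

(** Continuity and the sign of the right derivatives are enough for monotonicity,
    whatever happens on the left of the points. *)
Lemma right_derive_ge0_le (f : R -> R) (a b : R) :
  a <= b ->
  (forall x, a <= x <= b -> continuous f x) ->
  (forall x, a <= x < b -> exists l, 0 <= l /\ right_derive f x l) ->
  f a <= f b.
Proof.
  intros hab hc hd.
  apply Rnot_lt_le. intros hlt.
  set (e := (f a - f b) / (2 * (b - a))).
  assert (hab' : a < b). { destruct (Rle_lt_or_eq_dec _ _ hab); [assumption|subst; lra]. }
  assert (he : 0 < e) by (apply Rdiv_lt_0_compat; lra).
  assert (h : f a - e * (b - a) <= f b).
  { (* The set of points up to which [f] stays above the line of slope [-e]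
       is closed, and open to the right. *)
    set (E := fun y => a <= y <= b /\ forall z, a <= z <= y -> f a - e * (z - a) <= f z).
    destruct (completeness E) as [s [hs1 hs2]].
    { exists b. intros y [hy _]; lra. }
    { exists a. split; [lra|]. intros z hz. replace z with a by lra. lra. }
    assert (has : a <= s).
    { apply hs1. split; [lra|]. intros z hz. replace z with a by lra. lra. }
    assert (hsb : s <= b) by (apply hs2; intros y [hy _]; lra).
    assert (hbelow : forall z, a <= z < s -> f a - e * (z - a) <= f z).
    { intros z hz. apply NNPP. intros hn. assert (s <= z); [|lra].
      apply hs2. intros y [hy1 hy2]. apply Rnot_lt_le. intros hzy. apply hn. apply hy2. lra. }
    assert (hs : f a - e * (s - a) <= f s).
    { apply Rnot_lt_le. intros hn.
      destruct (Rle_lt_or_eq_dec _ _ has) as [has'|has']; [|subst s; lra].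
      destruct (proj1 (continuous_eps f s) (hc s ltac:(lra)) ((f a - e * (s-a) - f s)/1)) as [d [hd1 hd2]]; [lra|].
      set (z := Rmax a (s - d/2)).
      assert (hz : a <= z < s /\ s - d < z).
      { unfold z. unfold Rmax. destruct (Rle_dec a (s - d/2)); lra. }
      specialize (hbelow z (proj1 hz)). specialize (hd2 z).
      assert (Rabs (z - s) < d) by (rewrite Rabs_left; lra). specialize (hd2 H).
      apply Rabs_def2 in hd2. nra. }
    destruct (Rle_lt_or_eq_dec _ _ hsb) as [hsb'|hsb']; [|subst s; assumption].
    exfalso. destruct (hd s ltac:(lra)) as [l [hl0 hl]].
    destruct (hl e he) as [d [hd1 hd2]].
    assert (hmin : 0 < Rmin d (b - s)) by (apply Rmin_pos; lra).
    pose proof (Rmin_l d (b - s)). pose proof (Rmin_r d (b - s)).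
    set (y := s + Rmin d (b-s) / 2). assert (y <= s); [|unfold y in *; lra].
    apply hs1. split; [unfold y; lra|]. intros z hz.
    destruct (Rlt_le_dec z s) as [h1|h1]; [apply hbelow; lra|].
    destruct (Rle_lt_or_eq_dec _ _ h1) as [h2|h2]; [|subst z; assumption].
    specialize (hd2 (z - s)). assert (0 < z - s < d) by (unfold y in hz; lra).
    specialize (hd2 H1). replace (s + (z - s)) with z in hd2 by ring.
    apply Rabs_le_between in hd2. assert (0 <= l * (z - s)) by (apply Rmult_le_pos; lra). nra. }
  assert (e * (b - a) = (f a - f b)/2) by (unfold e; field; lra). lra.
Qed.

Lemma right_derive_0_eq (f : R -> R) (a b : R) :
  a <= b ->
  (forall x, a <= x <= b -> continuous f x) ->
  (forall x, a <= x < b -> right_derive f x 0) ->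
  f a = f b.
Proof.
  intros hab hc hd. apply Rle_antisym.
  - apply right_derive_ge0_le; try assumption. intros x hx. exists 0. split; [lra|]. apply hd; assumption.
  - enough (-1 * f a <= -1 * f b) by lra.
    apply (right_derive_ge0_le (fun x => -1 * f x)); try assumption.
    + intros x hx. apply cont_mult; [cont|]. apply hc; assumption.
    + intros x hx. exists (-1 * 0). split; [lra|]. apply right_derive_scal. apply hd; assumption.
Qed.

Lemma RInt_const_R (a b m : R) : RInt (fun _ => m) a b = m * (b - a).
Proof.
  rewrite RInt_const. apply Rmult_comm.
Qed.

Lemma right_derive_RInt (f : R -> R) (a x l : R) :
  regulated f -> filterlim f (at_right x) (locally l) ->
  right_derive (fun y => RInt f a y) x l.
Proof.
  intros hf hl e he. destruct (proj1 (right_limit_eps f x l) hl e he) as [d [hd h]].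
  exists d. split; [assumption|]. intros k hk.
  assert (hex : forall u v, ex_RInt f u v) by (intros; apply ex_RInt_regulated; assumption).
  rewrite <- (RInt_Chasles f a x (x+k)) by apply hex.
  change (plus (RInt f a x) (RInt f x (x+k))) with (RInt f a x + RInt f x (x+k)).
  replace (RInt f a x + RInt f x (x+k) - RInt f a x - l * k) with (RInt f x (x+k) - l*k) by ring.
  assert (hc : forall m, RInt (fun _ => m) x (x+k) = m * k).
  { intros m. rewrite RInt_const_R. eqR. ring. }
  apply Rabs_le. split.
  - assert (hh : (l - e) * k <= RInt f x (x+k)); [|lra].
    rewrite <- hc. apply RInt_le; [lra|apply ex_RInt_const|apply hex|].
    intros y hy. specialize (h y ltac:(lra)). apply Rabs_def2 in h. lra.
  - assert (hh : RInt f x (x+k) <= (l + e) * k); [|lra].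
    rewrite <- hc. apply RInt_le; [lra|apply hex|apply ex_RInt_const|].
    intros y hy. specialize (h y ltac:(lra)). apply Rabs_def2 in h. lra.
Qed.

Lemma continuous_RInt_regulated (f : R -> R) (a x : R) :
  regulated f -> continuous (fun y => RInt f a y) x.
Proof.
  intros hf. apply (continuous_RInt_1 f a x (fun y => RInt f a y)).
  apply filter_forall. intros y. apply (RInt_correct (V := R_CompleteNormedModule)). apply ex_RInt_regulated. assumption.
Qed.

(** The right limits of a regulated function determine its integral. *)
Lemma RInt_regulated_right_limit (f : R -> R) (a b C : R) :
  a <= b -> regulated f ->
  (forall x, a <= x < b -> filterlim f (at_right x) (locally C)) ->
  RInt f a b = C * (b - a).
Proof.
  intros hab hf hC.
  assert (h : (fun y => RInt f a y - C * y) a = (fun y => RInt f a y - C * y) b).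
  { apply (right_derive_0_eq (fun y => RInt f a y - C * y)); [assumption| |].
    - intros x hx. apply cont_minus.
      + apply continuous_RInt_regulated; assumption.
      + cont.
    - intros x hx. replace 0 with (C - C) by ring.
      apply right_derive_minus.
      + apply right_derive_RInt; [assumption|]. apply hC; assumption.
      + apply right_derive_is_derive. evar_last; [apply (is_derive_scal (fun y => y)); apply is_derive_id|apply Rmult_1_r]. }
  simpl in h. rewrite RInt_point in h. change (@zero _) with 0 in h. lra.
Qed.

Lemma is_derive_ge0_le (f df : R -> R) (a b : R) :
  a <= b -> (forall x, a <= x <= b -> is_derive f x (df x)) ->
  (forall x, a <= x <= b -> 0 <= df x) -> f a <= f b.
Proof.
  intros hab hd h0. apply right_derive_ge0_le; [assumption| |].
  - intros x hx. apply (ex_derive_continuous (V := R_NormedModule)). eexists. apply hd; assumption.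
  - intros x hx. exists (df x). split; [apply h0; lra|]. apply right_derive_is_derive, hd. lra.
Qed.

(** The derivative of [r - 1/r - 2 ln r] is [(1 - 1/r)^2]. *)
Lemma two_ln_gap_incr (r s : R) : 1 <= r <= s -> r - / r - 2 * ln r <= s - / s - 2 * ln s.
Proof.
  intros h. apply (is_derive_ge0_le (fun x => x - / x - 2 * ln x) (fun x => (1 - / x) ^ 2)); [lra| |].
  - intros x hx. auto_derive; [lra|]. field; lra.
  - intros x _. apply pow2_ge_0.
Qed.

Lemma two_ln_lt (z : R) : 1 < z -> 2 * ln z < z - / z.
Proof.
  intros hz.
  set (s := sqrt z). assert (hs : 1 < s) by (unfold s; rewrite <- sqrt_1; apply sqrt_lt_1; lra).
  assert (hss : z = s * s) by (unfold s; rewrite sqrt_sqrt; lra).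
  pose proof (two_ln_gap_incr 1 s ltac:(lra)) as h. rewrite ln_1, Rinv_1 in h.
  rewrite hss, ln_mult by lra.
  assert (hi : 0 < / s) by (apply Rinv_0_lt_compat; lra).
  assert (hi1 : s * / s = 1) by (field; lra).
  rewrite Rinv_mult. set (i := / s) in *.
  assert (hlt : i < 1) by nra.
  assert (0 < (s - i) * (s + i - 2)); [|nra].
  apply Rmult_lt_0_compat; nra.
Qed.

(** * The velocity jump across a wave *)

(** Up to the factor [c], the change of velocity across an isothermal wave of
    density ratio [x]: rarefactions for [x <= 1], shocks for [1 <= x]. *)
Definition hug (x : R) : R :=
  ln (Rmin x 1) + (sqrt (Rmax x 1) - / sqrt (Rmax x 1)).

Lemma hug_rarefaction (x : R) : x <= 1 -> hug x = ln x.
Proof.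
  intros h. unfold hug. rewrite Rmin_left, Rmax_right, sqrt_1, Rinv_1 by lra. ring.
Qed.

Lemma hug_shock (x : R) : 1 <= x -> hug x = sqrt x - / sqrt x.
Proof.
  intros h. unfold hug. rewrite Rmin_right, Rmax_left, ln_1 by lra. ring.
Qed.

Lemma hug_incr_ln (x y : R) : 0 < x <= y -> ln y - ln x <= hug y - hug x.
Proof.
  intros h.
  assert (hug_gap : forall z, 0 < z -> hug z =
    ln z + (sqrt (Rmax z 1) - / sqrt (Rmax z 1) - 2 * ln (sqrt (Rmax z 1)))).
  { intros z hz. assert (hm : 1 <= Rmax z 1) by apply Rmax_r.
    assert (hs : 0 < sqrt (Rmax z 1)) by (apply sqrt_lt_R0; lra).
    assert (h2 : 2 * ln (sqrt (Rmax z 1)) = ln (Rmax z 1)).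
    { rewrite <- (sqrt_sqrt (Rmax z 1)) at 2 by lra. rewrite ln_mult by assumption. ring. }
    rewrite h2. unfold hug.
    destruct (Rle_dec z 1).
    - rewrite Rmin_left, Rmax_right, ln_1 by lra. ring.
    - rewrite Rmin_right, Rmax_left, ln_1 by lra. ring. }
  rewrite !hug_gap by lra.
  enough (sqrt (Rmax x 1) - / sqrt (Rmax x 1) - 2 * ln (sqrt (Rmax x 1)) <=
          sqrt (Rmax y 1) - / sqrt (Rmax y 1) - 2 * ln (sqrt (Rmax y 1))) by lra.
  apply two_ln_gap_incr. split.
  - rewrite <- sqrt_1 at 1. apply sqrt_le_1; [lra| |]; pose proof (Rmax_r x 1); lra.
  - apply sqrt_le_1; try (pose proof (Rmax_r x 1); pose proof (Rmax_r y 1); lra).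
    apply Rle_max_compat_r. lra.
Qed.

Lemma hug_incr (x y : R) : 0 < x < y -> hug x < hug y.
Proof.
  intros h. pose proof (hug_incr_ln x y ltac:(lra)). pose proof (ln_increasing x y). lra.
Qed.

Lemma hug_continuous (x : R) : 0 < x -> continuous hug x.
Proof.
  intros hx. unfold hug.
  assert (0 < sqrt (Rmax x 1)) by (apply sqrt_lt_R0; pose proof (Rmax_r x 1); lra).
  apply cont_plus.
  - apply cont_ln; [cont|]. apply Rmin_pos; lra.
  - apply cont_minus; [cont|]. apply cont_inv; [cont|lra].
Qed.

(** The velocity behind a wave of the family [1] issued from density [rho0] and
    velocity [u0], as a function of the density behind it. *)
Definition wave_velocity (c rho0 u0 rho : R) : R := u0 - c * hug (rho / rho0).

Lemma wave_velocity_decr (c rho0 u0 r s : R) :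
  0 < c -> 0 < rho0 -> 0 < r < s ->
  wave_velocity c rho0 u0 s < wave_velocity c rho0 u0 r.
Proof.
  intros hc h0 h. unfold wave_velocity.
  assert (hug (r / rho0) < hug (s / rho0)); [|nra].
  apply hug_incr. split; [apply Rdiv_lt_0_compat; lra|].
  apply Rmult_lt_compat_r; [apply Rinv_0_lt_compat|]; lra.
Qed.

Lemma wave_velocity_continuous (c rho0 u0 r : R) :
  0 < rho0 -> 0 < r -> continuous (wave_velocity c rho0 u0) r.
Proof.
  intros h0 hr. unfold wave_velocity. apply cont_minus; [cont|]. apply cont_mult; [cont|].
  apply (continuous_comp (fun y => y / rho0) hug).
  - apply cont_div; [cont|cont|lra].
  - apply hug_continuous. apply Rdiv_lt_0_compat; lra.
Qed.

(** As long as the velocity does not exceed [c], the flux [rho u] decreases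
    along the wave curve: the logarithmic lower bound on the growth of [hug]
    compensates the growth of the factor [rho]. *)
Lemma wave_flux_decr (c rho0 u0 r s : R) :
  0 < c -> 0 < rho0 -> 0 < r < s -> wave_velocity c rho0 u0 r <= c ->
  s * wave_velocity c rho0 u0 s < r * wave_velocity c rho0 u0 r.
Proof.
  intros hc h0 h hu.
  set (a := wave_velocity c rho0 u0 r) in *.
  assert (hs : wave_velocity c rho0 u0 s = a - c * (hug (s/rho0) - hug (r/rho0))).
  { unfold a, wave_velocity. ring. }
  assert (h0r : 0 < r / rho0) by (apply Rdiv_lt_0_compat; lra).
  assert (hrs : r / rho0 < s / rho0).
  { apply Rmult_lt_compat_r; [apply Rinv_0_lt_compat|]; lra. }
  pose proof (hug_incr_ln (r/rho0) (s/rho0) ltac:(lra)) as hl.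
  assert (hln : ln (s/rho0) - ln (r/rho0) > 1 - r / s).
  { rewrite !ln_div by lra.
    assert (hlt : ln (r / s) < r / s - 1).
    { pose proof (exp_ineq1 (ln (r/s))) as he.
      assert (ln (r/s) <> 0).
      { assert (ln (r/s) < 0); [|lra]. rewrite <- ln_1. apply ln_increasing.
        - apply Rdiv_lt_0_compat; lra.
        - apply Rlt_div_l; lra. }
      specialize (he H). rewrite exp_ln in he; [lra|]. apply Rdiv_lt_0_compat; lra. }
    rewrite ln_div in hlt by lra. lra. }
  assert (hd : s * (hug (s/rho0) - hug (r/rho0)) > s - r).
  { replace (s - r) with (s * (1 - r/s)) by (field; lra).
    apply Rmult_lt_compat_l; lra. }
  rewrite hs. nra.
Qed.

Lemma cont_ex_RInt (f : R -> R) (a b : R) : (forall x, continuous f x) -> ex_RInt f a b.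
Proof. intros h. apply (ex_RInt_continuous (V := R_CompleteNormedModule)). intros x _. apply h. Qed.

Lemma RInt_fundamental (f df : R -> R) (a b : R) :
  (forall x, is_derive f x (df x)) -> (forall x, continuous df x) ->
  RInt df a b = f b - f a.
Proof.
  intros h1 h2. apply is_RInt_unique. apply (is_RInt_derive f df); intros; [apply h1|apply h2].
Qed.

Lemma RInt_split (f : R -> R) (a b d : R) : ex_RInt f a b -> ex_RInt f b d ->
  RInt f a d = RInt f a b + RInt f b d.
Proof. intros h1 h2. symmetry. apply (RInt_Chasles f a b d h1 h2). Qed.

Lemma RInt_plus_R (f g : R -> R) (a b : R) : ex_RInt f a b -> ex_RInt g a b ->
  RInt (fun x => f x + g x) a b = RInt f a b + RInt g a b.
Proof. intros. apply (RInt_plus (V := R_CompleteNormedModule)); assumption. Qed.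

Lemma RInt_minus_R (f g : R -> R) (a b : R) : ex_RInt f a b -> ex_RInt g a b ->
  RInt (fun x => f x - g x) a b = RInt f a b - RInt g a b.
Proof. intros. apply (RInt_minus (V := R_CompleteNormedModule)); assumption. Qed.

Lemma RInt_scal_R (f : R -> R) (k a b : R) : ex_RInt f a b ->
  RInt (fun x => k * f x) a b = k * RInt f a b.
Proof. intros. apply (RInt_scal (V := R_CompleteNormedModule)); assumption. Qed.

Lemma RInt_rescale (f : R -> R) (u a b : R) : regulated f ->
  RInt (fun x => u * f (u * x)) a b = RInt f (u * a) (u * b).
Proof.
  intros hf. pose proof (RInt_comp_lin f u 0 a b (ex_RInt_regulated f _ _ hf)) as h.
  rewrite !Rplus_0_r in h. rewrite <- h. apply RInt_ext. intros x _.
  rewrite Rplus_0_r. reflexivity.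
Qed.

Lemma RInt_zero (f : R -> R) (a b : R) :
  (forall x, Rmin a b < x < Rmax a b -> f x = 0) -> RInt f a b = 0.
Proof.
  intros h. rewrite (RInt_ext f (fun _ => 0)) by assumption. rewrite RInt_const_R. eqR. ring.
Qed.

(** * Bump functions *)

Definition square_pos (y : R) : R := (Rmax 0 y) ^ 2.

Lemma is_derive_square_pos (y : R) : is_derive square_pos y (2 * Rmax 0 y).
Proof.
  unfold square_pos. destruct (Rtotal_order y 0) as [h|[h|h]].
  - apply is_derive_ext_loc with (fun _ => 0).
    + exists (mkposreal (- y) ltac:(lra)). intros z hz. change (Rabs (z - y) < - y) in hz.
      apply Rabs_def2 in hz. rewrite Rmax_left by lra. eqR. ring.
    + rewrite Rmax_left by lra. rewrite Rmult_0_r. apply (is_derive_const (V := R_NormedModule)).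
  - subst y. rewrite Rmax_left, Rmult_0_r by lra. apply is_derive_Reals.
    intros e he. exists (mkposreal e he). intros h h0 hh. simpl in hh.
    rewrite Rplus_0_l, (Rmax_left 0 0) by lra.
    replace (((Rmax 0 h)^2 - 0^2)/h - 0) with ((Rmax 0 h)^2 / h) by (field; assumption).
    unfold Rmax. destruct (Rle_dec 0 h).
    + replace (h^2/h) with h by (field; assumption). assumption.
    + replace (0^2/h) with 0 by (field; assumption). rewrite Rabs_R0. assumption.
  - apply is_derive_ext_loc with (fun z => z ^ 2).
    + exists (mkposreal y h). intros z hz. change (Rabs (z - y) < y) in hz.
      apply Rabs_def2 in hz. rewrite Rmax_right by lra. reflexivity.
    + rewrite Rmax_right by lra. auto_derive; [trivial|ring].
Qed.

Definition bump (y : R) : R := square_pos y * square_pos (1 - y).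

Definition bump' (y : R) : R :=
  2 * Rmax 0 y * square_pos (1 - y) - square_pos y * (2 * Rmax 0 (1 - y)).

Lemma is_derive_bump (y : R) : is_derive bump y (bump' y).
Proof.
  unfold bump, bump'.
  evar_last.
  - apply (is_derive_mult square_pos (fun y => square_pos (1 - y))).
    + apply is_derive_square_pos.
    + apply (is_derive_comp square_pos (fun y => 1 - y)).
      * apply is_derive_square_pos.
      * auto_derive; [trivial|reflexivity].
    + intros; apply Rmult_comm.
  - unfold plus, mult, scal; simpl. unfold mult; simpl. ring.
Qed.

Lemma continuous_bump' (y : R) : continuous bump' y.
Proof. unfold bump', square_pos. cont. Qed.

Lemma continuous_bump (y : R) : continuous bump y.
Proof. unfold bump, square_pos. cont. Qed.

Lemma bump_ge0 (y : R) : 0 <= bump y.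
Proof. unfold bump, square_pos. apply Rmult_le_pos; apply pow2_ge_0. Qed.

Lemma bump_out (y : R) : y <= 0 \/ 1 <= y -> bump y = 0 /\ bump' y = 0.
Proof.
  intros [h|h]; unfold bump, bump', square_pos.
  - rewrite (Rmax_left 0 y) by lra. split; ring.
  - rewrite (Rmax_left 0 (1 - y)) by lra. split; ring.
Qed.

Lemma bump_pos (y : R) : 0 < y < 1 -> 0 < bump y.
Proof.
  intros h. unfold bump, square_pos. rewrite !Rmax_right by lra.
  apply Rmult_lt_0_compat; apply pow_lt; lra.
Qed.

Definition bump_mass : R := RInt bump 0 1.

Lemma bump_mass_pos : 0 < bump_mass.
Proof.
  apply RInt_gt_0; [lra| |].
  - intros x hx. apply bump_pos; lra.
  - intros x _. apply continuous_bump.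
Qed.

Definition smooth_step (y : R) : R := RInt bump 0 y / bump_mass.

Lemma is_derive_smooth_step (y : R) : is_derive smooth_step y (bump y / bump_mass).
Proof.
  unfold smooth_step. pose proof bump_mass_pos.
  apply is_derive_ext with (fun y => / bump_mass * RInt bump 0 y).
  { intros t. eqR. field. lra. }
  evar_last.
  - apply (is_derive_scal (fun y => RInt bump 0 y)).
    apply (is_derive_RInt bump (fun y => RInt bump 0 y) 0).
    + apply filter_forall. intros z. apply (RInt_correct (V := R_CompleteNormedModule)).
      apply cont_ex_RInt, continuous_bump.
    + apply continuous_bump.
  - unfold Rdiv. eqR. ring.
Qed.

Lemma smooth_step_continuous (y : R) : continuous smooth_step y.
Proof.
  apply (ex_derive_continuous (V := R_NormedModule)). eexists. apply is_derive_smooth_step.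
Qed.

Lemma smooth_step_left (y : R) : y <= 0 -> smooth_step y = 0.
Proof.
  intros h. unfold smooth_step. rewrite RInt_zero; [unfold Rdiv; ring|].
  intros x. rewrite Rmin_right, Rmax_left by lra. intros hx. apply bump_out. lra.
Qed.

Lemma smooth_step_right (y : R) : 1 <= y -> smooth_step y = 1.
Proof.
  intros h. unfold smooth_step. pose proof bump_mass_pos.
  rewrite (RInt_split bump 0 1 y) by (apply cont_ex_RInt, continuous_bump).
  rewrite (RInt_zero bump 1 y).
  - unfold bump_mass in *. field. lra.
  - intros x. rewrite Rmin_left, Rmax_right by lra. intros hx. apply bump_out. lra.
Qed.

Lemma smooth_step_incr (y z : R) : y <= z -> smooth_step y <= smooth_step z.
Proof.
  intros h. apply (is_derive_ge0_le _ (fun y => bump y / bump_mass)); [assumption| |].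
  - intros; apply is_derive_smooth_step.
  - intros. apply Rdiv_le_0_compat; [apply bump_ge0|apply bump_mass_pos].
Qed.

Lemma smooth_step_01 (y : R) : 0 <= smooth_step y <= 1.
Proof.
  split.
  - rewrite <- (smooth_step_left (Rmin 0 y)) by apply Rmin_l. apply smooth_step_incr, Rmin_r.
  - rewrite <- (smooth_step_right (Rmax 1 y)) by apply Rmax_l. apply smooth_step_incr, Rmax_r.
Qed.

(** * From the distributional balance to its integrated form *)

Lemma rescale_left (x a k : R) : 0 < k -> x <= a -> (x - a) / k <= 0.
Proof.
  intros hk h. apply Rmult_le_reg_r with k; [lra|].
  unfold Rdiv. rewrite Rmult_assoc, Rinv_l by lra. lra.
Qed.

Lemma rescale_right (x a k : R) : 0 < k -> a + k <= x -> 1 <= (x - a) / k.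
Proof. intros hk h. apply Rle_div_r; lra. Qed.

(** Approximation of a right limit, and of an integral from [a], by
    averages against the rescaled bump. *)
Lemma bump_average (h : R -> R) (a A l e : R) :
  regulated h -> - A < a < A -> filterlim h (at_right a) (locally l) -> 0 < e ->
  exists d, 0 < d /\ forall k, 0 < k < d ->
    Rabs (RInt (fun x => h x * (bump ((x - a) / k) / (k * bump_mass))) (- A) A - l) <= e.
Proof.
  intros hh ha hl he. destruct (proj1 (right_limit_eps h a l) hl e he) as [d [hd hd']].
  exists (Rmin d (A - a)). split; [apply Rmin_pos; lra|]. intros k hk.
  pose proof (Rmin_l d (A - a)). pose proof (Rmin_r d (A - a)).
  pose proof bump_mass_pos as hm.
  set (b := fun x => bump ((x - a) / k) / (k * bump_mass)).
  assert (hkm : 0 < k * bump_mass) by (apply Rmult_lt_0_compat; lra).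
  assert (hbc : forall x, continuous b x).
  { intros x. unfold b. apply cont_div; [|cont|lra].
    apply (continuous_comp (fun x => (x - a)/k) bump); [|apply continuous_bump].
    apply cont_div; [cont|cont|lra]. }
  assert (hb0 : forall x, 0 <= b x).
  { intros x. apply Rdiv_le_0_compat; [apply bump_ge0|assumption]. }
  assert (hb1 : RInt b (- A) A = 1).
  { rewrite (RInt_fundamental (fun x => smooth_step ((x - a)/k)) b).
    - rewrite (smooth_step_right ((A - a)/k)), (smooth_step_left ((- A - a)/k)); [eqR; ring| |].
      + apply rescale_left; lra.
      + apply rescale_right; lra.
    - intros x. evar_last.
      + apply (is_derive_comp smooth_step (fun x => (x - a)/k)); [apply is_derive_smooth_step|].
        auto_derive; [trivial|reflexivity].
      + unfold scal; simpl; unfold mult; simpl. unfold b. field. lra.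
    - assumption. }
  assert (hex : forall f, regulated f -> ex_RInt (fun x => f x * b x) (-A) A).
  { intros f hf. apply ex_RInt_regulated, regulated_mult; [assumption|].
    apply regulated_continuous; assumption. }
  assert (hcst : forall m, RInt (fun x => m * b x) (-A) A = m).
  { intros m. rewrite RInt_scal_R by (apply cont_ex_RInt; assumption). rewrite hb1. eqR. ring. }
  assert (hpt : forall x, Rabs (h x - l) < e \/ b x = 0).
  { intros x. destruct (Rle_lt_dec x a).
    - right. unfold b. rewrite (proj1 (bump_out _ (or_introl (rescale_left x a k ltac:(lra) ltac:(lra))))).
      unfold Rdiv; ring.
    - destruct (Rlt_le_dec x (a + k)).
      + left. apply hd'. lra.
      + right. unfold b. rewrite (proj1 (bump_out _ (or_intror (rescale_right x a k ltac:(lra) ltac:(lra))))).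
        unfold Rdiv; ring. }
  assert (hc : forall m, ex_RInt (fun x => m * b x) (- A) A).
  { intros m. apply (hex (fun _ => m)). apply regulated_continuous. intros; cont. }
  change (Rabs (RInt (fun x => h x * b x) (- A) A - l) <= e).
  apply Rabs_le. split.
  - enough (l - e <= RInt (fun x => h x * b x) (- A) A) by lra.
    rewrite <- (hcst (l - e)). apply RInt_le; [lra|apply hc|apply hex; assumption|].
    intros x _. specialize (hb0 x). destruct (hpt x) as [hx|hx]; [apply Rabs_def2 in hx; nra|rewrite hx; lra].
  - enough (RInt (fun x => h x * b x) (- A) A <= l + e) by lra.
    rewrite <- (hcst (l + e)). apply RInt_le; [lra|apply hex; assumption|apply hc|].
    intros x _. specialize (hb0 x). destruct (hpt x) as [hx|hx]; [apply Rabs_def2 in hx; nra|rewrite hx; lra].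
Qed.

Lemma smooth_step_average (n : R -> R) (a A M k : R) :
  regulated n -> - A < a < A -> (forall x, Rabs (n x) <= M) -> 0 < k < A - a ->
  Rabs (RInt (fun x => n x * smooth_step ((x - a) / k)) (- A) A - RInt n a A) <= M * k.
Proof.
  intros hn ha hM hk.
  set (s := fun x => smooth_step ((x - a) / k)).
  assert (hsc : forall x, continuous s x).
  { intros x. unfold s. apply (continuous_comp (fun x => (x - a)/k) smooth_step).
    - apply cont_div; [cont|cont|lra].
    - apply smooth_step_continuous. }
  assert (hns : forall u v, ex_RInt (fun x => n x * s x) u v).
  { intros. apply ex_RInt_regulated, regulated_mult; [assumption|]. apply regulated_continuous; assumption. }
  assert (hnn : forall u v, ex_RInt n u v) by (intros; apply ex_RInt_regulated; assumption).
  change (Rabs (RInt (fun x => n x * s x) (- A) A - RInt n a A) <= M * k).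
  assert (hs0 : forall x, x <= a -> s x = 0).
  { intros x hx. apply smooth_step_left. apply rescale_left; lra. }
  assert (hs1 : forall x, a + k <= x -> s x = 1).
  { intros x hx. apply smooth_step_right, rescale_right; lra. }
  rewrite (RInt_split (fun x => n x * s x) (-A) a A) by apply hns.
  rewrite (RInt_split (fun x => n x * s x) a (a+k) A) by apply hns.
  rewrite (RInt_split n a (a+k) A) by apply hnn.
  rewrite (RInt_zero (fun x => n x * s x) (-A) a).
  2:{ intros x. rewrite Rmax_right by lra. intros hx. rewrite hs0 by lra. ring. }
  rewrite (RInt_ext (fun x => n x * s x) n (a+k) A).
  2:{ intros x. rewrite Rmin_left by lra. intros hx. rewrite hs1 by lra. apply Rmult_1_r. }
  replace (0 + (RInt (fun x => n x * s x) a (a + k) + RInt n (a + k) A) - (RInt n a (a + k) + RInt n (a + k) A))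
    with (RInt (fun x => n x * s x) a (a + k) - RInt n a (a + k)) by ring.
  rewrite <- RInt_minus_R; [|apply hns|apply hnn].
  replace (M * k) with ((a + k - a) * M) by ring.
  apply abs_RInt_le_const; [lra| |].
  - apply (ex_RInt_minus (V := R_NormedModule)); [apply hns|apply hnn].
  - intros x _. replace (n x * s x - n x) with (- (n x * (1 - s x))) by ring.
    rewrite Rabs_Ropp, Rabs_mult. pose proof (smooth_step_01 ((x - a)/k)) as h01.
    fold (s x) in h01. rewrite (Rabs_pos_eq (1 - s x)) by lra.
    specialize (hM x). pose proof (Rabs_pos (n x)). nra.
Qed.

(** Testing against smoothed indicators of [[a, b]] turns the weak inequality
    [h' + n <= 0] into an inequality between one-sided values. *)
Lemma weak_decrease (n h : R -> R) (M : R) :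
  regulated n -> regulated h -> (forall x, Rabs (n x) <= M) ->
  (forall A psi psi', 0 < A ->
     (forall x, is_derive psi x (psi' x)) -> (forall x, continuous psi' x) ->
     (forall x, 0 <= psi x) ->
     (forall x, A <= Rabs x -> psi x = 0 /\ psi' x = 0) ->
     RInt (fun x => n x * psi x) (- A) A <= RInt (fun x => h x * psi' x) (- A) A) ->
  forall a b la lb, a < b ->
    filterlim h (at_right a) (locally la) -> filterlim h (at_right b) (locally lb) ->
    lb + RInt n a b <= la.
Proof.
  intros hn hh hM hw a b la lb hab hla hlb.
  set (A := Rmax (Rabs a) (Rabs b) + 2).
  pose proof (Rmax_l (Rabs a) (Rabs b)). pose proof (Rmax_r (Rabs a) (Rabs b)).
  assert (ha : - A + 1 < a < A - 1) by (unfold A; split; pose proof (Rle_abs a); pose proof (Rle_abs (- a)); rewrite Rabs_Ropp in *; lra).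
  assert (hb : - A + 1 < b < A - 1) by (unfold A; split; pose proof (Rle_abs b); pose proof (Rle_abs (- b)); rewrite Rabs_Ropp in *; lra).
  assert (hM0 : 0 <= M) by (eapply Rle_trans; [apply Rabs_pos|apply (hM 0)]).
  apply le_epsilon. intros e he.
  destruct (bump_average h a A la (e/4) hh ltac:(lra) hla ltac:(lra)) as [d1 [hd1 k1]].
  destruct (bump_average h b A lb (e/4) hh ltac:(lra) hlb ltac:(lra)) as [d2 [hd2 k2]].
  set (k := Rmin (Rmin d1 d2) (Rmin 1 (e / (4 * (M + 1)))) / 2).
  assert (he4 : 0 < e / (4 * (M + 1))) by (apply Rdiv_lt_0_compat; lra).
  assert (hk : 0 < k /\ k < d1 /\ k < d2 /\ k < 1 /\ k < e / (4 * (M+1))).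
  { unfold k. pose proof (Rmin_l (Rmin d1 d2) (Rmin 1 (e / (4 * (M + 1))))).
    pose proof (Rmin_r (Rmin d1 d2) (Rmin 1 (e / (4 * (M + 1))))).
    pose proof (Rmin_l d1 d2). pose proof (Rmin_r d1 d2).
    pose proof (Rmin_l 1 (e / (4 * (M + 1)))). pose proof (Rmin_r 1 (e / (4 * (M + 1)))).
    assert (0 < Rmin (Rmin d1 d2) (Rmin 1 (e / (4 * (M + 1))))).
    { repeat apply Rmin_pos; lra. } lra. }
  specialize (k1 k ltac:(lra)). specialize (k2 k ltac:(lra)).
  assert (hMk : M * k <= e / 4).
  { apply Rle_trans with ((M + 1) * (e / (4 * (M + 1)))); [nra|]. apply Req_le. field. lra. }
  pose proof (smooth_step_average n a A M k hn ltac:(lra) hM ltac:(lra)) as s1.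
  pose proof (smooth_step_average n b A M k hn ltac:(lra) hM ltac:(lra)) as s2.
  pose proof bump_mass_pos as hm.
  assert (hsc : forall a x, continuous (fun x => smooth_step ((x - a) / k)) x).
  { intros a' x. apply (continuous_comp (fun x => (x - a')/k) smooth_step).
    - apply cont_div; [cont|cont|lra].
    - apply smooth_step_continuous. }
  assert (hbc : forall a x, continuous (fun x => bump ((x - a) / k) / (k * bump_mass)) x).
  { intros a' x. apply cont_div; [|cont|apply Rmult_integral_contrapositive_currified; lra].
    apply (continuous_comp (fun x => (x - a')/k) bump); [|apply continuous_bump].
    apply cont_div; [cont|cont|lra]. }
  assert (hder : forall a x, is_derive (fun x => smooth_step ((x - a) / k)) x
              (bump ((x - a) / k) / (k * bump_mass))).
  { intros a' x. evar_last.
      + apply (is_derive_comp smooth_step (fun x => (x - a')/k)); [apply is_derive_smooth_step|].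
        auto_derive; [trivial|reflexivity].
      + unfold scal; simpl; unfold mult; simpl. field. lra. }
  specialize (hw A (fun x => smooth_step ((x - a)/k) - smooth_step ((x - b)/k))
    (fun x => bump ((x - a) / k) / (k * bump_mass) - bump ((x - b) / k) / (k * bump_mass))).
  assert (hw' : RInt (fun x => n x * (smooth_step ((x - a)/k) - smooth_step ((x - b)/k))) (-A) A
     <= RInt (fun x => h x * (bump ((x - a) / k) / (k * bump_mass) - bump ((x - b) / k) / (k * bump_mass))) (-A) A).
  { apply hw.
    - lra.
    - intros x. apply (is_derive_minus (V := R_NormedModule) (fun x => smooth_step ((x - a)/k)) (fun x => smooth_step ((x - b)/k))); apply hder.
    - intros x. apply cont_minus; apply hbc.
    - intros x. enough (smooth_step ((x - b)/k) <= smooth_step ((x - a)/k)) by lra.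
      apply smooth_step_incr. apply Rmult_le_compat_r; [left; apply Rinv_0_lt_compat|]; lra.
    - intros x hx.
      assert (hx' : x <= - A \/ A <= x).
      { unfold Rabs in hx. destruct (Rcase_abs x); lra. }
      assert (hq : forall z, x <= z \/ z + k <= x -> (x - z)/k <= 0 \/ 1 <= (x - z)/k).
      { intros z [hz|hz]; [left|right].
        - apply rescale_left; lra.
        - apply rescale_right; lra. }
      rewrite (proj1 (bump_out _ (hq a ltac:(lra)))), (proj1 (bump_out _ (hq b ltac:(lra)))).
      split; [|unfold Rdiv; eqR; ring].
      destruct hx' as [hx'|hx'].
      + rewrite !smooth_step_left; [eqR; ring| |]; apply rescale_left; lra.
      + rewrite !smooth_step_right; [eqR; ring| |]; apply rescale_right; lra. }
  assert (hr : forall f g, regulated f -> (forall x, continuous g x) -> ex_RInt (fun x => f x * g x) (-A) A).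
  { intros f g hf hg. apply ex_RInt_regulated, regulated_mult; [assumption|]. apply regulated_continuous; assumption. }
  rewrite (RInt_ext _ (fun x => n x * smooth_step ((x - a)/k) - n x * smooth_step ((x - b)/k))) in hw'
    by (intros; eqR; ring).
  rewrite RInt_minus_R in hw'; [|apply hr; [assumption|apply hsc]|apply hr; [assumption|apply hsc]].
  rewrite (RInt_ext (fun x => h x * _) (fun x => h x * (bump ((x - a) / k) / (k * bump_mass)) - h x * (bump ((x - b) / k) / (k * bump_mass)))) in hw'
    by (intros; eqR; ring).
  rewrite RInt_minus_R in hw'; [|apply hr; [assumption|apply hbc]|apply hr; [assumption|apply hbc]].
  rewrite (RInt_split n a b A) in s1 by (apply ex_RInt_regulated; assumption).
  apply Rabs_le_between in k1, k2, s1, s2. lra.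
Qed.

Lemma RInt_support (g : R -> R) (A B : R) :
  0 <= A <= B -> regulated g -> (forall x, A < Rabs x -> g x = 0) ->
  RInt g (- B) B = RInt g (- A) A.
Proof.
  intros hAB hg h0.
  assert (hex : forall u v, ex_RInt g u v) by (intros; apply ex_RInt_regulated; assumption).
  rewrite (RInt_split g (-B) (-A) B), (RInt_split g (-A) A B) by apply hex.
  rewrite (RInt_zero g (-B) (-A)), (RInt_zero g A B); [eqR; ring| |].
  - intros x. rewrite Rmin_left by lra. intros hx. apply h0. rewrite Rabs_pos_eq; lra.
  - intros x. rewrite Rmax_right by lra. intros hx. apply h0. rewrite Rabs_left1; lra.
Qed.

(** * Test functions adapted to self-similar fields *)

(** A function of the ray [x / t], localised at the times [1 < t < 2]. *)
Definition fan_test (psi : R -> R) (t x : R) : R := bump (t - 1) * psi (x / t).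

Definition fan_test_t (psi psi' : R -> R) (t x : R) : R :=
  bump' (t - 1) * psi (x / t) - bump (t - 1) * (x / t ^ 2) * psi' (x / t).

Definition fan_test_x (psi' : R -> R) (t x : R) : R :=
  bump (t - 1) / t * psi' (x / t).

Lemma is_derive_bump_shift (t : R) : is_derive (fun s => bump (s - 1)) t (bump' (t - 1)).
Proof.
  evar_last.
  - apply (is_derive_comp bump (fun s => s - 1)); [apply is_derive_bump|].
    auto_derive; [trivial|reflexivity].
  - unfold scal; simpl; unfold mult; simpl. ring.
Qed.

Section FanTest.
Variables (psi psi' : R -> R) (A : R).
Hypothesis (hA : 0 < A).
Hypothesis hpsi : forall x, is_derive psi x (psi' x).
Hypothesis hpsi' : forall x, continuous psi' x.
Hypothesis hsupp : forall x, A <= Rabs x -> psi x = 0 /\ psi' x = 0.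

Let hpsic (x : R) : continuous psi x.
Proof. apply (ex_derive_continuous (V := R_NormedModule)). eexists. apply hpsi. Qed.

Lemma is_derive_fan_test_t (t x : R) :
  is_derive (fun s => fan_test psi s x) t (fan_test_t psi psi' t x).
Proof.
  unfold fan_test, fan_test_t. destruct (Rlt_le_dec t 1) as [h|h].
  - apply is_derive_ext_loc with (fun _ => 0).
    + exists (mkposreal (1 - t) ltac:(lra)). intros s hs. change (Rabs (s - t) < 1 - t) in hs.
      apply Rabs_def2 in hs. rewrite (proj1 (bump_out (s - 1) ltac:(lra))). eqR. ring.
    + rewrite (proj1 (bump_out (t - 1) ltac:(lra))), (proj2 (bump_out (t - 1) ltac:(lra))).
      evar_last; [apply (is_derive_const (V := R_NormedModule))|]. change (@zero _) with 0. eqR. ring.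
  - evar_last.
    + apply (is_derive_mult (fun s => bump (s - 1)) (fun s => psi (x / s))).
      * apply is_derive_bump_shift.
      * apply (is_derive_comp psi (fun s => x / s)); [apply hpsi|].
        auto_derive; [lra|reflexivity].
      * intros; apply Rmult_comm.
    + unfold plus, scal, mult; simpl. unfold mult; simpl. field. lra.
Qed.

Lemma is_derive_fan_test_x (t x : R) :
  is_derive (fun y => fan_test psi t y) x (fan_test_x psi' t x).
Proof.
  unfold fan_test, fan_test_x. evar_last.
  - apply (is_derive_scal (fun y => psi (y / t))).
    apply (is_derive_comp psi (fun y => y / t)); [apply hpsi|].
    apply (is_derive_ext (fun y => / t * y)); [intros; apply Rmult_comm|].
    apply is_derive_scal. apply is_derive_id.
  - unfold scal, one; simpl. unfold mult; simpl. unfold Rdiv. ring.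
Qed.

Lemma test_function_fan_test (K : R) : 2 * A <= K -> 2 <= K -> test_function K (fan_test psi).
Proof.
  intros hK1 hK2. split; [lra|]. split.
  - exists (fan_test_t psi psi'), (fan_test_x psi'). intros t x _.
    split; [apply is_derive_fan_test_t|]. split; [apply is_derive_fan_test_x|].
    destruct (Rlt_le_dec t 1) as [h|h].
    + assert (hz : forall s, Rabs (s - t) < 1 - t -> bump (s - 1) = 0 /\ bump' (s - 1) = 0).
      { intros s hs. apply Rabs_def2 in hs. apply bump_out. lra. }
      split; (apply continuous_ext_loc with (fun _ => 0); [|apply continuous_const]);
      exists (mkposreal (1 - t) ltac:(lra)); intros [s y] [hs _];
      change (Rabs (s - t) < 1 - t) in hs; destruct (hz s hs) as [hz1 hz2];
      unfold fan_test_t, fan_test_x; simpl; rewrite ?hz1, ?hz2; eqR; unfold Rdiv; ring.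
    + assert (hq : continuous (fun p : R * R => snd p / fst p) (t, x)).
      { apply cont_div; cont. simpl. lra. }
      assert (hq1 : continuous (fun p : R * R => psi (snd p / fst p)) (t, x)).
      { apply (continuous_comp (fun p : R * R => snd p / fst p) psi); [assumption|]. apply hpsic. }
      assert (hq2 : continuous (fun p : R * R => psi' (snd p / fst p)) (t, x)).
      { apply (continuous_comp (fun p : R * R => snd p / fst p) psi'); [assumption|]. apply hpsi'. }
      assert (hb : continuous (fun p : R * R => bump (fst p - 1)) (t, x)).
      { apply (continuous_comp (fun p : R * R => fst p - 1) bump); [cont|]. apply continuous_bump. }
      assert (hb' : continuous (fun p : R * R => bump' (fst p - 1)) (t, x)).
      { apply (continuous_comp (fun p : R * R => fst p - 1) bump'); [cont|]. apply continuous_bump'. }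
      split; unfold fan_test_t, fan_test_x.
      * apply cont_minus; [cont|]. apply cont_mult; [|assumption].
        apply cont_mult; [assumption|]. apply cont_div; [cont|cont|].
        apply pow_nonzero. simpl; lra.
      * apply cont_mult; [|assumption]. apply cont_div; [assumption|cont|simpl; lra].
  - intros t x h. unfold fan_test.
    destruct (Rlt_le_dec t 1) as [h1|h1]; [rewrite (proj1 (bump_out (t-1) ltac:(lra))); ring|].
    destruct (Rlt_le_dec t 2) as [h2|h2]; [|rewrite (proj1 (bump_out (t-1) ltac:(lra))); ring].
    destruct h as [h|h]; [rewrite Rabs_pos_eq in h; lra|].
    assert (hx : A <= Rabs (x / t)); [|rewrite (proj1 (hsupp (x / t) hx)); ring].
    rewrite Rabs_div by lra. rewrite (Rabs_pos_eq t) by lra. apply Rle_div_r; [lra|]. nra.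
Qed.

(** Integrating first along the rays [x = xi t], the balance only sees the
    one-dimensional expression in [psi]. *)
Lemma weak_balance_fan_test (eta G : R * R -> R) (w : R -> R * R) (Ua Ub : R * R) (K : R) :
  2 * A <= K -> 2 <= K ->
  regulated (fun xi => eta (w xi)) -> regulated (fun xi => G (w xi)) ->
  weak_balance eta G w Ua Ub K (fan_test psi) =
  bump_mass * (RInt (fun xi => (G (w xi) - xi * eta (w xi)) * psi' xi) (- A) A
               - RInt (fun xi => eta (w xi) * psi xi) (- A) A).
Proof.
  intros hK1 hK2 hN hQ.
  set (N := fun xi => eta (w xi)) in *. set (Q := fun xi => G (w xi)) in *.
  set (I1 := RInt (fun xi => N xi * psi xi) (- A) A).
  set (I2 := RInt (fun xi => (Q xi - xi * N xi) * psi' xi) (- A) A).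
  assert (hid : regulated (fun x => x)) by (apply regulated_continuous; intros; cont).
  assert (hr1 : regulated (fun xi => N xi * psi xi)).
  { apply regulated_mult; [assumption|]. apply regulated_continuous; assumption. }
  assert (hr2 : regulated (fun xi => (Q xi - xi * N xi) * psi' xi)).
  { apply regulated_mult; [|apply regulated_continuous; assumption].
    apply regulated_minus; [assumption|]. apply regulated_mult; assumption. }
  assert (hinner : forall t, 0 < t < K ->
    RInt (fun x => eta (w (x / t)) * Derive (fun s => fan_test psi s x) t
        + G (w (x / t)) * Derive (fun y => fan_test psi t y) x) (- K) K =
    I1 * (t * bump' (t - 1)) + I2 * bump (t - 1)).
  { intros t ht.
    rewrite (RInt_ext _ (fun x => N (x/t) * fan_test_t psi psi' t x + Q (x/t) * fan_test_x psi' t x)).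
    2:{ intros x _. unfold N, Q.
        rewrite (is_derive_unique (fun s : R => fan_test psi s x) _ _ (is_derive_fan_test_t t x)).
        rewrite (is_derive_unique (fun y : R => fan_test psi t y) _ _ (is_derive_fan_test_x t x)). reflexivity. }
    destruct (Rlt_le_dec 1 t) as [h1|h1]; [destruct (Rlt_le_dec t 2) as [h2|h2]|].
    2,3: rewrite (proj1 (bump_out (t - 1) ltac:(lra))), (proj2 (bump_out (t - 1) ltac:(lra)));
         rewrite RInt_zero; [eqR; ring|]; intros x _; unfold fan_test_t, fan_test_x;
         rewrite (proj1 (bump_out (t - 1) ltac:(lra))), (proj2 (bump_out (t - 1) ltac:(lra)));
         unfold Rdiv; ring.
    set (g := fun xi => (t * bump' (t - 1)) * (N xi * psi xi) + bump (t-1) * ((Q xi - xi * N xi) * psi' xi)).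
    assert (hg : regulated g).
    { assert (hc : forall k : R, regulated (fun _ => k)) by (intros; apply regulated_continuous; intros; cont).
      apply regulated_plus; apply regulated_mult; auto. }
    rewrite (RInt_ext _ (fun x => / t * g (/ t * x))).
    2:{ intros x _. replace (/ t * x) with (x / t) by (unfold Rdiv; ring).
        unfold g, fan_test_t, fan_test_x. eqR. field. lra. }
    rewrite RInt_rescale by assumption.
    replace (/ t * - K) with (- (K / t)) by (unfold Rdiv; ring).
    replace (/ t * K) with (K / t) by (unfold Rdiv; ring).
    rewrite (RInt_support g A (K / t)); [|split; [lra|apply Rle_div_r; [lra|nra]]|assumption|].
    2:{ intros x hx. unfold g. destruct (hsupp x ltac:(lra)) as [k1 k2]. rewrite k1, k2. ring. }
    unfold g. rewrite RInt_plus_R, !RInt_scal_R; try (apply ex_RInt_regulated; assumption).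
    - unfold I1, I2. eqR. ring.
    - apply (ex_RInt_scal (V := R_NormedModule)), ex_RInt_regulated; assumption.
    - apply (ex_RInt_scal (V := R_NormedModule)), ex_RInt_regulated; assumption. }
  unfold weak_balance.
  rewrite (RInt_zero (fun x => eta (riemann_data Ua Ub x) * fan_test psi 0 x)).
  2:{ intros x _. unfold fan_test. rewrite (proj1 (bump_out (0 - 1) ltac:(lra))). ring. }
  rewrite (RInt_ext _ (fun t => I1 * (t * bump' (t - 1)) + I2 * bump (t - 1))).
  2:{ intros t. rewrite Rmin_left, Rmax_right by lra. intros ht. apply hinner. assumption. }
  assert (hc1 : forall t, continuous (fun t => t * bump' (t - 1)) t).
  { intros t. apply cont_mult; [cont|]. apply (continuous_comp (fun t => t - 1) bump'); [cont|apply continuous_bump']. }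
  assert (hc2 : forall t, continuous (fun t => bump (t - 1)) t).
  { intros t. apply (continuous_comp (fun t => t - 1) bump); [cont|apply continuous_bump]. }
  assert (he1 : ex_RInt (fun t => t * bump' (t - 1)) 0 K) by (apply cont_ex_RInt; exact hc1).
  assert (he2 : ex_RInt (fun t => bump (t - 1)) 0 K) by (apply cont_ex_RInt; exact hc2).
  rewrite RInt_plus_R, !RInt_scal_R; try assumption.
  2,3: apply (ex_RInt_scal (V := R_NormedModule)); assumption.
  assert (hm : RInt (fun t => bump (t - 1)) 0 K = bump_mass).
  { rewrite (RInt_fundamental (fun t => bump_mass * smooth_step (t - 1))).
    - rewrite smooth_step_right, smooth_step_left by lra. eqR. ring.
    - intros t. evar_last.
      + apply (is_derive_scal (fun t => smooth_step (t - 1))).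
        apply (is_derive_comp smooth_step (fun t => t - 1)); [apply is_derive_smooth_step|].
        auto_derive; [trivial|reflexivity].
      + pose proof bump_mass_pos. unfold scal; simpl. unfold mult; simpl. field. lra.
    - assumption. }
  assert (hm2 : RInt (fun t => t * bump' (t - 1)) 0 K = - bump_mass).
  { assert (hp : RInt (fun t => bump (t - 1) + t * bump' (t - 1)) 0 K = 0).
    { rewrite (RInt_fundamental (fun t => t * bump (t - 1))).
      - rewrite (proj1 (bump_out (K - 1) ltac:(lra))). eqR. ring.
      - intros t. evar_last.
        + apply (is_derive_mult (fun t => t) (fun t => bump (t - 1))).
          * apply is_derive_id.
          * apply is_derive_bump_shift.
          * intros; apply Rmult_comm.
        + unfold plus, mult, one; simpl. ring.
      - intros t. apply cont_plus; auto. }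
    rewrite RInt_plus_R in hp by (apply cont_ex_RInt; auto). lra. }
  rewrite hm, hm2. unfold I1, I2, N, Q. eqR. ring.
Qed.

End FanTest.

(** For small times a test function supported away from [x = 0], on either
    side, only sees the state ahead of all the waves. *)
Lemma weak_balance_data (eta G : R * R -> R) (w : R -> R * R) (Ua Ub U0 : R * R) (s X nl ql : R) :
  (s = -1 /\ U0 = Ua) \/ (s = 1 /\ U0 = Ub) ->
  regulated (fun xi => eta (w xi)) -> regulated (fun xi => G (w xi)) ->
  (forall xi, X < s * xi -> filterlim (fun z => eta (w z)) (at_right xi) (locally nl)) ->
  (forall xi, X < s * xi -> filterlim (fun z => G (w z)) (at_right xi) (locally ql)) ->
  (forall K phi, test_function K phi -> weak_balance eta G w Ua Ub K phi = 0) ->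
  nl = eta U0.
Proof.
  intros hs hN hQ hnl hql hw.
  (* The test function lives on [[-2, -1]] or on [[1, 2]]. *)
  set (p := (3 * s - 1) / 2).
  assert (hp : (s = -1 /\ p = -2 /\ U0 = Ua) \/ (s = 1 /\ p = 1 /\ U0 = Ub)).
  { unfold p. destruct hs as [[hs hU]|[hs hU]]; subst s; [left|right]; repeat split; try assumption; lra. }
  clearbody p. clear hs.
  set (d := / (Rabs X + 1)).
  assert (hd : 0 < d <= 1).
  { unfold d. pose proof (Rabs_pos X). split; [apply Rinv_0_lt_compat; lra|].
    rewrite <- Rinv_1. apply Rinv_le_contravar; lra. }
  set (chi := fun t => bump (t / (2 * d) + / 2)).
  set (chi' := fun t => bump' (t / (2 * d) + / 2) / (2 * d)).
  assert (hchi : forall t, is_derive chi t (chi' t)).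
  { intros t. unfold chi, chi'. evar_last.
    - apply (is_derive_comp bump (fun t => t / (2*d) + /2)); [apply is_derive_bump|].
      auto_derive; [trivial|reflexivity].
    - unfold scal; simpl; unfold mult; simpl. field. lra. }
  assert (hchi'c : forall t, continuous chi' t).
  { intros t. unfold chi'. apply cont_div; [|cont|lra].
    apply (continuous_comp (fun t => t/(2*d) + /2) bump'); [|apply continuous_bump'].
    apply cont_plus; [|cont]. apply cont_div; [cont|cont|lra]. }
  assert (hchi0 : forall t, d <= Rabs t -> chi t = 0 /\ chi' t = 0).
  { intros t ht. assert (h : t / (2*d) + /2 <= 0 \/ 1 <= t/(2*d) + /2).
    { unfold Rabs in ht. destruct (Rcase_abs t).
      - left. assert (t / (2*d) <= - / 2); [|lra].
        apply Rle_div_l; lra.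
      - right. assert (/ 2 <= t / (2*d)); [|lra]. apply Rle_div_r; lra. }
    unfold chi, chi'. rewrite (proj1 (bump_out _ h)), (proj2 (bump_out _ h)). split; [reflexivity|].
    unfold Rdiv; ring. }
  assert (hchi1 : 0 < chi 0).
  { unfold chi. apply bump_pos. unfold Rdiv. rewrite Rmult_0_l. lra. }
  set (g := fun x => bump (x - p)). set (g' := fun x => bump' (x - p)).
  assert (hg : forall x, is_derive g x (g' x)).
  { intros x. unfold g, g'. evar_last.
    - apply (is_derive_comp bump (fun x => x - p)); [apply is_derive_bump|].
      auto_derive; [trivial|reflexivity].
    - unfold scal; simpl; unfold mult; simpl. ring. }
  assert (hgc : forall x, continuous g x).
  { intros x. apply (ex_derive_continuous (V := R_NormedModule)). eexists; apply hg. }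
  assert (hg'c : forall x, continuous g' x).
  { intros x. unfold g'. apply (continuous_comp (fun x => x - p) bump'); [cont|apply continuous_bump']. }
  assert (hg0 : forall x, x <= p \/ p + 1 <= x -> g x = 0 /\ g' x = 0).
  { intros x hx. apply bump_out. lra. }
  assert (hder1 : forall t x, is_derive (fun s => chi s * g x) t (chi' t * g x)).
  { intros t x. apply (is_derive_ext (fun s => g x * chi s)); [intros; apply Rmult_comm|].
    rewrite Rmult_comm. apply is_derive_scal, hchi. }
  assert (hder2 : forall t x, is_derive (fun y => chi t * g y) x (chi t * g' x)).
  { intros t x. apply is_derive_scal, hg. }
  assert (htest : test_function 3 (fun t x => chi t * g x)).
  { split; [lra|]. split.
    - exists (fun t x => chi' t * g x), (fun t x => chi t * g' x). intros t x _.
      split; [apply hder1|]. split; [apply hder2|].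
      split; apply cont_mult.
      + apply (continuous_comp fst chi'); [cont|apply hchi'c].
      + apply (continuous_comp snd g); [cont|apply hgc].
      + apply (continuous_comp fst chi); [cont|].
        apply (ex_derive_continuous (V := R_NormedModule)). eexists; apply hchi.
      + apply (continuous_comp snd g'); [cont|apply hg'c].
    - intros t x [h|h].
      + rewrite (proj1 (hchi0 t ltac:(lra))). ring.
      + assert (hx : x <= p \/ p + 1 <= x) by (unfold Rabs in h; destruct (Rcase_abs x); lra).
        rewrite (proj1 (hg0 x hx)). ring. }
  specialize (hw 3 _ htest).
  assert (hgm : RInt g (- (3)) 3 = bump_mass).
  { pose proof bump_mass_pos. rewrite (RInt_fundamental (fun x => bump_mass * smooth_step (x - p))).
    - rewrite smooth_step_right, smooth_step_left by lra. eqR. ring.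
    - intros t. evar_last.
      + apply (is_derive_scal (fun t => smooth_step (t - p))).
        apply (is_derive_comp smooth_step (fun t => t - p)); [apply is_derive_smooth_step|].
        auto_derive; [trivial|reflexivity].
      + unfold scal; simpl. unfold mult; simpl. unfold g. field. lra.
    - assumption. }
  assert (hg'm : RInt g' (- (3)) 3 = 0).
  { rewrite (RInt_fundamental g g') by assumption.
    rewrite (proj1 (hg0 3 ltac:(lra))), (proj1 (hg0 (- (3)) ltac:(lra))). eqR. ring. }
  assert (hloc : forall (f : R -> R) (l t : R) (k : R -> R), regulated f ->
     (forall xi, X < s * xi -> filterlim f (at_right xi) (locally l)) -> 0 < t < d ->
     (forall x, continuous k x) -> (forall x, x <= p \/ p + 1 <= x -> k x = 0) ->
     RInt (fun x => f (x / t) * k x) (- (3)) 3 = l * RInt k (- (3)) 3).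
  { intros f l t k hf hl ht hk hk0.
    assert (hti : 0 < / t) by (apply Rinv_0_lt_compat; lra).
    assert (hft : regulated (fun x => f (x / t))).
    { pose proof (regulated_scale f (/ t) hti hf) as hs.
      replace (fun x => f (x / t)) with (fun x => f (/ t * x)); [exact hs|].
      apply FunctionalExtensionality.functional_extensionality. intros x. f_equal. unfold Rdiv. ring. }
    assert (hkr : regulated k) by (apply regulated_continuous; assumption).
    assert (hfk : regulated (fun x => f (x/t) * k x)) by (apply regulated_mult; assumption).
    assert (hlk : regulated (fun x => l * k x)).
    { apply regulated_continuous. intros; cont. apply hk. }
    rewrite <- RInt_scal_R by (apply ex_RInt_regulated; assumption).
    enough (h : RInt (fun x => f (x/t) * k x - l * k x) (- (3)) 3 = 0).
    { rewrite RInt_minus_R in h by (apply ex_RInt_regulated; assumption). eqR. lra. }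
    assert (hdiff : regulated (fun x => f (x/t) * k x - l * k x)) by (apply regulated_minus; assumption).
    rewrite (RInt_split _ (- (3)) p 3), (RInt_split _ p (p + 1) 3) by (apply ex_RInt_regulated; assumption).
    rewrite (RInt_zero _ (- (3)) p).
    2:{ intros x. rewrite Rmax_right by lra. intros hx. rewrite hk0 by lra. ring. }
    rewrite (RInt_zero _ (p + 1) 3).
    2:{ intros x. rewrite Rmin_left by lra. intros hx. rewrite hk0 by lra. ring. }
    rewrite (RInt_regulated_right_limit _ p (p + 1) 0); [eqR; ring|lra|assumption|].
    intros x hx.
    replace 0 with ((l - l) * k x) by ring.
    assert (hcr : filterlim k (at_right x) (locally (k x))).
    { apply filterlim_filter_le_1 with (2 := hk x). apply filter_le_within. }
    (* On the support, [x / t] lies beyond all the waves. *)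
    assert (hxt : X < s * (x / t)).
    { assert (X * t < 1).
      { assert (Rabs X * t < 1); [|pose proof (Rle_abs X); nra].
        pose proof (Rabs_pos X).
        apply Rle_lt_trans with (Rabs X * d); [apply Rmult_le_compat_l; lra|].
        unfold d. apply Rlt_div_l; lra. }
      replace (s * (x / t)) with (s * x / t) by (field; lra).
      apply Rlt_div_r; [lra|]. destruct hp as [[hp1 [hp2 _]]|[hp1 [hp2 _]]]; subst s; lra. }
    apply right_limit_eps. intros e he.
    assert (hkx : 0 < Rabs (k x) + 1) by (pose proof (Rabs_pos (k x)); lra).
    destruct (proj1 (right_limit_eps f (x/t) l) (hl _ hxt) (e / (Rabs (k x) + 1))) as [d1 [hd1 k1]].
    { apply Rdiv_lt_0_compat; lra. }
    destruct (proj1 (right_limit_eps k x (k x)) hcr 1) as [d2 [hd2 k2]]; [lra|].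
    exists (Rmin (d1 * t) d2). split; [apply Rmin_pos; [nra|lra]|].
    intros y hy. pose proof (Rmin_l (d1*t) d2). pose proof (Rmin_r (d1*t) d2).
    specialize (k1 (y / t)).
    assert (hyt : x/t < y/t < x/t + d1).
    { split; [apply Rmult_lt_compat_r; lra|]. apply Rlt_div_l; [lra|].
      replace ((x/t + d1) * t) with (x + d1 * t) by (field; lra). lra. }
    specialize (k1 hyt). specialize (k2 y ltac:(lra)).
    replace (f (y/t) * k y - l * k y - (l - l) * k x) with ((f (y/t) - l) * k y) by ring.
    rewrite Rabs_mult.
    assert (Rabs (k y) < Rabs (k x) + 1).
    { replace (k y) with ((k y - k x) + k x) by ring. eapply Rle_lt_trans; [apply Rabs_triang|]. lra. }
    replace e with (e / (Rabs (k x) + 1) * (Rabs (k x) + 1)) by (field; lra).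
    apply Rmult_le_0_lt_compat; try apply Rabs_pos; assumption. }
  unfold weak_balance in hw.
  rewrite (RInt_ext (fun x => eta (riemann_data Ua Ub x) * (chi 0 * g x)) (fun x => (eta U0 * chi 0) * g x)) in hw.
  2:{ intros x _. unfold riemann_data.
      destruct hp as [[hp1 [hp2 hp3]]|[hp1 [hp2 hp3]]]; rewrite hp3;
      (destruct (Rlt_dec x 0); [try (eqR; ring)|try (eqR; ring)]);
      rewrite (proj1 (hg0 x ltac:(lra))); eqR; ring. }
  rewrite RInt_scal_R, hgm in hw by (apply cont_ex_RInt; assumption).
  rewrite (RInt_ext _ (fun t => (nl * bump_mass) * chi' t)) in hw.
  2:{ intros t. rewrite Rmin_left, Rmax_right by lra. intros ht.
      rewrite (RInt_ext _ (fun x => eta (w (x / t)) * (chi' t * g x) + G (w (x/t)) * (chi t * g' x))).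
      2:{ intros x _. rewrite (is_derive_unique (fun s : R => chi s * g x) _ _ (hder1 t x)), (is_derive_unique (fun y : R => chi t * g y) _ _ (hder2 t x)). reflexivity. }
      destruct (Rlt_le_dec t d) as [h1|h1].
      - rewrite RInt_plus_R.
        + rewrite (hloc (fun z => eta (w z)) nl t (fun x => chi' t * g x)); try assumption; try lra.
          * rewrite (hloc (fun z => G (w z)) ql t (fun x => chi t * g' x)); try assumption; try lra.
            -- rewrite !RInt_scal_R, hgm, hg'm by (apply cont_ex_RInt; assumption). eqR; ring.
            -- intros x. cont. apply hg'c.
            -- intros x hx. rewrite (proj2 (hg0 x hx)). ring.
          * intros x. cont. apply hgc.
          * intros x hx. rewrite (proj1 (hg0 x hx)). ring.
        + apply ex_RInt_regulated, regulated_mult; [|apply regulated_continuous; intros; cont; apply hgc].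
          pose proof (regulated_scale (fun z => eta (w z)) (/ t) ltac:(apply Rinv_0_lt_compat; lra) hN) as hs.
          replace (fun x => eta (w (x / t))) with (fun x => eta (w (/ t * x))); [exact hs|].
          apply FunctionalExtensionality.functional_extensionality. intros x. do 2 f_equal. unfold Rdiv. ring.
        + apply ex_RInt_regulated, regulated_mult; [|apply regulated_continuous; intros; cont; apply hg'c].
          pose proof (regulated_scale (fun z => G (w z)) (/ t) ltac:(apply Rinv_0_lt_compat; lra) hQ) as hs.
          replace (fun x => G (w (x / t))) with (fun x => G (w (/ t * x))); [exact hs|].
          apply FunctionalExtensionality.functional_extensionality. intros x. do 2 f_equal. unfold Rdiv. ring.
      - assert (ht' : d <= Rabs t) by (rewrite Rabs_pos_eq; lra).
        rewrite (proj1 (hchi0 t ht')), (proj2 (hchi0 t ht')).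
        rewrite RInt_zero; [eqR; ring|]. intros x _. ring. }
  rewrite RInt_scal_R in hw by (apply cont_ex_RInt; assumption).
  rewrite (RInt_fundamental chi chi') in hw by assumption.
  rewrite (proj1 (hchi0 3 ltac:(rewrite Rabs_pos_eq; lra))) in hw.
  pose proof bump_mass_pos as hm.
  apply Rmult_eq_reg_r with (bump_mass * chi 0); [|apply Rmult_integral_contrapositive_currified; lra].
  lra.
Qed.

(** * From weak solutions to profiles *)

Lemma limit_of_right_limits (h hr : R -> R) (x l : R) :
  filterlim h (at_left x) (locally l) ->
  (forall y, filterlim h (at_right y) (locally (hr y))) ->
  filterlim hr (at_left x) (locally l).
Proof.
  intros hl hh. apply left_limit_eps. intros e he.
  destruct (proj1 (left_limit_eps _ _ _) hl (e/2) ltac:(lra)) as [d [hd k]].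
  exists d. split; [assumption|]. intros y hy.
  destruct (proj1 (right_limit_eps _ _ _) (hh y) (e/2) ltac:(lra)) as [d' [hd' k']].
  set (z := y + Rmin d' (x - y) / 2).
  assert (0 < Rmin d' (x - y)) by (apply Rmin_pos; lra).
  pose proof (Rmin_l d' (x - y)). pose proof (Rmin_r d' (x - y)).
  specialize (k z ltac:(unfold z; lra)). specialize (k' z ltac:(unfold z; lra)).
  replace (hr y - l) with ((h z - l) - (h z - hr y)) by ring.
  unfold Rminus at 1. eapply Rle_lt_trans; [apply Rabs_triang|]. rewrite Rabs_Ropp. lra.
Qed.

Lemma limit_of_right_limits_right (h hr : R -> R) (x : R) :
  (forall y, filterlim h (at_right y) (locally (hr y))) ->
  filterlim hr (at_right x) (locally (hr x)).
Proof.
  intros hh. apply right_limit_eps. intros e he.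
  destruct (proj1 (right_limit_eps _ _ _) (hh x) (e/2) ltac:(lra)) as [d [hd k]].
  exists d. split; [assumption|]. intros y hy.
  destruct (proj1 (right_limit_eps _ _ _) (hh y) (e/2) ltac:(lra)) as [d' [hd' k']].
  set (z := y + Rmin d' (x + d - y) / 2).
  assert (0 < Rmin d' (x + d - y)) by (apply Rmin_pos; lra).
  pose proof (Rmin_l d' (x + d - y)). pose proof (Rmin_r d' (x + d - y)).
  specialize (k z ltac:(unfold z; lra)). specialize (k' z ltac:(unfold z; lra)).
  replace (hr y - hr x) with ((h z - hr x) - (h z - hr y)) by ring.
  unfold Rminus at 1. eapply Rle_lt_trans; [apply Rabs_triang|]. rewrite Rabs_Ropp. lra.
Qed.

Lemma left_limit_unique (f : R -> R) (x l1 l2 : R) :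
  filterlim f (at_left x) (locally l1) -> filterlim f (at_left x) (locally l2) -> l1 = l2.
Proof. apply (filterlim_locally_unique (V := R_NormedModule)). Qed.

Lemma right_limit_unique (f : R -> R) (x l1 l2 : R) :
  filterlim f (at_right x) (locally l1) -> filterlim f (at_right x) (locally l2) -> l1 = l2.
Proof. apply (filterlim_locally_unique (V := R_NormedModule)). Qed.

Lemma continuous_at_left (f : R -> R) (x : R) : continuous f x -> filterlim f (at_left x) (locally (f x)).
Proof. intros h. apply filterlim_filter_le_1 with (2 := h). apply filter_le_within. Qed.

Lemma continuous_at_right (f : R -> R) (x : R) : continuous f x -> filterlim f (at_right x) (locally (f x)).
Proof. intros h. apply filterlim_filter_le_1 with (2 := h). apply filter_le_within. Qed.

(** Let the ends of the interval of integration tend to [x] from both sides. *)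
Lemma jump_decrease (n h : R -> R) (M x ll lr : R) :
  regulated n -> regulated h -> (forall y, Rabs (n y) <= M) ->
  (forall a b la lb, a < b ->
    filterlim h (at_right a) (locally la) -> filterlim h (at_right b) (locally lb) ->
    lb + RInt n a b <= la) ->
  filterlim h (at_left x) (locally ll) -> filterlim h (at_right x) (locally lr) ->
  lr <= ll.
Proof.
  intros hn hh hM hdec hl hr. apply le_epsilon. intros e he.
  assert (hM0 : 0 <= M) by (eapply Rle_trans; [apply Rabs_pos|apply (hM 0)]).
  destruct (proj1 (left_limit_eps _ _ _) hl (e/4) ltac:(lra)) as [d [hd k]].
  assert (hq : 0 < e / (2 * (M + 1))) by (apply Rdiv_lt_0_compat; lra).
  set (a := x - Rmin d (e / (2 * (M + 1))) / 2).
  assert (0 < Rmin d (e / (2 * (M + 1)))) by (apply Rmin_pos; lra).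
  pose proof (Rmin_l d (e / (2 * (M + 1)))). pose proof (Rmin_r d (e / (2 * (M + 1)))).
  destruct (hh a) as [_ [la hla]].
  specialize (hdec a x la lr ltac:(unfold a; lra) hla hr).
  assert (hla' : la <= ll + e / 2).
  { destruct (proj1 (right_limit_eps _ _ _) hla (e/4) ltac:(lra)) as [d' [hd' k']].
    set (z := a + Rmin d' (x - a) / 2).
    assert (0 < Rmin d' (x - a)) by (apply Rmin_pos; unfold a; lra).
    pose proof (Rmin_l d' (x - a)). pose proof (Rmin_r d' (x - a)).
    specialize (k z ltac:(unfold z, a in *; lra)). specialize (k' z ltac:(unfold z; lra)).
    apply Rabs_def2 in k, k'. lra. }
  assert (hint : Rabs (RInt n a x) <= (x - a) * M).
  { apply abs_RInt_le_const; [unfold a; lra|apply ex_RInt_regulated; assumption|intros; apply hM]. }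
  assert (hb : (x - a) * M <= e / 2).
  { apply Rle_trans with (e / (2 * (M + 1)) * (M + 1)).
    - apply Rmult_le_compat; unfold a; lra.
    - apply Req_le. field. lra. }
  apply Rabs_le_between in hint. lra.
Qed.

(** The identity [h' + n = 0] in the sense of distributions. Nonnegative test
    functions suffice, since [weak_decrease] can be applied to the pair and to its
    opposite. *)
Definition weakly_conserved (n h : R -> R) : Prop :=
  forall A psi psi', 0 < A ->
    (forall x, is_derive psi x (psi' x)) -> (forall x, continuous psi' x) ->
    (forall x, 0 <= psi x) ->
    (forall x, A <= Rabs x -> psi x = 0 /\ psi' x = 0) ->
    RInt (fun x => n x * psi x) (- A) A = RInt (fun x => h x * psi' x) (- A) A.

Lemma conserved_integral (n h : R -> R) (M : R) :
  regulated n -> regulated h -> (forall x, Rabs (n x) <= M) -> weakly_conserved n h ->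
  forall a b la lb, a < b ->
    filterlim h (at_right a) (locally la) -> filterlim h (at_right b) (locally lb) ->
    lb + RInt n a b = la.
Proof.
  intros hn hh hM hw a b la lb hab hla hlb. apply Rle_antisym.
  - apply (weak_decrease n h M hn hh hM); try assumption.
    intros A psi psi' h1 h2 h3 h4 h5. rewrite (hw A psi psi' h1 h2 h3 h4 h5). apply Rle_refl.
  - assert (hopp : forall f, regulated f -> regulated (fun x => -1 * f x)).
    { intros f hf. apply regulated_mult; [|assumption]. apply regulated_continuous. intros; cont. }
    assert (hlim : forall x l, filterlim h (at_right x) (locally l) ->
       filterlim (fun y => -1 * h y) (at_right x) (locally (-1 * l))).
    { intros x l hl. eapply filterlim_comp; [exact hl|].
      apply (filterlim_scal_r (V := R_NormedModule) (-1) l). }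
    enough (h1 : -1 * lb + RInt (fun x => -1 * n x) a b <= -1 * la).
    { rewrite RInt_scal_R in h1 by (apply ex_RInt_regulated; assumption). lra. }
    apply (weak_decrease _ (fun x => -1 * h x) M); auto.
    + intros x. rewrite Rabs_mult, Rabs_m1, Rmult_1_l. apply hM.
    + intros A psi psi' h1 h2 h3 h4 h5.
      assert (hc : forall x, continuous psi x).
      { intros x. apply (ex_derive_continuous (V := R_NormedModule)). eexists; apply h2. }
      rewrite (RInt_ext _ (fun x => -1 * (n x * psi x))) by (intros; eqR; ring).
      rewrite (RInt_ext (fun x => -1 * h x * psi' x) (fun x => -1 * (h x * psi' x))) by (intros; eqR; ring).
      rewrite !RInt_scal_R by (apply ex_RInt_regulated, regulated_mult; [assumption|apply regulated_continuous; assumption]).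
      rewrite (hw A psi psi' h1 h2 h3 h4 h5). apply Rle_refl.
Qed.

(** The integrated form [h(b) - h(a) = - int n] gives the continuity of [h], and
    its right derivative from the right limits of [n]. *)
Lemma conserved_profile (n h hl hr nr : R -> R) (M : R) :
  regulated n -> (forall x, Rabs (n x) <= M) -> weakly_conserved n h ->
  (forall x, filterlim h (at_left x) (locally (hl x))) ->
  (forall x, filterlim h (at_right x) (locally (hr x))) ->
  (forall x, filterlim n (at_right x) (locally (nr x))) ->
  (forall x, continuous hr x) /\ (forall x, hl x = hr x) /\
  (forall x, right_derive hr x (- nr x)).
Proof.
  intros hn hM hw hhl hhr hnr.
  assert (hh : regulated h).
  { intros x. split; eexists; [apply hhl|apply hhr]. }
  assert (hex : forall u v, ex_RInt n u v) by (intros; apply ex_RInt_regulated; assumption).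
  assert (heq : forall x, hr x = hr 0 - RInt n 0 x).
  { intros x. destruct (Rtotal_order 0 x) as [h0|[h0|h0]].
    - pose proof (conserved_integral n h M hn hh hM hw 0 x _ _ h0 (hhr 0) (hhr x)). lra.
    - subst x. rewrite RInt_point. change (@zero _) with 0. ring.
    - pose proof (conserved_integral n h M hn hh hM hw x 0 _ _ h0 (hhr x) (hhr 0)) as h1.
      rewrite <- opp_RInt_swap by apply hex. change (@opp _) with Ropp. lra. }
  assert (hcont : forall x, continuous hr x).
  { intros x. apply continuous_ext with (fun x => hr 0 - RInt n 0 x).
    - intros y. symmetry. apply heq.
    - apply cont_minus; [cont|]. apply continuous_RInt_regulated; assumption. }
  split; [assumption|]. split.
  - intros x. apply (left_limit_unique hr x).
    + apply limit_of_right_limits with h; auto.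
    + apply continuous_at_left; auto.
  - intros x. apply (right_derive_ext (fun x => hr 0 + -1 * RInt n 0 x) hr x (- nr x) 1); [lra| |].
    + intros y _. rewrite (heq y). ring.
    + replace (- nr x) with (0 + -1 * nr x) by ring. apply (right_derive_plus (fun _ => hr 0)).
      * apply right_derive_is_derive. apply (is_derive_const (V := R_NormedModule)).
      * apply right_derive_scal. apply right_derive_RInt; auto.
Qed.

Lemma regulated_comp (F : R * R -> R) (w : R -> R * R) (m M : R) :
  0 < m -> (forall xi, m <= fst (w xi) <= M) ->
  (forall xi, exists U, filterlim w (at_left xi) (locally U)) ->
  (forall xi, exists U, filterlim w (at_right xi) (locally U)) ->
  (forall U, 0 < fst U -> continuous F U) ->
  regulated (fun xi => F (w xi)).
Proof.
  intros hm hb hl hr hF xi.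
  assert (hp : forall U (Fi : (R -> Prop) -> Prop), ProperFilter Fi -> filterlim w Fi (locally U) -> 0 < fst U).
  { intros U Fi hFi hw. apply Rlt_le_trans with m; [assumption|].
    assert (h1 : filterlim (fun x => fst (w x)) Fi (locally (fst U))).
    { eapply filterlim_comp; [exact hw|]. apply (continuous_fst (fst U) (snd U)) || (destruct U; apply continuous_fst). }
    change (Rbar_le m (fst U)).
    apply (filterlim_le (F := Fi) (fun _ => m) (fun x => fst (w x))).
    - apply filter_forall. intros; apply hb.
    - apply filterlim_const.
    - exact h1. }
  split.
  - destruct (hl xi) as [U hU]. exists (F U). eapply filterlim_comp; [exact hU|].
    apply hF. apply (hp U (at_left xi)); [apply at_left_proper_filter|assumption].
  - destruct (hr xi) as [U hU]. exists (F U). eapply filterlim_comp; [exact hU|].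
    apply hF. apply (hp U (at_right xi)); [apply at_right_proper_filter|assumption].
Qed.

Lemma continuous_momentum_flux (c : R) (U : R * R) : 0 < fst U -> continuous (momentum_flux c) U.
Proof.
  destruct U as [r q]. intros h. simpl in h. unfold momentum_flux. cont. simpl; lra.
Qed.

Lemma continuous_energy (c : R) (U : R * R) : 0 < fst U -> continuous (energy c) U.
Proof.
  destruct U as [r q]. intros h. simpl in h. unfold energy. cont; simpl; lra.
Qed.

Lemma continuous_energy_flux (c : R) (U : R * R) : 0 < fst U -> continuous (energy_flux c) U.
Proof.
  intros h. unfold energy_flux.
  apply cont_mult; [|apply cont_plus; [apply continuous_energy; assumption|]];
  destruct U as [r q]; simpl in h; cont; simpl; lra.
Qed.

(** * The profile of a self-similar solution *)

(** [alpha xi] is the mass flux across the ray of speed [xi] and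
    [alpha^2 / rho + c^2 rho] the momentum flux in the frame of the ray.  Both
    are continuous, even across shocks, where [rm] and [rp], the densities on
    the left and on the right, differ. *)
Record profile (c : R) (rm rp alpha : R -> R) : Prop := {
  pf_bounds : exists m M, 0 < m /\ forall x, m <= rp x <= M /\ m <= rm x <= M;
  pf_alpha_bound : exists M, forall x, Rabs (alpha x + x * rp x) <= M;
  pf_right : forall x, filterlim rp (at_right x) (locally (rp x));
  pf_left : forall x, filterlim rp (at_left x) (locally (rm x));
  pf_alpha_cont : forall x, continuous alpha x;
  pf_alpha : forall x, right_derive alpha x (- rp x);
  pf_P_cont : forall x, continuous (fun y => alpha y ^ 2 / rp y + c ^ 2 * rp y) x;
  pf_P : forall x, right_derive (fun y => alpha y ^ 2 / rp y + c ^ 2 * rp y) x (- 2 * alpha x);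
  pf_jump : forall x, alpha x ^ 2 / rm x + c ^ 2 * rm x = alpha x ^ 2 / rp x + c ^ 2 * rp x;
  pf_entropy_pos : forall x, 0 < alpha x -> rm x <= rp x;
  pf_entropy_neg : forall x, alpha x < 0 -> rp x <= rm x
}.

(** In the frame of the ray the energy production reduces to the jump of
    [alpha (alpha^2 / (2 rho^2) + c^2 ln rho)]; for [alpha > 0] its sign
    forces compression. *)
Lemma entropy_compression (c a r s : R) :
  0 < c -> 0 < a -> 0 < r -> 0 < s ->
  a ^ 2 / r + c ^ 2 * r = a ^ 2 / s + c ^ 2 * s ->
  a ^ 2 / (2 * s ^ 2) + c ^ 2 * ln s <= a ^ 2 / (2 * r ^ 2) + c ^ 2 * ln r ->
  r <= s.
Proof.
  intros hc ha hr hs hP hE. apply Rnot_lt_le. intros hlt.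
  assert (hrs : a ^ 2 = c ^ 2 * (r * s)).
  { assert (h : (r - s) * (c ^ 2 * (r * s) - a ^ 2) = 0).
    { replace ((r - s) * (c ^ 2 * (r * s) - a ^ 2)) with
       (r * s * ((a ^ 2 / r + c ^ 2 * r) - (a ^ 2 / s + c ^ 2 * s))) by (field; lra).
      rewrite hP. ring. }
    apply Rmult_integral in h. destruct h; lra. }
  rewrite hrs in hE.
  assert (h2 : 2 * ln (r / s) < r / s - / (r / s)).
  { apply two_ln_lt. apply Rlt_div_r; lra. }
  rewrite ln_div in h2 by assumption.
  replace (c ^ 2 * (r * s) / (2 * s ^ 2)) with (c ^ 2 * (r / s) / 2) in hE by (field; lra).
  replace (c ^ 2 * (r * s) / (2 * r ^ 2)) with (c ^ 2 * / (r / s) / 2) in hE by (field; lra).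
  assert (0 < c ^ 2) by (apply pow_lt; assumption).
  assert (0 <= c ^ 2 * (/ (r / s) / 2 + ln r - r / s / 2 - ln s)) by lra.
  assert (/ (r / s) / 2 + ln r - r / s / 2 - ln s < 0) by lra. nra.
Qed.

Lemma limit_map (F : R * R -> R) (w : R -> R * R) (Fi : (R -> Prop) -> Prop) (U : R * R) :
  continuous F U -> filterlim w Fi (locally U) ->
  filterlim (fun x => F (w x)) Fi (locally (F U)).
Proof. intros hF hw. eapply filterlim_comp; [exact hw|exact hF]. Qed.

Lemma continuous_fst_R (U : R * R) : continuous (fun U : R * R => fst U) U.
Proof. destruct U. apply continuous_fst. Qed.

Lemma continuous_snd_R (U : R * R) : continuous (fun U : R * R => snd U) U.
Proof. destruct U. apply continuous_snd. Qed.

Lemma limit_le (f : R -> R) (Fi : (R -> Prop) -> Prop) (l m M : R) :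
  ProperFilter Fi -> (forall x, m <= f x <= M) -> filterlim f Fi (locally l) -> m <= l <= M.
Proof.
  intros hFi hb hl. split.
  - apply (filterlim_le (F := Fi) (fun _ => m) f m l); [|apply filterlim_const|exact hl].
    apply filter_forall. intros; apply hb.
  - apply (filterlim_le (F := Fi) f (fun _ => M) l M); [|exact hl|apply filterlim_const].
    apply filter_forall. intros; apply hb.
Qed.

(** One-sided limits of [G - x eta] along a self-similar field. *)
Lemma limit_flux (eta G : R * R -> R) (w : R -> R * R) (U : R * R) (x : R) (Fi : (R -> Prop) -> Prop) :
  Filter Fi -> continuous eta U -> continuous G U -> filterlim (fun y => y) Fi (locally x) ->
  filterlim w Fi (locally U) ->
  filterlim (fun y => G (w y) - y * eta (w y)) Fi (locally (G U - x * eta U)).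
Proof.
  intros hFi heta hG hx hw. unfold Rminus.
  eapply filterlim_comp_2; [apply (limit_map G w Fi U hG hw)| |apply (filterlim_plus (V := R_NormedModule))].
  eapply filterlim_comp; [|apply (filterlim_opp (V := R_NormedModule))].
  eapply filterlim_comp_2; [exact hx|apply (limit_map eta w Fi U heta hw)|apply (filterlim_mult (K := R_AbsRing))].
Qed.

Lemma energy_bound (c m M r q : R) :
  0 < m -> m <= r <= M -> Rabs q <= M ->
  Rabs (energy c (r, q)) <= M ^ 2 / (2 * m) + c ^ 2 * M * (Rabs (ln m) + Rabs (ln M)).
Proof.
  intros hm hr hq. unfold energy. simpl fst. simpl snd.
  eapply Rle_trans; [apply Rabs_triang|]. apply Rplus_le_compat.
  - rewrite Rabs_pos_eq.
    2:{ apply Rdiv_le_0_compat; [apply pow2_ge_0|lra]. }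
    assert (hq2 : q ^ 2 <= M ^ 2).
    { apply pow_maj_Rabs. assumption. }
    unfold Rdiv. apply Rmult_le_compat; [apply pow2_ge_0| |assumption|].
    + left; apply Rinv_0_lt_compat; lra.
    + apply Rinv_le_contravar; lra.
  - rewrite !Rabs_mult, (Rabs_pos_eq (c ^ 2)), (Rabs_pos_eq r) by (try apply pow2_ge_0; lra).
    assert (hln : ln m <= ln r <= ln M) by (split; apply ln_le; lra).
    assert (Rabs (ln r) <= Rabs (ln m) + Rabs (ln M)).
    { apply Rabs_le. pose proof (Rle_abs (ln M)). pose proof (Rle_abs (- ln m)).
      rewrite Rabs_Ropp in *. pose proof (Rabs_pos (ln m)). pose proof (Rabs_pos (ln M)). lra. }
    pose proof (pow2_ge_0 c). apply Rmult_le_compat; try apply Rabs_pos; try assumption.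
    + apply Rmult_le_pos; lra.
    + apply Rmult_le_compat_l; lra.
Qed.

(** The three balance laws, tested along rays, give the conservation of [alpha] and
    of the momentum flux and, at each jump, the sign of the compression; tested
    for small times, they give the initial states as the values beyond all the
    waves. *)
Lemma profile_of_solution (c : R) (Ua Ub : R * R) (w : R -> R * R) :
  0 < c -> riemann_solution c Ua Ub w ->
  exists rm rp alpha, profile c rm rp alpha /\
    (forall x, filterlim w (at_left x) (locally (rm x, alpha x + x * rm x)) /\
               filterlim w (at_right x) (locally (rp x, alpha x + x * rp x))) /\
    (forall s U0 X r q, (s = -1 /\ U0 = Ua) \/ (s = 1 /\ U0 = Ub) ->
       (forall x, X < s * x -> rp x = r /\ alpha x = q - x * r) -> U0 = (r, q)).
Proof.
  intros hc [[m [M [hm hb]]] hl hr hmass hmom hent].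
  set (wl := (fun x => (proj1_sig (constructive_indefinite_description _ (hl x)) : R * R))).
  set (wr := (fun x => (proj1_sig (constructive_indefinite_description _ (hr x)) : R * R))).
  assert (hwl : forall x, filterlim w (at_left x) (locally (wl x))).
  { intros x. unfold wl. apply (proj2_sig (constructive_indefinite_description _ (hl x))). }
  assert (hwr : forall x, filterlim w (at_right x) (locally (wr x))).
  { intros x. unfold wr. apply (proj2_sig (constructive_indefinite_description _ (hr x))). }
  clearbody wl wr.
  assert (hb1 : forall x, m <= fst (w x) <= M) by (intros; apply hb).
  assert (hlimb : forall (Fi : (R -> Prop) -> Prop) U, ProperFilter Fi -> filterlim w Fi (locally U) ->
     m <= fst U <= M /\ - M <= snd U <= M).
  { intros Fi U hFi hU. split.
    - apply (limit_le (fun x => fst (w x)) Fi); [assumption|apply hb|].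
      apply (limit_map (fun U => fst U) w); [apply continuous_fst_R|assumption].
    - apply (limit_le (fun x => snd (w x)) Fi); [assumption| |].
      + intros x. apply Rabs_le_between. apply hb.
      + apply (limit_map (fun U => snd U) w); [apply continuous_snd_R|assumption]. }
  assert (hbl : forall x, m <= fst (wl x) <= M /\ - M <= snd (wl x) <= M).
  { intros x. apply (hlimb (at_left x)); [apply at_left_proper_filter|apply hwl]. }
  assert (hbr : forall x, m <= fst (wr x) <= M /\ - M <= snd (wr x) <= M).
  { intros x. apply (hlimb (at_right x)); [apply at_right_proper_filter|apply hwr]. }
  assert (hpl : forall x, 0 < fst (wl x)) by (intros x; specialize (hbl x); lra).
  assert (hpr : forall x, 0 < fst (wr x)) by (intros x; specialize (hbr x); lra).
  assert (hreg : forall F, (forall U, 0 < fst U -> continuous F U) -> regulated (fun x => F (w x))).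
  { intros F hF. apply (regulated_comp F w m M); assumption. }
  assert (hL : forall eta G : R * R -> R, (forall U, 0 < fst U -> continuous eta U) ->
     (forall U, 0 < fst U -> continuous G U) -> forall x,
     filterlim (fun y => G (w y) - y * eta (w y)) (at_left x) (locally (G (wl x) - x * eta (wl x)))).
  { intros eta G heta hG x. apply limit_flux; [apply at_left_proper_filter|apply heta, hpl|apply hG, hpl| |apply hwl].
    apply (continuous_at_left (fun y => y)), continuous_id. }
  assert (hR : forall eta G : R * R -> R, (forall U, 0 < fst U -> continuous eta U) ->
     (forall U, 0 < fst U -> continuous G U) -> forall x,
     filterlim (fun y => G (w y) - y * eta (w y)) (at_right x) (locally (G (wr x) - x * eta (wr x)))).
  { intros eta G heta hG x. apply limit_flux; [apply at_right_proper_filter|apply heta, hpr|apply hG, hpr| |apply hwr].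
    apply (continuous_at_right (fun y => y)), continuous_id. }
  assert (hcons : forall (eta G : R * R -> R), (forall U, 0 < fst U -> continuous eta U) ->
     (forall U, 0 < fst U -> continuous G U) ->
     (forall K phi, test_function K phi -> weak_balance eta G w Ua Ub K phi = 0) ->
     weakly_conserved (fun x => eta (w x)) (fun x => G (w x) - x * eta (w x))).
  { intros eta G heta hG hwb A psi psi' hA hpsi hpsi' hpos hsupp.
    assert (htest : test_function (2 * A + 2) (fan_test psi)).
    { apply (test_function_fan_test psi psi' A); try assumption; lra. }
    specialize (hwb _ _ htest).
    rewrite (weak_balance_fan_test psi psi' A hA hpsi hpsi' hsupp) in hwb;
      [|lra|lra|apply hreg; assumption|apply hreg; assumption].
    pose proof bump_mass_pos as hbm.
    apply Rmult_integral in hwb. destruct hwb; eqR; lra. }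
  assert (cf : forall U : R * R, 0 < fst U -> continuous (fun U : R * R => fst U) U) by (intros; apply continuous_fst_R).
  assert (cs : forall U : R * R, 0 < fst U -> continuous (fun U : R * R => snd U) U) by (intros; apply continuous_snd_R).
  assert (cm : forall U : R * R, 0 < fst U -> continuous (momentum_flux c) U) by (intros; apply continuous_momentum_flux; assumption).
  assert (ce : forall U : R * R, 0 < fst U -> continuous (energy c) U) by (intros; apply continuous_energy; assumption).
  assert (cef : forall U : R * R, 0 < fst U -> continuous (energy_flux c) U) by (intros; apply continuous_energy_flux; assumption).
  destruct (conserved_profile _ _ _ _ (fun x => fst (wr x)) M (hreg _ cf)
    ltac:(intros x; apply Rabs_le; specialize (hb1 x); lra)
    (hcons _ _ cf cs hmass) (hL _ _ cf cs) (hR _ _ cf cs)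
    ltac:(intros x; apply limit_map; [apply continuous_fst_R|apply hwr])) as [A1 [A2 A3]].
  destruct (conserved_profile _ _ _ _ (fun x => snd (wr x)) M (hreg _ cs)
    ltac:(intros x; apply hb)
    (hcons _ _ cs cm hmom) (hL _ _ cs cm) (hR _ _ cs cm)
    ltac:(intros x; apply limit_map; [apply continuous_snd_R|apply hwr])) as [B1 [B2 B3]].
  set (rm := fun x => fst (wl x)). set (rp := fun x => fst (wr x)).
  set (alpha := fun x => snd (wr x) - x * fst (wr x)).
  assert (hrp : forall x, 0 < rp x) by (intros x; unfold rp; specialize (hbr x); lra).
  assert (hrm : forall x, 0 < rm x) by (intros x; unfold rm; specialize (hbl x); lra).
  assert (hqr : forall x, snd (wr x) = alpha x + x * rp x) by (intros; unfold alpha, rp; ring).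
  assert (hql : forall x, snd (wl x) = alpha x + x * rm x).
  { intros x. unfold alpha. rewrite <- A2. unfold rm. ring. }
  assert (hP : forall x r, r <> 0 -> alpha x ^ 2 / r + c ^ 2 * r =
     (momentum_flux c (r, alpha x + x * r) - x * (alpha x + x * r)) - x * alpha x).
  { intros x r h0. unfold momentum_flux. simpl fst; simpl snd. field. assumption. }
  assert (hPr : forall x, alpha x ^ 2 / rp x + c ^ 2 * rp x =
     (momentum_flux c (wr x) - x * snd (wr x)) - x * alpha x).
  { intros x. rewrite hP by (specialize (hrp x); lra). rewrite <- hqr.
    unfold rp. rewrite <- surjective_pairing. reflexivity. }
  assert (hjump : forall x, alpha x ^ 2 / rm x + c ^ 2 * rm x = alpha x ^ 2 / rp x + c ^ 2 * rp x).
  { intros x. rewrite hPr, <- B2. rewrite hP by (specialize (hrm x); lra). rewrite <- hql.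
    unfold rm. rewrite <- surjective_pairing. reflexivity. }
  (* The energy inequality across the ray of speed [x]. *)
  assert (hE : forall x, alpha x * (alpha x ^ 2 / (2 * rp x ^ 2) + c ^ 2 * ln (rp x)) <=
                         alpha x * (alpha x ^ 2 / (2 * rm x ^ 2) + c ^ 2 * ln (rm x))).
  { intros x.
    assert (hdec : energy_flux c (wr x) - x * energy c (wr x) <= energy_flux c (wl x) - x * energy c (wl x)).
    { apply (jump_decrease (fun y => energy c (w y)) (fun y => energy_flux c (w y) - y * energy c (w y))
        (M ^ 2 / (2 * m) + c ^ 2 * M * (Rabs (ln m) + Rabs (ln M))) x).
      - apply hreg; assumption.
      - intros y. split; eexists; [apply hL|apply hR]; assumption.
      - intros y. rewrite (surjective_pairing (w y)). apply energy_bound; [assumption|apply hb|apply hb].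
      - apply (weak_decrease _ _ (M ^ 2 / (2 * m) + c ^ 2 * M * (Rabs (ln m) + Rabs (ln M)))).
        + apply hreg; assumption.
        + intros y. split; eexists; [apply hL|apply hR]; assumption.
        + intros y. rewrite (surjective_pairing (w y)). apply energy_bound; [assumption|apply hb|apply hb].
        + intros A psi psi' hA hpsi hpsi' hpos hsupp.
          assert (htest : test_function (2 * A + 2) (fan_test psi)).
          { apply (test_function_fan_test psi psi' A); try assumption; lra. }
          specialize (hent _ _ htest).
          rewrite (weak_balance_fan_test psi psi' A hA hpsi hpsi' hsupp) in hent;
            [|lra|lra|apply hreg; assumption|apply hreg; assumption].
          pose proof bump_mass_pos as hbm.
          apply Rmult_le_reg_l with bump_mass; [assumption|].
          rewrite Rmult_minus_distr_l in hent.
          apply Rminus_le_0. apply hent.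
          intros t y _. unfold fan_test. apply Rmult_le_pos; [apply bump_ge0|apply hpos].
      - apply hL; assumption.
      - apply hR; assumption. }
    assert (hflux : forall U, 0 < fst U -> snd U = alpha x + x * fst U ->
      energy_flux c U - x * energy c U =
      alpha x * (alpha x ^ 2 / (2 * fst U ^ 2) + c ^ 2 * ln (fst U))
      + x * (alpha x ^ 2 / fst U + c ^ 2 * fst U) + alpha x * (x ^ 2 / 2 + c ^ 2)).
    { intros U hU1 hU2. unfold energy_flux, energy. rewrite hU2. field. lra. }
    rewrite (hflux _ (hrp x) (hqr x)), (hflux _ (hrm x) (hql x)) in hdec.
    fold (rp x) (rm x) in hdec. rewrite hjump in hdec. lra. }
  exists rm, rp, alpha. split; [|split].
  - constructor.
    + exists m, M. split; [assumption|]. intros x. unfold rm, rp. specialize (hbl x). specialize (hbr x). lra.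
    + exists M. intros x. rewrite <- hqr. apply Rabs_le. specialize (hbr x). lra.
    + intros x. apply (limit_of_right_limits_right (fun y => fst (w y))).
      intros y. apply (limit_map (fun U => fst U)); [apply continuous_fst_R|apply hwr].
    + intros x. apply (limit_of_right_limits (fun y => fst (w y))).
      * apply (limit_map (fun U => fst U)); [apply continuous_fst_R|apply hwl].
      * intros y. apply (limit_map (fun U => fst U)); [apply continuous_fst_R|apply hwr].
    + exact A1.
    + exact A3.
    + intros x. apply continuous_ext with (fun x => (momentum_flux c (wr x) - x * snd (wr x)) - x * alpha x).
      * intros y. symmetry. apply hPr.
      * apply cont_minus; [apply B1|]. apply cont_mult; [cont|apply A1].
    + intros x.
      assert (hprod : right_derive (fun y => y * alpha y) x (1 * alpha x + x * - rp x)).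
      { apply (right_derive_mult (fun y => y)); [|apply A3].
        apply right_derive_is_derive, (is_derive_id (K := R_AbsRing)). }
      apply (right_derive_ext (fun x => (momentum_flux c (wr x) - x * snd (wr x)) - x * alpha x) _ x _ 1); [lra| |].
      * intros y _. symmetry. apply hPr.
      * replace (-2 * alpha x) with (- snd (wr x) - (1 * alpha x + x * - rp x)) by (rewrite hqr; ring).
        apply right_derive_minus; [apply B3|assumption].
    + exact hjump.
    + intros x hx. apply (entropy_compression c (alpha x)); auto.
      apply Rmult_le_reg_l with (alpha x); [assumption|]. apply hE.
    + intros x hx. apply (entropy_compression c (- alpha x)); auto; [lra| |].
      * replace ((- alpha x) ^ 2) with (alpha x ^ 2) by ring. symmetry. apply hjump.
      * replace ((- alpha x) ^ 2) with (alpha x ^ 2) by ring.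
        apply Rmult_le_reg_l with (- alpha x); [lra|]. specialize (hE x). lra.
  - intros x. rewrite <- hql, <- hqr. unfold rm, rp. rewrite <- !surjective_pairing. auto.
  - intros s U0 X r q hs h.
    assert (hlim : forall F : R * R -> R, (forall U, 0 < fst U -> continuous F U) -> forall x, X < s * x ->
       filterlim (fun y => F (w y)) (at_right x) (locally (F (r, q)))).
    { intros F hF x hx. destruct (h x hx) as [h1 h2].
      replace (r, q) with (wr x).
      - apply limit_map; [|apply hwr]. apply hF, hrp.
      - rewrite (surjective_pairing (wr x)). fold (rp x). rewrite hqr, h1, h2. f_equal. ring. }
    assert (e1 : r = fst U0).
    { apply (weak_balance_data (fun U => fst U) (fun U => snd U) w Ua Ub U0 s X r q hs (hreg _ cf) (hreg _ cs)).
      - apply (hlim (fun U => fst U) cf).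
      - apply (hlim (fun U => snd U) cs).
      - exact hmass. }
    assert (e2 : q = snd U0).
    { apply (weak_balance_data (fun U => snd U) (momentum_flux c) w Ua Ub U0 s X q (momentum_flux c (r, q)) hs (hreg _ cs) (hreg _ cm)).
      - apply (hlim (fun U => snd U) cs).
      - apply (hlim (momentum_flux c) cm).
      - exact hmom. }
    rewrite (surjective_pairing U0), <- e1, <- e2. reflexivity.
Qed.

(** * Succession of the waves *)

Section SignZones.
Variables (z e em : R -> R).
Hypothesis hz : forall x, continuous z x.
Hypothesis hz0 : forall x, 0 <= z x.
Hypothesis hze : forall x, z x = 0 <-> e x = 0.
Hypothesis hdz : forall x, right_derive z x (- 2 * e x).
Hypothesis her : forall x, filterlim e (at_right x) (locally (e x)).
Hypothesis hel : forall x, filterlim e (at_left x) (locally (em x)).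
Hypothesis hent : forall x, em x <= 0 -> e x <= 0.

(** Let [s] be the supremum of the points before [y] where [e <= 0]. Beyond it [e > 0], so
    [z] decreases; but if [e] vanishes at [s], so does [z], which is nonnegative;
    and [e] cannot jump upwards across [0] at [s]. *)
Lemma nonpos_persists (x y : R) : e x <= 0 -> x <= y -> e y <= 0.
Proof.
  intros hx hxy. apply Rnot_lt_le. intros hy.
  set (E := fun t => x <= t <= y /\ e t <= 0).
  destruct (completeness E) as [s [hs1 hs2]].
  { exists y. intros t [ht _]; lra. }
  { exists x. split; lra. }
  assert (hsx : x <= s) by (apply hs1; split; lra).
  assert (hsy : s <= y) by (apply hs2; intros t [ht _]; lra).
  assert (hpos : forall t, s < t <= y -> 0 < e t).
  { intros t ht. apply Rnot_le_lt. intros hn. assert (t <= s); [|lra].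
    apply hs1. split; lra. }
  destruct (Rle_lt_dec (e s) 0) as [h|h].
  - assert (hs : 0 <= e s).
    { apply Rnot_lt_le. intros hn.
      assert (s < y). { destruct (Rle_lt_or_eq_dec _ _ hsy); [assumption|subst; lra]. }
      destruct (proj1 (right_limit_eps _ _ _) (her s) (- e s) ltac:(lra)) as [d [hd k]].
      set (t := s + Rmin d (y - s) / 2).
      assert (0 < Rmin d (y - s)) by (apply Rmin_pos; lra).
      pose proof (Rmin_l d (y - s)). pose proof (Rmin_r d (y - s)).
      specialize (k t ltac:(unfold t; lra)). specialize (hpos t ltac:(unfold t; lra)).
      apply Rabs_def2 in k. lra. }
    assert (hzs : z s = 0) by (apply hze; lra).
    assert (hzy : -1 * z s <= -1 * z y).
    { apply (right_derive_ge0_le (fun t => -1 * z t) s y); [assumption| |].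
      - intros t _. apply cont_mult; [cont|apply hz].
      - intros t ht. exists (-1 * (-2 * e t)). split; [|apply right_derive_scal, hdz].
        destruct (Rle_lt_or_eq_dec s t) as [h1|h1]; [lra| |subst t; lra].
        specialize (hpos t ltac:(lra)). lra. }
    assert (hzy0 : z y = 0) by (pose proof (hz0 y); lra).
    apply hze in hzy0. lra.
  - assert (hm : em s <= 0); [|apply hent in hm; lra].
    apply Rnot_lt_le. intros hn.
    destruct (proj1 (left_limit_eps _ _ _) (hel s) (em s) hn) as [d [hd k]].
    assert (s <= Rmax x (s - d)).
    { apply hs2. intros t ht. apply Rnot_lt_le. intros hlt.
      pose proof (Rmax_l x (s - d)). pose proof (Rmax_r x (s - d)).
      assert (t <= s) by (apply hs1; assumption).
      destruct ht as [ht1 ht2]. destruct (Rle_lt_or_eq_dec t s H1) as [h1|h1]; [|subst; lra].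
      specialize (k t ltac:(lra)). apply Rabs_def2 in k. lra. }
    unfold Rmax in H. destruct (Rle_dec x (s - d)); [lra|].
    assert (s = x) by lra. subst s. lra.
Qed.

(** [z] increases while [e <= 0], and is positive where [e < 0]. *)
Lemma neg_persists (x y : R) : e x < 0 -> x <= y -> e y < 0.
Proof.
  intros hx hxy.
  assert (hy : e y <= 0) by (apply (nonpos_persists x); lra).
  assert (hzxy : z x <= z y).
  { apply right_derive_ge0_le; [assumption|intros; apply hz|].
    intros t ht. exists (-2 * e t). split; [|apply hdz].
    assert (e t <= 0) by (apply (nonpos_persists x); lra). lra. }
  assert (hzx : z x <> 0) by (intros h; apply hze in h; lra).
  pose proof (hz0 x). destruct hy as [hy|hy]; [assumption|]. apply hze in hy. lra.
Qed.

(** [s1] and [s2] are the suprema of the sets where [e > 0] and [e >= 0]. *)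
Lemma sign_zones (a b : R) : 0 < e a -> e b < 0 ->
  exists s1 s2, s1 <= s2 /\ (forall x, x < s1 -> 0 < e x) /\
    (forall x, s1 <= x < s2 -> e x = 0) /\ (forall x, s2 < x -> e x < 0).
Proof.
  intros ha hb.
  destruct (completeness (fun x => 0 < e x)) as [s1 [h1 h1']].
  { exists b. intros x hx. apply Rnot_lt_le. intros hlt.
    assert (e x < 0) by (apply (neg_persists b); lra). lra. }
  { exists a. assumption. }
  destruct (completeness (fun x => 0 <= e x)) as [s2 [h2 h2']].
  { exists b. intros x hx. apply Rnot_lt_le. intros hlt.
    assert (e x < 0) by (apply (neg_persists b); lra). lra. }
  { exists a. lra. }
  assert (h12 : s1 <= s2) by (apply h1'; intros x hx; apply h2; lra).
  assert (hn : forall x, s1 < x -> e x <= 0).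
  { intros x hx. apply Rnot_lt_le. intros hlt. specialize (h1 x hlt). lra. }
  assert (hp : forall x, x < s2 -> 0 <= e x).
  { intros x hx. apply Rnot_lt_le. intros hlt. assert (s2 <= x); [|lra].
    apply h2'. intros y hy. apply Rnot_lt_le. intros hxy.
    assert (e y < 0) by (apply (neg_persists x); lra). lra. }
  exists s1, s2. split; [assumption|]. split; [|split].
  - intros x hx. apply Rnot_le_lt. intros hle. assert (s1 <= x); [|lra].
    apply h1'. intros y hy. apply Rnot_lt_le. intros hxy.
    assert (e y <= 0) by (apply (nonpos_persists x); lra). lra.
  - intros x hx. apply Rle_antisym; [|apply hp; lra].
    destruct (Rle_lt_or_eq_dec s1 x) as [h|h]; [lra|apply hn; assumption|].
    subst x. apply Rnot_lt_le. intros hlt.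
    destruct (proj1 (right_limit_eps _ _ _) (her s1) (e s1) hlt) as [d [hd k]].
    specialize (k (s1 + d / 2) ltac:(lra)). specialize (hn (s1 + d/2) ltac:(lra)).
    apply Rabs_def2 in k. lra.
  - intros x hx. apply Rnot_le_lt. intros hle. specialize (h2 x hle). lra.
Qed.

End SignZones.

Section Profile.
Variables (c : R) (rm rp alpha : R -> R).
Hypothesis hc : 0 < c.
Hypothesis hpf : profile c rm rp alpha.

Lemma profile_rp_pos (x : R) : 0 < rp x.
Proof. destruct (pf_bounds _ _ _ _ hpf) as [m [M [hm h]]]. specialize (h x). lra. Qed.

Lemma profile_rm_pos (x : R) : 0 < rm x.
Proof. destruct (pf_bounds _ _ _ _ hpf) as [m [M [hm h]]]. specialize (h x). lra. Qed.

Let P (x : R) : R := alpha x ^ 2 / rp x + c ^ 2 * rp x.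

(** [s = 1] singles out the slow family of waves, [s = - 1] the fast one. *)
Let z (s x : R) : R := P x - 2 * c * s * alpha x.
Let e (s x : R) : R := alpha x - s * c * rp x.

Let z_square (s x : R) : s * s = 1 -> z s x = (e s x) ^ 2 / rp x.
Proof.
  intros hs. pose proof (profile_rp_pos x). unfold z, P, e.
  replace ((alpha x - s * c * rp x) ^ 2) with
    (alpha x ^ 2 - 2 * c * s * alpha x * rp x + (s * s) * c ^ 2 * rp x ^ 2) by ring.
  rewrite hs. field. lra.
Qed.

Let z_square_left (s x : R) : s * s = 1 -> z s x = (alpha x - s * c * rm x) ^ 2 / rm x.
Proof.
  intros hs. pose proof (profile_rm_pos x). unfold z, P. rewrite <- (pf_jump _ _ _ _ hpf x).
  replace ((alpha x - s * c * rm x) ^ 2) with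
    (alpha x ^ 2 - 2 * c * s * alpha x * rm x + (s * s) * c ^ 2 * rm x ^ 2) by ring.
  rewrite hs. field. lra.
Qed.

Let z_continuous (s x : R) : continuous (z s) x.
Proof.
  unfold z. apply cont_minus; [apply (pf_P_cont _ _ _ _ hpf)|].
  apply cont_mult; [cont|apply (pf_alpha_cont _ _ _ _ hpf)].
Qed.

Let z_derive (s x : R) : right_derive (z s) x (- 2 * e s x).
Proof.
  unfold z. replace (-2 * e s x) with (-2 * alpha x - (2 * c * s) * (- rp x)) by (unfold e; ring).
  apply right_derive_minus; [apply (pf_P _ _ _ _ hpf)|].
  apply right_derive_scal. apply (pf_alpha _ _ _ _ hpf).
Qed.

Let z_zero (s x : R) : s * s = 1 -> z s x = 0 <-> e s x = 0.
Proof.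
  intros hs. rewrite z_square by assumption. pose proof (profile_rp_pos x).
  split; intros h.
  - apply Rmult_integral in h. destruct h as [h|h].
    + apply Rsqr_0_uniq. unfold Rsqr. rewrite <- h. ring.
    + assert (0 < / rp x) by (apply Rinv_0_lt_compat; assumption). lra.
  - rewrite h. unfold Rdiv. ring.
Qed.

Let e_right (s x : R) : filterlim (e s) (at_right x) (locally (e s x)).
Proof.
  unfold e, Rminus.
  eapply filterlim_comp_2; [apply continuous_at_right, (pf_alpha_cont _ _ _ _ hpf)| |apply (filterlim_plus (V := R_NormedModule))].
  eapply filterlim_comp; [|apply (filterlim_opp (V := R_NormedModule))].
  eapply filterlim_comp; [apply (pf_right _ _ _ _ hpf)|].
  apply (filterlim_scal_r (V := R_NormedModule) (s * c) (rp x)).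
Qed.

Let e_left (s x : R) : filterlim (e s) (at_left x) (locally (alpha x - s * c * rm x)).
Proof.
  unfold e, Rminus.
  eapply filterlim_comp_2; [apply continuous_at_left, (pf_alpha_cont _ _ _ _ hpf)| |apply (filterlim_plus (V := R_NormedModule))].
  eapply filterlim_comp; [|apply (filterlim_opp (V := R_NormedModule))].
  eapply filterlim_comp; [apply (pf_left _ _ _ _ hpf)|].
  apply (filterlim_scal_r (V := R_NormedModule) (s * c) (rm x)).
Qed.

Let e_entropy (s x : R) : s = 1 \/ s = - 1 -> alpha x - s * c * rm x <= 0 -> e s x <= 0.
Proof.
  intros hs h. unfold e. pose proof (profile_rp_pos x). pose proof (profile_rm_pos x).
  assert (0 < c * rp x) by (apply Rmult_lt_0_compat; assumption).
  assert (0 < c * rm x) by (apply Rmult_lt_0_compat; assumption).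
  destruct hs; subst s.
  - destruct (Rle_lt_dec (alpha x) 0) as [h0|h0]; [lra|].
    pose proof (pf_entropy_pos _ _ _ _ hpf x h0). nra.
  - pose proof (pf_entropy_neg _ _ _ _ hpf x ltac:(lra)). nra.
Qed.

Let e_far (s : R) : s = 1 \/ s = - 1 -> exists a b, 0 < e s a /\ e s b < 0.
Proof.
  intros hs. destruct (pf_bounds _ _ _ _ hpf) as [m [M [hm hb]]].
  destruct (pf_alpha_bound _ _ _ _ hpf) as [B hB].
  set (X := (Rabs B + c * M + 1) / m).
  assert (hXm : X * m = Rabs B + c * M + 1) by (unfold X; field; lra).
  assert (hM : m <= M) by (specialize (hb 0); lra).
  assert (0 < c * M) by (apply Rmult_lt_0_compat; lra).
  assert (hX : 0 < X). { unfold X. apply Rdiv_lt_0_compat; [pose proof (Rabs_pos B); lra|lra]. }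
  exists (- X), X. unfold e. split.
  - specialize (hB (- X)). specialize (hb (- X)). pose proof (Rle_abs B). apply Rabs_le_between in hB.
    destruct hs; subst s; nra.
  - specialize (hB X). specialize (hb X). pose proof (Rle_abs B). apply Rabs_le_between in hB.
    destruct hs; subst s; nra.
Qed.

Let zones (s : R) : s = 1 \/ s = - 1 ->
  exists s1 s2, s1 <= s2 /\ (forall x, x < s1 -> 0 < e s x) /\
    (forall x, s1 <= x < s2 -> e s x = 0) /\ (forall x, s2 < x -> e s x < 0).
Proof.
  intros hs. destruct (e_far s hs) as [a [b [ha hb]]].
  assert (hss : s * s = 1) by (destruct hs; subst s; ring).
  apply (sign_zones (z s) (e s) (fun x => alpha x - s * c * rm x)) with a b; try assumption; intros.
  - apply z_continuous.
  - rewrite z_square by assumption. apply Rdiv_le_0_compat; [apply pow2_ge_0|apply profile_rp_pos].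
  - apply z_zero; assumption.
  - apply z_derive.
  - apply e_right.
  - apply e_left.
  - apply e_entropy; assumption.
Qed.

(** Where [alpha - c rho] and [alpha + c rho] keep their signs, the state is
    constant: [(alpha -+ c rho) / sqrt rho] have the same derivative
    [- sqrt rho], and their difference is [2 c sqrt rho]. *)
Let state_constant (s1 s2 a b : R) :
  s1 * s1 = 1 -> s2 * s2 = 1 -> a <= b ->
  (forall x, a <= x <= b -> 0 < s1 * e 1 x) -> (forall x, a <= x <= b -> 0 < s2 * e (-1) x) ->
  rp a = rp b /\ alpha b = alpha a - rp a * (b - a).
Proof.
  intros hs1 hs2 hab he1 he2.
  assert (hsqrt : forall s t x, s = 1 \/ s = -1 -> t * t = 1 -> 0 < t * e s x ->
     t * sqrt (z s x) = e s x / sqrt (rp x) /\ right_derive (fun y => t * sqrt (z s y)) x (- sqrt (rp x))).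
  { intros s t x hs ht h.
    assert (hss : s * s = 1) by (destruct hs; subst s; ring).
    pose proof (profile_rp_pos x) as hr.
    assert (hsr : 0 < sqrt (rp x)) by (apply sqrt_lt_R0; assumption).
    assert (hzx : sqrt (z s x) = t * e s x / sqrt (rp x)).
    { rewrite z_square by assumption.
      replace (e s x ^ 2 / rp x) with ((t * e s x / sqrt (rp x)) ^ 2).
      - apply sqrt_pow2. apply Rdiv_le_0_compat; lra.
      - replace ((t * e s x / sqrt (rp x)) ^ 2) with ((t * t) * e s x ^ 2 / (sqrt (rp x) * sqrt (rp x))) by (field; lra).
        rewrite ht, sqrt_sqrt by lra. field. lra. }
    split.
    - rewrite hzx. replace (t * (t * e s x / sqrt (rp x))) with ((t * t) * e s x / sqrt (rp x)) by (field; lra).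
      rewrite ht. field. lra.
    - assert (hz0 : 0 < z s x).
      { rewrite z_square by assumption. apply Rdiv_lt_0_compat; [|assumption].
        apply pow2_gt_0. intros h0. rewrite h0 in h. lra. }
      assert (hE : e s x <> 0) by (intros h0; rewrite h0 in h; lra).
      assert (ht0 : t <> 0) by (intros h0; rewrite h0 in h; lra).
      replace (- sqrt (rp x)) with (t * (/ (2 * sqrt (z s x)) * (-2 * e s x))).
      + apply right_derive_scal. apply (right_derive_comp sqrt (z s)); [apply z_derive|].
        apply is_derive_Reals. apply derivable_pt_lim_sqrt. assumption.
      + rewrite hzx. field. repeat split; lra. }
  assert (hr : forall y, a <= y <= b -> rp y = rp a).
  { intros y hy.
    assert (heq : s2 * sqrt (z (-1) a) - s1 * sqrt (z 1 a) = s2 * sqrt (z (-1) y) - s1 * sqrt (z 1 y)).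
    { apply (right_derive_0_eq (fun x => s2 * sqrt (z (-1) x) - s1 * sqrt (z 1 x))); [lra| |].
      - intros x _. apply cont_minus; apply cont_mult; try apply cont_sqrt; try cont; apply z_continuous.
      - intros x hx. replace 0 with (- sqrt (rp x) - - sqrt (rp x)) by ring.
        apply right_derive_minus; apply hsqrt; auto; [apply he2|apply he1]; lra. }
    assert (hd : forall x, a <= x <= b -> s2 * sqrt (z (-1) x) - s1 * sqrt (z 1 x) = 2 * c * sqrt (rp x)).
    { intros x hx. pose proof (profile_rp_pos x).
      rewrite (proj1 (hsqrt (-1) s2 x (or_intror eq_refl) hs2 (he2 x hx))).
      rewrite (proj1 (hsqrt 1 s1 x (or_introl eq_refl) hs1 (he1 x hx))).
      unfold e. rewrite <- (sqrt_sqrt (rp x)) at 1 3 by lra. field.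
      assert (0 < sqrt (rp x)) by (apply sqrt_lt_R0; assumption). lra. }
    rewrite !hd in heq by lra. pose proof (profile_rp_pos y). pose proof (profile_rp_pos a).
    apply sqrt_inj; try lra. nra. }
  split; [symmetry; apply hr; lra|].
  assert (h : alpha a + rp a * a = alpha b + rp a * b).
  { apply (right_derive_0_eq (fun x => alpha x + rp a * x)); [assumption| |].
    - intros x _. apply cont_plus; [apply (pf_alpha_cont _ _ _ _ hpf)|cont].
    - intros x hx. replace 0 with (- rp x + rp a * 1) by (rewrite hr by lra; ring).
      apply right_derive_plus; [apply (pf_alpha _ _ _ _ hpf)|].
      apply right_derive_scal. apply right_derive_is_derive, (is_derive_id (K := R_AbsRing)). }
  lra.
Qed.

Let alpha_limit_left (x r q d : R) : 0 < d ->
  (forall y, x - d < y < x -> rp y = r /\ alpha y = q - y * r) ->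
  rm x = r /\ alpha x = q - x * r.
Proof.
  intros hd h. split.
  - apply (left_limit_unique rp x); [apply (pf_left _ _ _ _ hpf)|].
    apply left_limit_eps. intros e0 he0. exists d. split; [assumption|].
    intros y hy. rewrite (proj1 (h y hy)), Rminus_diag, Rabs_R0. assumption.
  - apply (left_limit_unique alpha x); [apply continuous_at_left, (pf_alpha_cont _ _ _ _ hpf)|].
    assert (hl : filterlim (fun y => q - y * r) (at_left x) (locally (q - x * r))).
    { apply (continuous_at_left (fun y => q - y * r)). cont. }
    apply left_limit_eps. intros e0 he0.
    destruct (proj1 (left_limit_eps _ _ _) hl e0 he0) as [d' [hd' k]].
    exists (Rmin d d'). split; [apply Rmin_pos; assumption|].
    pose proof (Rmin_l d d'). pose proof (Rmin_r d d').
    intros y hy. rewrite (proj2 (h y ltac:(lra))). apply k. lra.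
Qed.

Let alpha_limit_right (x r q d : R) : 0 < d ->
  (forall y, x < y < x + d -> rp y = r /\ alpha y = q - y * r) ->
  rp x = r /\ alpha x = q - x * r.
Proof.
  intros hd h. split.
  - apply (right_limit_unique rp x); [apply (pf_right _ _ _ _ hpf)|].
    apply right_limit_eps. intros e0 he0. exists d. split; [assumption|].
    intros y hy. rewrite (proj1 (h y hy)), Rminus_diag, Rabs_R0. assumption.
  - apply (right_limit_unique alpha x); [apply continuous_at_right, (pf_alpha_cont _ _ _ _ hpf)|].
    assert (hl : filterlim (fun y => q - y * r) (at_right x) (locally (q - x * r))).
    { apply (continuous_at_right (fun y => q - y * r)). cont. }
    apply right_limit_eps. intros e0 he0.
    destruct (proj1 (right_limit_eps _ _ _) hl e0 he0) as [d' [hd' k]].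
    exists (Rmin d d'). split; [apply Rmin_pos; assumption|].
    pose proof (Rmin_l d d'). pose proof (Rmin_r d d').
    intros y hy. rewrite (proj2 (h y ltac:(lra))). apply k. lra.
Qed.

(** Inside a fan [alpha = s c rho], hence [alpha' = - alpha / (s c)]. *)
Let fan_exponential (s a b : R) : s * s = 1 -> a <= b ->
  (forall x, a <= x < b -> e s x = 0) -> alpha b = alpha a * exp (- s * (b - a) / c).
Proof.
  intros hs hab he.
  assert (h : exp (s * a / c) * alpha a = exp (s * b / c) * alpha b).
  { assert (hprod : forall x, a <= x < b -> right_derive (fun x => exp (s * x / c) * alpha x) x 0).
    { intros x hx.
      assert (hex : right_derive (fun y => exp (s * y / c)) x (exp (s * x / c) * (s / c))).
      { apply right_derive_is_derive. auto_derive; [trivial|]. unfold Rdiv. eqR. ring. }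
      specialize (he x hx). unfold e in he.
      assert (hrx : rp x = s / c * alpha x).
      { replace (alpha x) with (s * c * rp x) by lra.
        replace (s / c * (s * c * rp x)) with ((s * s) * rp x) by (field; lra). rewrite hs. ring. }
      replace 0 with (exp (s * x / c) * (s / c) * alpha x + exp (s * x / c) * - rp x)
        by (rewrite hrx; field; lra).
      apply (right_derive_mult (fun y => exp (s * y / c)) alpha); [assumption|apply (pf_alpha _ _ _ _ hpf)]. }
    apply (right_derive_0_eq (fun x => exp (s * x / c) * alpha x)); [assumption| |assumption].
    intros x _. apply cont_mult; [|apply (pf_alpha_cont _ _ _ _ hpf)].
    apply cont_exp. apply cont_div; [cont|cont|lra]. }
  replace (- s * (b - a) / c) with (s * a / c + - (s * b / c)) by (field; lra).
  rewrite exp_plus, exp_Ropp.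
  pose proof (exp_pos (s * b / c)). apply Rmult_eq_reg_l with (exp (s * b / c)); [|lra].
  rewrite <- h. field. lra.
Qed.

(** The states on both sides of the family [s] are joined either by a shock or
    by a rarefaction fan. *)
Definition joined (s s1 s2 r1 q1 r2 q2 : R) : Prop :=
  (s1 = s2 /\ r1 * r2 = (q1 - s1 * r1) ^ 2 / c ^ 2 /\ q1 - s1 * r1 = q2 - s1 * r2 /\
     s * c * r1 <= q1 - s1 * r1 <= s * c * r2) \/
  (s1 < s2 /\ q1 - s1 * r1 = s * c * r1 /\ q2 - s2 * r2 = s * c * r2 /\
     r2 = r1 * exp (- s * (s2 - s1) / c)).

Let zone_joined (s s1 s2 r1 q1 r2 q2 d : R) : s = 1 \/ s = - 1 -> s1 <= s2 -> 0 < d ->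
  (forall x, s1 <= x < s2 -> e s x = 0) ->
  (forall x, s1 - d < x < s1 -> rp x = r1 /\ alpha x = q1 - x * r1) ->
  (forall x, s1 - d < x < s1 -> 0 < e s x) ->
  (forall x, s2 < x < s2 + d -> rp x = r2 /\ alpha x = q2 - x * r2) ->
  (forall x, s2 < x < s2 + d -> e s x < 0) ->
  joined s s1 s2 r1 q1 r2 q2.
Proof.
  intros hs hs12 hd h0 hl hl' hr hr'.
  assert (hss : s * s = 1) by (destruct hs; subst s; ring).
  destruct (alpha_limit_left s1 r1 q1 d hd hl) as [l1 l2].
  destruct (alpha_limit_right s2 r2 q2 d hd hr) as [k1 k2].
  pose proof (profile_rm_pos s1) as p1. pose proof (profile_rp_pos s2) as p2.
  rewrite l1 in p1. rewrite k1 in p2.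
  destruct (Rle_lt_or_eq_dec _ _ hs12) as [hlt|heq].
  - right. split; [assumption|].
    assert (e1 : alpha s1 = s * c * r1).
    { assert (hz1 : z s s1 = 0) by (apply z_zero; [assumption|apply h0; lra]).
      rewrite z_square_left, l1 in hz1 by assumption.
      apply Rmult_integral in hz1. destruct hz1 as [h|h].
      - assert (alpha s1 - s * c * r1 = 0); [|lra]. apply Rsqr_0_uniq. unfold Rsqr. rewrite <- h. ring.
      - assert (0 < / r1) by (apply Rinv_0_lt_compat; assumption). lra. }
    assert (e2 : alpha s2 = s * c * r2).
    { (* [z] vanishes on the fan, hence at its end *)
      assert (hz2 : z s s2 = 0).
      { apply (left_limit_unique (z s) s2); [apply continuous_at_left, z_continuous|].
        apply left_limit_eps. intros e0 he0. exists (s2 - s1). split; [lra|].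
        intros y hy. replace (z s y) with 0; [rewrite Rminus_diag, Rabs_R0; assumption|].
        symmetry. apply z_zero; [assumption|apply h0; lra]. }
      apply z_zero in hz2; [|assumption]. unfold e in hz2. rewrite k1 in hz2. lra. }
    split; [lra|]. split; [lra|].
    pose proof (fan_exponential s s1 s2 hss hs12 h0) as hf. rewrite e1, e2 in hf.
    apply Rmult_eq_reg_l with (s * c); [lra|]. destruct hs; subst s; lra.
  - left. subst s2. split; [reflexivity|].
    assert (i1 : 0 <= alpha s1 - s * c * r1).
    { rewrite <- l1. apply Rnot_lt_le. intros hn.
      destruct (proj1 (left_limit_eps _ _ _) (e_left s s1) (- (alpha s1 - s * c * rm s1)) ltac:(lra)) as [d' [hd' k]].
      assert (0 < Rmin d d') by (apply Rmin_pos; assumption).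
      pose proof (Rmin_l d d'). pose proof (Rmin_r d d').
      specialize (k (s1 - Rmin d d' / 2) ltac:(lra)). specialize (hl' (s1 - Rmin d d' / 2) ltac:(lra)).
      apply Rabs_def2 in k. lra. }
    assert (i2 : alpha s1 - s * c * r2 <= 0).
    { rewrite <- k1. apply Rnot_lt_le. intros hn.
      destruct (proj1 (right_limit_eps _ _ _) (e_right s s1) (e s s1) hn) as [d' [hd' k]].
      assert (0 < Rmin d d') by (apply Rmin_pos; assumption).
      pose proof (Rmin_l d d'). pose proof (Rmin_r d d').
      specialize (k (s1 + Rmin d d' / 2) ltac:(lra)). specialize (hr' (s1 + Rmin d d' / 2) ltac:(lra)).
      apply Rabs_def2 in k. lra. }
    split; [|split; [lra|lra]].
    pose proof (pf_jump _ _ _ _ hpf s1) as hj. rewrite l1, k1, l2 in hj. rewrite l2 in i1, i2.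
    set (a := q1 - s1 * r1) in *.
    assert (hprod : (r1 - r2) * (c ^ 2 * (r1 * r2) - a ^ 2) = 0).
    { replace ((r1 - r2) * (c ^ 2 * (r1 * r2) - a ^ 2)) with
       (r1 * r2 * ((a ^ 2 / r1 + c ^ 2 * r1) - (a ^ 2 / r2 + c ^ 2 * r2))) by (field; lra).
      rewrite hj. ring. }
    apply Rmult_eq_reg_l with (c ^ 2); [|apply pow_nonzero; lra].
    replace (c ^ 2 * (a ^ 2 / c ^ 2)) with (a ^ 2) by (field; lra).
    apply Rmult_integral in hprod. destruct hprod as [h|h]; [|lra].
    replace r2 with r1 in * by lra. replace a with (s * c * r1) by lra.
    replace ((s * c * r1) ^ 2) with ((s * s) * (c ^ 2 * (r1 * r1))) by ring. rewrite hss. ring.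
Qed.


(** The profile consists of three constant states separated by a slow wave
    filling [[s1, s2]] and a fast wave filling [[t1, t2]]. *)
Lemma two_wave_structure :
  exists s1 s2 t1 t2 rL qL rM qM rb qb,
    (s1 <= s2 /\ s2 < t1 /\ t1 <= t2) /\ (0 < rL /\ 0 < rM /\ 0 < rb) /\
    (forall x, x < s1 -> rp x = rL /\ alpha x = qL - x * rL) /\
    joined 1 s1 s2 rL qL rM qM /\ joined (-1) t1 t2 rM qM rb qb /\
    (forall x, x <= s1 -> rm x = rL /\ alpha x = qL - x * rL) /\
    (forall x, s1 < x <= s2 -> alpha x = c * rm x /\ rm x = rL * exp (- (x - s1) / c)) /\
    (forall x, s2 < x <= t1 -> rm x = rM /\ alpha x = qM - x * rM) /\
    (forall x, t1 < x <= t2 -> alpha x = - c * rm x /\ rm x = rM * exp ((x - t1) / c)) /\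
    (forall x, t2 < x -> rm x = rb /\ alpha x = qb - x * rb) /\
    (forall x, s1 <= x < s2 -> alpha x = c * rp x /\ rp x = rL * exp (- (x - s1) / c)) /\
    (forall x, s2 <= x < t1 -> rp x = rM /\ alpha x = qM - x * rM) /\
    (forall x, t1 <= x < t2 -> alpha x = - c * rp x /\ rp x = rM * exp ((x - t1) / c)) /\
    (forall x, t2 <= x -> rp x = rb /\ alpha x = qb - x * rb).
Proof.
  destruct (zones 1 (or_introl eq_refl)) as [s1 [s2 [hs [ha1 [ha2 ha3]]]]].
  destruct (zones (-1) (or_intror eq_refl)) as [t1 [t2 [ht [hb1 [hb2 hb3]]]]].
  assert (hst : s2 < t1).
  { apply Rnot_le_lt. intros hle.
    pose proof (profile_rm_pos s2). pose proof (profile_rp_pos s2).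
    assert (0 < c * rp s2) by (apply Rmult_lt_0_compat; assumption).
    assert (0 < c * rm s2) by (apply Rmult_lt_0_compat; assumption).
    assert (h1 : 0 <= alpha s2 - 1 * c * rm s2).
    { apply Rnot_lt_le. intros hn.
      destruct (proj1 (left_limit_eps _ _ _) (e_left 1 s2) (- (alpha s2 - 1 * c * rm s2)) ltac:(lra)) as [d [hd k]].
      assert (hx : exists x, s2 - d < x < s2 /\ x <> s1).
      { destruct (Req_dec s1 (s2 - d / 2)); [exists (s2 - d / 4)|exists (s2 - d / 2)]; lra. }
      destruct hx as [x [hx hx1]]. specialize (k x hx). apply Rabs_def2 in k.
      destruct (Rlt_le_dec x s1) as [h|h]; [specialize (ha1 x h)|specialize (ha2 x ltac:(lra))]; lra. }
    assert (h2 : e (-1) s2 <= 0).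
    { apply Rnot_lt_le. intros hn.
      destruct (proj1 (right_limit_eps _ _ _) (e_right (-1) s2) (e (-1) s2) hn) as [d [hd k]].
      assert (hx : exists x, s2 < x < s2 + d /\ x <> t2).
      { destruct (Req_dec t2 (s2 + d / 2)); [exists (s2 + d / 4)|exists (s2 + d / 2)]; lra. }
      destruct hx as [x [hx hx1]]. specialize (k x hx). apply Rabs_def2 in k.
      destruct (Rlt_le_dec x t2) as [h|h]; [specialize (hb2 x ltac:(lra))|specialize (hb3 x ltac:(lra))]; lra. }
    unfold e in h2. lra. }
  assert (he0 : forall x, e 1 x <= e (-1) x).
  { intros x. unfold e. pose proof (profile_rp_pos x). nra. }
  (* In each of the three zones the state is that of a reference point. *)
  assert (hzone : forall (Z : R -> Prop) (s t : R), s * s = 1 -> t * t = 1 ->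
     (forall x y u, Z x -> Z y -> x <= u <= y -> Z u) ->
     (forall x, Z x -> 0 < s * e 1 x /\ 0 < t * e (-1) x) ->
     forall x y, Z x -> Z y -> rp y = rp x /\ alpha y = (alpha x + x * rp x) - y * rp x).
  { intros Z s t hss htt hconv hsign x y hx hy.
    destruct (Rle_lt_dec x y) as [hxy|hxy].
    - destruct (state_constant s t x y hss htt hxy) as [k1 k2];
        [intros u hu; apply hsign, (hconv x y); auto..|]. split; lra.
    - destruct (state_constant s t y x hss htt ltac:(lra)) as [k1 k2];
        [intros u hu; apply hsign, (hconv y x); auto..|]. rewrite k1 in k2. split; lra. }
  set (a := s1 - 1). set (m := (s2 + t1) / 2). set (b := t2 + 1).
  assert (zL : forall x, x < s1 -> rp x = rp a /\ alpha x = (alpha a + a * rp a) - x * rp a).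
  { intros x hx. apply (hzone (fun x => x < s1) 1 1); try ring; try (unfold a; lra); intros; [lra|].
    specialize (ha1 x0 ltac:(lra)). specialize (he0 x0). lra. }
  assert (zM : forall x, s2 < x < t1 -> rp x = rp m /\ alpha x = (alpha m + m * rp m) - x * rp m).
  { intros x hx. apply (hzone (fun x => s2 < x < t1) (-1) 1); try ring; try (unfold m; lra); intros; [lra|].
    specialize (ha3 x0 ltac:(lra)). specialize (hb1 x0 ltac:(lra)). lra. }
  assert (zb : forall x, t2 < x -> rp x = rp b /\ alpha x = (alpha b + b * rp b) - x * rp b).
  { intros x hx. apply (hzone (fun x => t2 < x) (-1) (-1)); try ring; try (unfold b; lra); intros; [lra|].
    specialize (ha3 x0 ltac:(lra)). specialize (hb3 x0 ltac:(lra)). lra. }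
  exists s1, s2, t1, t2, (rp a), (alpha a + a * rp a), (rp m), (alpha m + m * rp m), (rp b), (alpha b + b * rp b).
  assert (j1 : joined 1 s1 s2 (rp a) (alpha a + a * rp a) (rp m) (alpha m + m * rp m)).
  { apply zone_joined with (t1 - s2); auto; try lra; intros x hx; [apply zL|apply ha1|apply zM|apply ha3]; lra. }
  assert (j2 : joined (-1) t1 t2 (rp m) (alpha m + m * rp m) (rp b) (alpha b + b * rp b)).
  { apply zone_joined with (t1 - s2); auto; try lra; intros x hx; [apply zM|apply hb1|apply zb|apply hb3]; lra. }
  (* States inside the fans: [z] vanishes there, so [alpha = s c rho]. *)
  assert (hfan : forall s u1 u2, s = 1 \/ s = -1 -> (forall x, u1 <= x < u2 -> e s x = 0) ->
     (forall x, u1 < x <= u2 -> alpha x = s * c * rm x) /\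
     (forall x, u1 <= x <= u2 -> alpha x = alpha u1 * exp (- s * (x - u1) / c))).
  { intros s u1 u2 hs' h0.
    assert (hss : s * s = 1) by (destruct hs'; subst s; ring). split; intros x hx.
    - assert (hz2 : z s x = 0).
      { apply (left_limit_unique (z s) x); [apply continuous_at_left, z_continuous|].
        apply left_limit_eps. intros e0 hpos. exists (x - u1). split; [lra|].
        intros y hy. replace (z s y) with 0; [rewrite Rminus_diag, Rabs_R0; assumption|].
        symmetry. apply z_zero; [assumption|apply h0; lra]. }
      rewrite z_square_left in hz2 by assumption. pose proof (profile_rm_pos x).
      apply Rmult_integral in hz2. destruct hz2 as [h|h].
      + assert (alpha x - s * c * rm x = 0); [|lra]. apply Rsqr_0_uniq. unfold Rsqr. rewrite <- h. ring.
      + assert (0 < / rm x) by (apply Rinv_0_lt_compat; assumption). lra.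
    - apply fan_exponential; [assumption|lra|]. intros y hy. apply h0. lra. }
  assert (lL : forall x, x <= s1 -> rm x = rp a /\ alpha x = (alpha a + a * rp a) - x * rp a).
  { intros x hx. apply (alpha_limit_left x _ _ 1); [lra|]. intros y hy. apply zL. lra. }
  assert (lM : forall x, s2 < x <= t1 -> rm x = rp m /\ alpha x = (alpha m + m * rp m) - x * rp m).
  { intros x hx. apply (alpha_limit_left x _ _ (x - s2)); [lra|]. intros y hy. apply zM. lra. }
  assert (lb : forall x, t2 < x -> rm x = rp b /\ alpha x = (alpha b + b * rp b) - x * rp b).
  { intros x hx. apply (alpha_limit_left x _ _ (x - t2)); [lra|]. intros y hy. apply zb. lra. }
  destruct (hfan 1 s1 s2 (or_introl eq_refl) ha2) as [f1 g1].
  destruct (hfan (-1) t1 t2 (or_intror eq_refl) hb2) as [f2 g2].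
  assert (g1' : s1 < s2 -> forall x, s1 <= x <= s2 -> alpha x = c * (rp a * exp (- (x - s1) / c))).
  { intros hlt x hx. rewrite g1 by assumption.
    destruct j1 as [[h _]|[_ [h _]]]; [lra|].
    rewrite <- (proj2 (lL s1 (Rle_refl _))) in h. rewrite h.
    replace (- (x - s1) / c) with (- (1) * (x - s1) / c) by (field; lra). ring. }
  assert (g2' : t1 < t2 -> forall x, t1 <= x <= t2 -> alpha x = - c * (rp m * exp ((x - t1) / c))).
  { intros hlt x hx. rewrite g2 by assumption.
    destruct j2 as [[h _]|[_ [h _]]]; [lra|].
    rewrite <- (proj2 (lM t1 ltac:(lra))) in h. rewrite h.
    replace ((x - t1) / c) with (- (-1) * (x - t1) / c) by (field; lra). ring. }
  split; [auto|]. split; [repeat split; apply profile_rp_pos|].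
  split; [exact zL|]. split; [exact j1|]. split; [exact j2|]. split; [exact lL|].
  split; [|split; [exact lM|split; [|split; [exact lb|split; [|split; [|split]]]]]].
  - intros x hx. specialize (f1 x hx). specialize (g1' ltac:(lra) x ltac:(lra)).
    split; [lra|]. apply Rmult_eq_reg_l with c; lra.
  - intros x hx. specialize (f2 x hx). specialize (g2' ltac:(lra) x ltac:(lra)).
    split; [lra|]. apply Rmult_eq_reg_l with c; lra.
  - intros x hx. specialize (ha2 x hx). unfold e in ha2. specialize (g1' ltac:(lra) x ltac:(lra)).
    split; [lra|]. apply Rmult_eq_reg_l with c; lra.
  - intros x hx. apply (alpha_limit_right x _ _ (t1 - x)); [lra|]. intros y hy. apply zM. lra.
  - intros x hx. specialize (hb2 x hx). unfold e in hb2. specialize (g2' ltac:(lra) x ltac:(lra)).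
    split; [lra|]. apply Rmult_eq_reg_l with c; lra.
  - intros x hx. apply (alpha_limit_right x _ _ 1); [lra|]. intros y hy. apply zb. lra.
Qed.

End Profile.

(** * Accessible traces *)

(** The density on the other side of a stationary shock. *)
Definition conj_density (c alpha rho : R) : R := alpha ^ 2 / (c ^ 2 * rho).

(** [wave_velocity] in the frame of the particle, in terms of the state
    [(rho0, alpha0)]. *)
Definition phi (c rho0 alpha0 rho : R) : R := wave_velocity c rho0 (alpha0 / rho0) rho.

(** The traces, on the left of the particle, of the Riemann solutions issued
    from the left state [(rho0, alpha0)]: that state itself; the states of the
    slow wave curve, continued by the sonic states once its velocity
    goes below [- c]; and the states overtaken by all the waves. *)
Definition accessible (c rho0 alpha0 rho alpha : R) : Prop :=
  0 < rho /\
  ( (c * rho < alpha /\ rho = rho0 /\ alpha = alpha0)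
    \/
    (alpha = rho * Rmax (phi c rho0 alpha0 rho) (- c) /\
     phi c rho0 alpha0 rho <= c /\
     (c * rho0 < alpha0 -> conj_density c alpha0 rho0 < rho))
    \/
    (alpha < - c * rho /\
     conj_density c alpha rho * phi c rho0 alpha0 (conj_density c alpha rho) < alpha) ).

Lemma joined_slow_velocity (c s1 s2 r1 q1 r2 q2 : R) :
  0 < c -> 0 < r1 -> 0 < r2 -> joined c 1 s1 s2 r1 q1 r2 q2 ->
  wave_velocity c r1 (q1 / r1) r2 = q2 / r2.
Proof.
  intros hc h1 h2 [[hs [hp [hq hi]]]|[hs [k1 [k2 k3]]]]; unfold wave_velocity.
  - set (a := q1 - s1 * r1) in *.
    assert (ha : 0 < a) by (assert (0 < c * r1) by (apply Rmult_lt_0_compat; assumption); lra).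
    assert (hr2 : r2 = (a / (c * r1)) ^ 2 * r1).
    { apply Rmult_eq_reg_l with r1; [|lra]. rewrite hp. field. lra. }
    assert (hge : 1 <= a / (c * r1)).
    { apply Rle_div_r; [apply Rmult_lt_0_compat; assumption|lra]. }
    assert (hsq : sqrt (r2 / r1) = a / (c * r1)).
    { replace (r2 / r1) with ((a / (c * r1)) ^ 2) by (rewrite hr2; field; lra).
      apply sqrt_pow2. lra. }
    rewrite hug_shock, hsq.
    + replace q2 with (a + s1 * r2) by lra. replace q1 with (a + s1 * r1) by (unfold a; ring).
      rewrite hr2. field. lra.
    + replace (r2 / r1) with ((a / (c * r1)) ^ 2) by (rewrite hr2; field; lra).
      apply pow_R1_Rle. assumption.
  - assert (hr : r2 / r1 = exp (- (s2 - s1) / c)).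
    { rewrite k3. replace (- (1) * (s2 - s1) / c) with (- (s2 - s1) / c) by (field; lra). field. lra. }
    rewrite hug_rarefaction.
    + rewrite hr, ln_exp. replace q1 with ((c + s1) * r1) by lra. replace q2 with ((c + s2) * r2) by lra.
      field. lra.
    + rewrite hr, <- exp_0.
      assert (hle : - (s2 - s1) / c <= 0) by (apply Rle_div_l; lra).
      destruct hle as [hle|hle]; [left; apply exp_increasing; assumption|rewrite hle; right; reflexivity].
Qed.

Lemma phi_shift (c rho0 q0 v rho : R) : 0 < rho0 ->
  phi c rho0 (q0 - v * rho0) rho = wave_velocity c rho0 (q0 / rho0) rho - v.
Proof.
  intros h. unfold phi, wave_velocity. field. lra.
Qed.

Lemma exp_ge_1 (x : R) : 0 <= x -> 1 <= exp x.
Proof.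
  intros [h|h]; [left; rewrite <- exp_0; apply exp_increasing; assumption|].
  rewrite <- h, exp_0. lra.
Qed.

(** The three cases of [accessible] correspond to the position of the particle: on
    the left of the slow wave (first case, or the sonic end of the second one);
    inside a fan or between the two waves (second case); on the right of the fast
    wave (third case). In the last case the fast wave moves to the left of the
    particle, which yields a density below the conjugate one where the flux
    along the slow curve is at most [alpha]; this flux decreases. *)
Lemma V_minus_accessible (c r0 a0 v rho alpha : R) :
  0 < c -> 0 < r0 -> V_minus c r0 a0 v (rho, alpha) -> accessible c r0 a0 rho alpha.
Proof.
  intros hc h0 [r [q [[Ub [w [hUb [hsol hlim]]]] heq]]].
  injection heq as hr hq. subst rho alpha.
  destruct (profile_of_solution c _ _ _ hc hsol) as [rm [rp [al [hpf [hw hdata]]]]].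
  destruct (two_wave_structure c rm rp al hc hpf) as
    [s1 [s2 [t1 [t2 [rL [qL [rM [qM [rb [qb [[h12 [h23 h34]] [[pL [pM pb]] [zL [j1 [j2 [lL [f1 [lM [f2 [lb _]]]]]]]]]]]]]]]]]]]].
  (* The trace and the initial state are read off the profile. *)
  assert (hS : (r, q) = (rm v, al v + v * rm v)).
  { apply (filterlim_locally_unique (K := R_AbsRing) (V := prod_NormedModule R_AbsRing R_NormedModule R_NormedModule)
             (F := at_left v) w); [exact hlim|apply hw]. }
  injection hS as hS1 hS2.
  assert (hL : (r0, a0 + v * r0) = (rL, qL)).
  { apply (hdata (-1) _ (- s1)); [left; auto|]. intros x hx. apply zL. lra. }
  injection hL as hL1 hL2. subst rL.
  assert (hqL : a0 = qL - v * r0) by lra.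
  replace (q - v * r) with (al v) by (rewrite hS1, hS2; ring).
  rewrite hS1. clear hS1 hS2 hlim hw r q.
  pose proof (joined_slow_velocity c s1 s2 r0 qL rM qM hc h0 pM j1) as hvel.
  assert (hphi : forall x, phi c r0 a0 x = wave_velocity c r0 (qL / r0) x - v).
  { intros x. rewrite hqL. apply phi_shift. assumption. }
  assert (hphiM : phi c r0 a0 rM = qM / rM - v) by (rewrite hphi, hvel; ring).
  assert (hphiM' : rM * phi c r0 a0 rM = qM - v * rM) by (rewrite hphiM; field; lra).
  assert (hcr0 : 0 < c * r0) by (apply Rmult_lt_0_compat; assumption).
  assert (hcrM : 0 < c * rM) by (apply Rmult_lt_0_compat; assumption).
  assert (hcrb : 0 < c * rb) by (apply Rmult_lt_0_compat; assumption).
  assert (c2 : 0 < c ^ 2) by (apply pow_lt; assumption).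
  (* A supersonic left state can only be left through a shock. *)
  assert (hshock : s2 < v -> c * r0 < a0 -> conj_density c a0 r0 < rM).
  { intros hv hsup. unfold conj_density. destruct j1 as [[hs [hp [_ _]]]|[hs [k1 _]]]; [|nra].
    subst s2. apply Rlt_div_l; [apply Rmult_lt_0_compat; assumption|].
    replace (rM * (c ^ 2 * r0)) with (c ^ 2 * (r0 * rM)) by ring. rewrite hp.
    replace (c ^ 2 * ((qL - s1 * r0) ^ 2 / c ^ 2)) with ((qL - s1 * r0) ^ 2) by (field; lra).
    assert (a0 < qL - s1 * r0) by nra. nra. }
  assert (hM_slow : s2 < v -> qM - v * rM < c * rM).
  { intros hv. assert (qM - s2 * rM <= c * rM).
    { destruct j1 as [[hs [hp [hq hi]]]|[hs [k1 [k2 k3]]]]; [subst s2|]; lra. }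
    nra. }
  split.
  { destruct (pf_bounds _ _ _ _ hpf) as [m [M [hm hb]]]. specialize (hb v). lra. }
  destruct (Rle_lt_dec v s1) as [c1|c1]; [|destruct (Rle_lt_dec v s2) as [c2'|c2'];
    [|destruct (Rle_lt_dec v t1) as [c3|c3]; [|destruct (Rle_lt_dec v t2) as [c4|c4]]]].
  - destruct (lL v c1) as [e1 e2]. rewrite e1, e2.
    assert (hge : c * r0 <= a0).
    { assert (c * r0 <= qL - s1 * r0).
      { destruct j1 as [[hs [hp [hq hi]]]|[hs [k1 [k2 k3]]]]; lra. }
      nra. }
    destruct hge as [hge|hge]; [left; split; [lra|split; [reflexivity|lra]]|].
    right; left.
    assert (hpc : phi c r0 a0 r0 = c).
    { unfold phi, wave_velocity. replace (r0 / r0) with 1 by (field; lra).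
      rewrite hug_rarefaction, ln_1 by lra. rewrite <- hge. field. lra. }
    rewrite hpc, Rmax_left by lra. split; [lra|]. split; lra.
  - destruct (f1 v (conj c1 c2')) as [e1 e2].
    right; left.
    assert (hrat : rm v / r0 = exp (- (v - s1) / c)) by (rewrite e2; field; lra).
    assert (hk : qL - s1 * r0 = c * r0).
    { destruct j1 as [[hs _]|[hs [k1 _]]]; lra. }
    assert (hpc : phi c r0 a0 (rm v) = c).
    { rewrite hphi. unfold wave_velocity. rewrite hrat, hug_rarefaction, ln_exp.
      - replace qL with ((c + s1) * r0) by lra. field. lra.
      - rewrite <- exp_0. left. apply exp_increasing. apply Rlt_div_l; lra. }
    rewrite hpc, Rmax_left by lra. split; [lra|]. split; [lra|]. intros hsup. nra.
  - destruct (lM v (conj c2' c3)) as [e1 e2]. rewrite e1, e2. right; left.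
    assert (hfast : - c * rM <= qM - v * rM).
    { assert (- c * rM <= qM - t1 * rM).
      { destruct j2 as [[hs [hp [hq hi]]]|[hs [k1 [k2 k3]]]]; [|lra].
        apply Ropp_le_cancel. assert (h2 : qM - t1 * rM = qb - t1 * rb) by lra.
        assert (hsq : (qM - t1 * rM) ^ 2 <= (c * rM) ^ 2).
        { assert (hrr : (qM - t1 * rM) ^ 2 = c ^ 2 * (rM * rb)) by (rewrite hp; field; lra).
          rewrite hrr. assert (rb <= rM); [|nra].
          assert (hab : (c * rb) ^ 2 <= (qM - t1 * rM) ^ 2) by nra.
          rewrite hrr in hab. apply Rmult_le_reg_l with (c ^ 2 * rb); [apply Rmult_lt_0_compat; assumption|]. nra. }
        apply Rnot_lt_le. intros hn. nra. }
      nra. }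
    assert (hge : - c <= phi c r0 a0 rM).
    { apply Rmult_le_reg_l with rM; [assumption|]. rewrite hphiM'. lra. }
    rewrite Rmax_left, hphiM' by assumption. split; [reflexivity|]. split; [|apply hshock; assumption].
    apply Rmult_le_reg_l with rM; [assumption|]. rewrite hphiM'. specialize (hM_slow c2'). lra.
  - destruct (f2 v (conj c3 c4)) as [e1 e2]. right; left.
    assert (hk : qM - t1 * rM = - c * rM).
    { destruct j2 as [[hs _]|[hs [k1 _]]]; lra. }
    assert (hge : rM <= rm v).
    { rewrite e2. rewrite <- (Rmult_1_r rM) at 1. apply Rmult_le_compat_l; [lra|].
      apply exp_ge_1. apply Rdiv_le_0_compat; lra. }
    assert (hlt : phi c r0 a0 (rm v) <= - c).
    { apply Rle_trans with (phi c r0 a0 rM).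
      - destruct hge as [hge|hge]; [|rewrite <- hge; lra].
        left. apply wave_velocity_decr; try assumption. lra.
      - apply Rmult_le_reg_l with rM; [assumption|]. rewrite hphiM'. nra. }
    rewrite Rmax_right by assumption. split; [lra|]. split; [lra|].
    intros hsup. specialize (hshock ltac:(lra) hsup). lra.
  - destruct (lb v c4) as [e1 e2]. rewrite e1, e2. right; right.
    set (a := qb - v * rb).
    assert (hb2 : qb - t2 * rb <= - c * rb).
    { destruct j2 as [[hs [hp [hq hi]]]|[hs [k1 [k2 k3]]]]; [subst t2|]; lra. }
    assert (ha : a < - c * rb) by (unfold a; nra).
    split; [assumption|].
    set (rh := conj_density c a rb).
    assert (hrh : c ^ 2 * rb * rh = a ^ 2).
    { unfold rh, conj_density. field. lra. }
    (* Whether the fast wave is a shock or a fan, a density [r] between [rM]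
       and [rh] has [r * phi r <= a]. *)
    assert (hkey : exists r1, rM <= r1 < rh /\ r1 * phi c r0 a0 r1 <= a).
    { destruct j2 as [[hs [hp [hq hi]]]|[hs [k1 [k2 k3]]]].
      - subst t2. exists rM. set (at1 := qM - t1 * rM) in *.
        assert (hp' : at1 ^ 2 = c ^ 2 * (rM * rb)) by (rewrite hp; field; lra).
        assert (hlt : a < at1) by (unfold a; nra).
        assert (hsq : at1 ^ 2 < a ^ 2) by nra.
        assert (rM < rh).
        { apply Rmult_lt_reg_l with (c ^ 2 * rb); [apply Rmult_lt_0_compat; assumption|].
          rewrite hrh. replace (c ^ 2 * rb * rM) with (c ^ 2 * (rM * rb)) by ring. lra. }
        assert (rb <= rM).
        { apply Rmult_le_reg_l with (c ^ 2 * rb); [apply Rmult_lt_0_compat; assumption|].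
          replace (c ^ 2 * rb * rM) with (at1 ^ 2) by (rewrite hp'; ring). nra. }
        split; [lra|]. rewrite hphiM'. unfold a, at1 in *. nra.
      - exists rb.
        assert (hge : rM <= rb).
        { rewrite k3. rewrite <- (Rmult_1_r rM) at 1. apply Rmult_le_compat_l; [lra|].
          apply exp_ge_1. apply Rdiv_le_0_compat; lra. }
        split; [split; [assumption|]|].
        + apply Rmult_lt_reg_l with (c ^ 2 * rb); [apply Rmult_lt_0_compat; assumption|].
          rewrite hrh. nra.
        + apply Rle_trans with (rb * phi c r0 a0 rM).
          * apply Rmult_le_compat_l; [lra|]. destruct hge as [hge|hge]; [|rewrite <- hge; lra].
            left. apply wave_velocity_decr; try assumption. lra.
          * assert (phi c r0 a0 rM = t1 - c - v).
            { apply Rmult_eq_reg_l with rM; [|lra]. rewrite hphiM'. lra. }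
            rewrite H. unfold a. nra. }
    destruct hkey as [r1 [hr1 hk]].
    eapply Rlt_le_trans; [|exact hk]. apply wave_flux_decr; try assumption; [lra|].
    change (phi c r0 a0 r1 <= c). apply Rmult_le_reg_l with r1; [lra|].
    assert (0 < c * r1) by (apply Rmult_lt_0_compat; lra). lra.
Qed.

(** * Self-similar fields as weak solutions *)

(** Continuity is uniform in the second variable over a segment. *)
Lemma uniform_in_parameter (g : R -> R -> R) (t0 a b e : R) :
  a <= b -> 0 < e ->
  (forall x, continuous (fun p : R * R => g (fst p) (snd p)) (t0, x)) ->
  exists d, 0 < d /\ forall t x : R, Rabs (t - t0) < d -> a <= x <= b -> Rabs (g t x - g t0 x) <= e.
Proof.
  intros hab he hg.
  apply (interval_induction (fun u v => exists d, 0 < d /\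
    forall t x : R, Rabs (t - t0) < d -> u <= x <= v -> Rabs (g t x - g t0 x) <= e)); [assumption| |].
  - intros x y z hxy hyz [d1 [h1 k1]] [d2 [h2 k2]].
    exists (Rmin d1 d2). split; [apply Rmin_pos; assumption|].
    pose proof (Rmin_l d1 d2). pose proof (Rmin_r d1 d2).
    intros t u ht hu. destruct (Rle_lt_dec u y); [apply k1|apply k2]; lra.
  - intros x _. destruct (proj1 (filterlim_locally _ _) (hg x) (mkposreal (e/2) ltac:(lra))) as [d hd].
    exists d. split; [apply cond_pos|]. intros y z _ _ h1 h2 h3 h4.
    exists d. split; [apply cond_pos|]. intros t u ht hu.
    assert (k : forall s, Rabs (s - t0) < d -> Rabs (g s u - g t0 x) < e / 2).
    { intros s hs. apply (hd (s, u)). split; simpl.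
      - exact hs.
      - change (Rabs (u - x) < d). apply Rabs_def1; lra. }
    pose proof (k t ht) as k1. pose proof (k t0 ltac:(rewrite Rminus_diag, Rabs_R0; apply cond_pos)) as k2.
    apply Rabs_def2 in k1, k2. apply Rabs_le. lra.
Qed.

(** Integrals against a discontinuous weight depend smoothly on a parameter. *)
Section ParameterIntegral.
Variables (n : R -> R) (M a b : R).
Hypothesis hab : a <= b.
Hypothesis hn : regulated n.
Hypothesis hM : forall x, Rabs (n x) <= M.

Let M_ge0 : 0 <= M.
Proof. eapply Rle_trans; [apply Rabs_pos|apply (hM 0)]. Qed.

Let section_continuous (g : R -> R -> R) (t : R) :
  (forall x, continuous (fun p : R * R => g (fst p) (snd p)) (t, x)) ->
  forall x, continuous (g t) x.
Proof.
  intros hg x. apply (continuous_comp_2 (fun _ => t) (fun y => y) g); [cont|cont|apply hg].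
Qed.

Lemma ex_RInt_weight (g : R -> R) : (forall x : R, continuous g x) -> ex_RInt (fun x => n x * g x) a b.
Proof.
  intros hg. apply ex_RInt_regulated, regulated_mult; [assumption|].
  apply regulated_continuous; assumption.
Qed.

Lemma RInt_weight_bound (g : R -> R) (e : R) : (forall x : R, continuous g x) ->
  (forall x, a <= x <= b -> Rabs (g x) <= e) ->
  Rabs (RInt (fun x => n x * g x) a b) <= (b - a) * (M * e).
Proof.
  intros hg he. apply abs_RInt_le_const; [assumption|apply ex_RInt_weight; assumption|].
  intros x hx. rewrite Rabs_mult. apply Rmult_le_compat; try apply Rabs_pos; [apply hM|apply he; assumption].
Qed.

Lemma continuous_RInt_weight (g : R -> R -> R) (t0 : R) :
  (forall t x : R, continuous (fun p : R * R => g (fst p) (snd p)) (t, x)) ->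
  continuous (fun t => RInt (fun x => n x * g t x) a b) t0.
Proof.
  intros hg. apply continuous_eps. intros e he.
  set (k := (b - a) * M + 1).
  assert (hk : 0 < k) by (unfold k; assert (0 <= (b - a) * M) by (apply Rmult_le_pos; lra); lra).
  destruct (uniform_in_parameter g t0 a b (e / (2 * k)) hab) as [d [hd h]].
  { apply Rdiv_lt_0_compat; lra. }
  { apply hg. }
  exists d. split; [assumption|]. intros t ht.
  rewrite <- RInt_minus_R by (apply ex_RInt_weight, section_continuous, hg).
  rewrite (RInt_ext _ (fun x => n x * (g t x - g t0 x))) by (intros; eqR; ring).
  eapply Rle_lt_trans.
  - apply RInt_weight_bound with (e := e / (2 * k)).
    + intros x. apply cont_minus; apply section_continuous, hg.
    + intros x hx. apply h; assumption.
  - apply Rle_lt_trans with (k * (e / (2 * k))).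
    + rewrite <- Rmult_assoc. apply Rmult_le_compat_r; [left; apply Rdiv_lt_0_compat; lra|unfold k; lra].
    + replace (k * (e / (2 * k))) with (e / 2) by (field; lra). lra.
Qed.

Lemma is_derive_RInt_weight (g g' : R -> R -> R) (t0 : R) :
  (forall t x : R, is_derive (fun s => g s x) t (g' t x)) ->
  (forall t x : R, continuous (fun p : R * R => g (fst p) (snd p)) (t, x)) ->
  (forall t x : R, continuous (fun p : R * R => g' (fst p) (snd p)) (t, x)) ->
  is_derive (fun t => RInt (fun x => n x * g t x) a b) t0 (RInt (fun x => n x * g' t0 x) a b).
Proof.
  intros hd hg hg'. apply is_derive_Reals. intros e he.
  set (k := (b - a) * M + 1).
  assert (hk : 0 < k) by (unfold k; assert (0 <= (b - a) * M) by (apply Rmult_le_pos; lra); lra).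
  destruct (uniform_in_parameter g' t0 a b (e / (2 * k)) hab) as [d [hd0 hu]].
  { apply Rdiv_lt_0_compat; lra. }
  { apply hg'. }
  exists (mkposreal d hd0). intros h h0 hh. simpl in hh.
  replace ((RInt (fun x => n x * g (t0 + h) x) a b - RInt (fun x => n x * g t0 x) a b) / h
     - RInt (fun x => n x * g' t0 x) a b)
    with (RInt (fun x => n x * ((g (t0 + h) x - g t0 x) / h - g' t0 x)) a b).
  2:{ rewrite (RInt_ext _ (fun x => (/ h) * (n x * g (t0 + h) x - n x * g t0 x) - n x * g' t0 x))
        by (intros; eqR; field; assumption).
      assert (e1 : forall t, ex_RInt (fun x => n x * g t x) a b).
      { intros t. apply ex_RInt_weight, section_continuous, hg. }
      assert (e2 : ex_RInt (fun x => n x * g' t0 x) a b).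
      { apply ex_RInt_weight, section_continuous, hg'. }
      assert (e3 : ex_RInt (fun x => n x * g (t0 + h) x - n x * g t0 x) a b).
      { apply (ex_RInt_minus (V := R_NormedModule)); apply e1. }
      rewrite RInt_minus_R; [|apply (ex_RInt_scal (V := R_NormedModule)); assumption|assumption].
      rewrite RInt_scal_R by assumption. rewrite RInt_minus_R by apply e1. eqR. field. assumption. }
  eapply Rle_lt_trans.
  - apply RInt_weight_bound with (e := e / (2 * k)).
    + intros x. apply cont_minus; [apply cont_div; [apply cont_minus|cont|assumption]|];
      apply section_continuous; auto.
    + intros x hx.
      destruct (MVT_gen (fun s => g s x) t0 (t0 + h) (fun s => g' s x)) as [s [hs1 hs2]].
      * intros s _. apply hd.
      * intros s _. apply continuity_pt_filterlim.
        apply (ex_derive_continuous (V := R_NormedModule) (fun s => g s x)). eexists; apply hd.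
      * rewrite hs2. replace (g' s x * (t0 + h - t0) / h - g' t0 x) with (g' s x - g' t0 x) by (field; assumption).
        apply hu; [|assumption].
        apply Rabs_def2 in hh. unfold Rmin, Rmax in hs1. destruct (Rle_dec t0 (t0 + h)); apply Rabs_def1; lra.
  - apply Rle_lt_trans with (k * (e / (2 * k))).
    + rewrite <- Rmult_assoc. apply Rmult_le_compat_r; [left; apply Rdiv_lt_0_compat; lra|unfold k; lra].
    + replace (k * (e / (2 * k))) with (e / 2) by (field; lra). lra.
Qed.

End ParameterIntegral.

Lemma C1_differentiable (f f1 f2 : R -> R -> R) (x y : R) :
  locally (x, y) (fun p : R * R => is_derive (fun s => f s (snd p)) (fst p) (f1 (fst p) (snd p))) ->
  is_derive (fun s => f x s) y (f2 x y) ->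
  continuous (fun p : R * R => f1 (fst p) (snd p)) (x, y) ->
  differentiable_pt_lim f x y (f1 x y) (f2 x y).
Proof.
  intros h1 h2 h3. apply filterdiff_differentiable_pt_lim.
  apply (is_derive_filterdiff f x y f1 (f2 x y)); assumption.
Qed.

Lemma differentiable_continuous (f : R -> R -> R) (x y l1 l2 : R) :
  differentiable_pt_lim f x y l1 l2 ->
  continuous (fun p : R * R => f (fst p) (snd p)) (x, y).
Proof.
  intros h. apply continuity_2d_pt_filterlim, differentiable_continuity_pt.
  exists l1, l2. exact h.
Qed.

Section SelfSimilar.
Variables (eta G : R * R -> R) (w : R -> R * R) (Ua Ub : R * R) (M X : R).
Hypothesis hX : 0 < X.
Hypothesis hN : regulated (fun xi => eta (w xi)).
Hypothesis hQ : regulated (fun xi => G (w xi)).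
Hypothesis hNM : forall xi, Rabs (eta (w xi)) <= M.
Hypothesis hQM : forall xi, Rabs (G (w xi)) <= M.
Hypothesis hleft : forall xi, xi < - X -> w xi = Ua.
Hypothesis hright : forall xi, X < xi -> w xi = Ub.

Let data (f : R * R -> R) (x : R) : R := if Rlt_dec x 0 then f Ua else f Ub.
Let dev (f : R * R -> R) (x : R) : R := f (w x) - data f x.

Let regulated_data (f : R * R -> R) : regulated (data f).
Proof.
  intros x. unfold data. split.
  - destruct (Rle_lt_dec x 0) as [h|h].
    + exists (f Ua). apply left_limit_eps. intros e he. exists 1. split; [lra|].
      intros y hy. destruct (Rlt_dec y 0); [|lra]. rewrite Rminus_diag, Rabs_R0. assumption.
    + exists (f Ub). apply left_limit_eps. intros e he. exists x. split; [lra|].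
      intros y hy. destruct (Rlt_dec y 0); [lra|]. rewrite Rminus_diag, Rabs_R0. assumption.
  - destruct (Rlt_le_dec x 0) as [h|h].
    + exists (f Ua). apply right_limit_eps. intros e he. exists (- x). split; [lra|].
      intros y hy. destruct (Rlt_dec y 0); [|lra]. rewrite Rminus_diag, Rabs_R0. assumption.
    + exists (f Ub). apply right_limit_eps. intros e he. exists 1. split; [lra|].
      intros y hy. destruct (Rlt_dec y 0); [lra|]. rewrite Rminus_diag, Rabs_R0. assumption.
Qed.

Let data_bound (f : R * R -> R) : (forall xi, Rabs (f (w xi)) <= M) -> forall x, Rabs (data f x) <= M.
Proof.
  intros h x. unfold data. destruct (Rlt_dec x 0).
  - rewrite <- (hleft (- X - 1)) by lra. apply h.
  - rewrite <- (hright (X + 1)) by lra. apply h.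
Qed.

Let dev_bound (f : R * R -> R) : (forall xi, Rabs (f (w xi)) <= M) -> forall x, Rabs (dev f x) <= 2 * M.
Proof.
  intros h x. unfold dev. pose proof (h x) as h1. pose proof (data_bound f h x) as h2.
  apply Rabs_le_between in h1, h2. apply Rabs_le. lra.
Qed.

Let dev_out (f : R * R -> R) (x : R) : X < Rabs x -> dev f x = 0.
Proof.
  intros h. unfold dev, data. unfold Rabs in h. destruct (Rcase_abs x).
  - destruct (Rlt_dec x 0); [|lra]. rewrite hleft by lra. ring.
  - destruct (Rlt_dec x 0); [lra|]. rewrite hright by lra. ring.
Qed.

Let dev_split (f : R * R -> R) (t x : R) : 0 < t -> f (w (x / t)) = data f x + dev f (x / t).
Proof.
  intros ht. unfold dev.
  assert (data f (x / t) = data f x); [|lra].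
  unfold data. assert (x / t * t = x) by (field; lra).
  destruct (Rlt_dec x 0), (Rlt_dec (x / t) 0); try reflexivity; exfalso; nra.
Qed.

(** The time derivative of the integral of [eta (w (x / t)) phi] accounts for
    the whole balance but for the defect of the profile equation tested, at
    each time, against [xi |-> phi t (t xi)]. *)
Lemma weak_balance_self_similar (defect : (R -> R) -> R) (K : R) (phi : R -> R -> R) :
  (forall psi psi' : R -> R, (forall x : R, is_derive psi x (psi' x)) -> (forall x : R, continuous psi' x) ->
     RInt (fun xi => (G (w xi) - xi * eta (w xi)) * psi' xi - eta (w xi) * psi xi) (- X) X
     = (G Ub - X * eta Ub) * psi X - (G Ua + X * eta Ua) * psi (- X) + defect psi) ->
  test_function K phi ->
  weak_balance eta G w Ua Ub K phi = RInt (fun t => defect (fun xi => phi t (t * xi))) 0 K.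
Proof.
  intros hdef [hK [[f1 [f2 hC1]] hsupp]].
  assert (d1 : forall t x : R, is_derive (fun s => phi s x) t (f1 t x)) by (intros; apply hC1; trivial).
  assert (d2 : forall t x : R, is_derive (fun y => phi t y) x (f2 t x)) by (intros; apply hC1; trivial).
  assert (c1 : forall t x : R, continuous (fun p : R * R => f1 (fst p) (snd p)) (t, x)) by (intros; apply hC1; trivial).
  assert (c2 : forall t x : R, continuous (fun p : R * R => f2 (fst p) (snd p)) (t, x)) by (intros; apply hC1; trivial).
  assert (hdiff : forall t x : R, differentiable_pt_lim phi t x (f1 t x) (f2 t x)).
  { intros t x. apply C1_differentiable; [|apply d2|apply c1]. apply filter_forall. intros p; apply d1. }
  assert (c0 : forall t x : R, continuous (fun p : R * R => phi (fst p) (snd p)) (t, x)).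
  { intros t x. eapply differentiable_continuous, hdiff. }
  (* Values on the boundary of the support. *)
  assert (hout : forall t x : R, K < Rabs x -> phi t x = 0 /\ f1 t x = 0 /\ f2 t x = 0).
  { intros t x hx. split; [apply hsupp; auto|]. split.
    - rewrite <- (is_derive_unique _ _ _ (d1 t x)). apply is_derive_unique.
      apply (is_derive_ext (fun _ => 0)); [intros s; symmetry; apply hsupp; auto|].
      apply (is_derive_const (V := R_NormedModule)).
    - rewrite <- (is_derive_unique _ _ _ (d2 t x)). apply is_derive_unique.
      apply (is_derive_ext_loc (fun _ => 0)); [|apply (is_derive_const (V := R_NormedModule))].
      exists (mkposreal (Rabs x - K) ltac:(lra)). intros y hy. change (Rabs (y - x) < Rabs x - K) in hy.
      symmetry. apply hsupp. right. pose proof (Rabs_triang_inv x y) as ht.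
      rewrite Rabs_minus_sym in hy. eapply Rlt_le_trans with (r2 := Rabs x - Rabs (x - y)); [|]; lra. }
  assert (hcx : forall t x : R, continuous (phi t) x).
  { intros t x. apply (ex_derive_continuous (V := R_NormedModule)). eexists; apply d2. }
  assert (hct : forall t x : R, continuous (fun s => phi s x) t).
  { intros t x. apply (ex_derive_continuous (V := R_NormedModule)). eexists; apply d1. }
  assert (hf2x : forall t x : R, continuous (f2 t) x).
  { intros t x. apply (continuous_comp_2 (fun _ => t) (fun y => y) f2); [cont|cont|apply c2]. }
  assert (hf1x : forall t x : R, continuous (f1 t) x).
  { intros t x. apply (continuous_comp_2 (fun _ => t) (fun y => y) f1); [cont|cont|apply c1]. }
  assert (hbx : forall t x : R, Rabs x = K -> phi t x = 0).
  { intros t x hx. apply (filterlim_locally_unique (V := R_NormedModule) (F := at_right 1) (fun s => phi t (s * x))).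
    - replace (phi t x) with (phi t (1 * x)) by (f_equal; ring).
      apply (continuous_at_right (fun s => phi t (s * x))).
      apply (continuous_comp (fun s => s * x) (phi t)); [cont|apply hcx].
    - apply right_limit_eps. intros e he. exists 1. split; [lra|]. intros s hs.
      assert (hsK : K < Rabs (s * x)) by (rewrite Rabs_mult, (Rabs_pos_eq s), hx by lra; nra).
      rewrite (proj1 (hout t (s * x) hsK)). rewrite Rminus_0_r, Rabs_R0. assumption. }
  assert (hbt : forall x, phi K x = 0).
  { intros x. apply (filterlim_locally_unique (V := R_NormedModule) (F := at_right K) (fun s => phi s x)).
    - apply (continuous_at_right (fun s => phi s x)). apply hct.
    - apply right_limit_eps. intros e he. exists 1. split; [lra|]. intros s hs.
      rewrite hsupp by (left; rewrite Rabs_pos_eq; lra).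
      rewrite Rminus_0_r, Rabs_R0. assumption. }
  set (A := fun t => RInt (fun x => data eta x * f1 t x) (- K) K + RInt (fun x => data G x * f2 t x) (- K) K
     + (RInt (fun xi => dev eta xi * (t * f1 t (t * xi))) (- X) X
        + RInt (fun xi => dev G xi * (t * f2 t (t * xi))) (- X) X)).
  set (B := fun t => RInt (fun x => data eta x * phi t x) (- K) K
     + RInt (fun xi => dev eta xi * (t * phi t (t * xi))) (- X) X).
  set (B' := fun t => RInt (fun x => data eta x * f1 t x) (- K) K
     + RInt (fun xi => dev eta xi * (phi t (t * xi) + t * (f1 t (t * xi) + f2 t (t * xi) * xi))) (- X) X).
  assert (cs : forall (f : R -> R -> R), (forall t x : R, continuous (fun p : R * R => f (fst p) (snd p)) (t, x)) ->
     forall t x : R, continuous (fun p : R * R => f (fst p) (fst p * snd p)) (t, x)).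
  { intros f hf t x. apply (continuous_comp_2 (fun p : R * R => fst p) (fun p : R * R => fst p * snd p) f); [cont|cont|apply hf]. }
  pose proof (cs phi c0) as s0. pose proof (cs f1 c1) as s1. pose proof (cs f2 c2) as s2.
  assert (rdev : forall f, regulated (fun xi => f (w xi)) -> regulated (dev f)).
  { intros f hf. apply regulated_minus; [assumption|apply regulated_data]. }
  pose proof (rdev eta hN) as rN. pose proof (rdev G hQ) as rQ.
  pose proof (dev_bound eta hNM) as bN. pose proof (dev_bound G hQM) as bQ.
  pose proof (data_bound eta hNM) as bdN. pose proof (data_bound G hQM) as bdQ.
  pose proof (regulated_data eta) as rdN. pose proof (regulated_data G) as rdQ.
  assert (hB' : forall t : R, is_derive B t (B' t)).
  { intros t. apply (is_derive_plus (V := R_NormedModule) (fun t => RInt (fun x => data eta x * phi t x) (- K) K)).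
    - apply (is_derive_RInt_weight _ M (- K) K ltac:(lra) rdN bdN phi f1); assumption.
    - apply (is_derive_RInt_weight _ (2 * M) (- X) X ltac:(lra) rN bN (fun t xi => t * phi t (t * xi))
        (fun t xi => phi t (t * xi) + t * (f1 t (t * xi) + f2 t (t * xi) * xi))).
      + intros s xi.
        assert (hch : is_derive (fun s => phi s (s * xi)) s (f1 s (s * xi) + f2 s (s * xi) * xi)).
        { apply is_derive_Reals.
          replace (f1 s (s * xi) + f2 s (s * xi) * xi) with (f1 s (s * xi) * 1 + f2 s (s * xi) * xi) by ring.
          apply (derivable_pt_lim_comp_2d phi (fun s => s) (fun s => s * xi)); [apply hdiff| |].
          - apply derivable_pt_lim_id.
          - apply is_derive_Reals. auto_derive; [trivial|ring]. }
        evar_last; [apply (is_derive_mult (fun s => s) (fun s => phi s (s * xi))); [apply is_derive_id|exact hch|intros; apply Rmult_comm]|].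
        unfold plus, mult, one; simpl. eqR. ring.
      + intros s xi. apply cont_mult; [cont|apply s0].
      + intros s xi. apply cont_plus; [apply s0|]. apply cont_mult; [cont|].
        apply cont_plus; [apply s1|]. apply cont_mult; [apply s2|cont]. }
  assert (hB'c : forall t : R, continuous B' t).
  { intros t. apply cont_plus.
    - apply (continuous_RInt_weight _ M); try assumption. lra.
    - apply (continuous_RInt_weight _ (2 * M) (- X) X ltac:(lra) rN bN (fun t xi => phi t (t * xi) + t * (f1 t (t * xi) + f2 t (t * xi) * xi))).
      intros s xi. apply cont_plus; [apply s0|]. apply cont_mult; [cont|].
      apply cont_plus; [apply s1|]. apply cont_mult; [apply s2|cont]. }
  assert (hAc : forall t : R, continuous A t).
  { intros t. apply cont_plus; apply cont_plus.
    - apply (continuous_RInt_weight _ M); try assumption. lra.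
    - apply (continuous_RInt_weight _ M); try assumption. lra.
    - apply (continuous_RInt_weight _ (2 * M) (- X) X ltac:(lra) rN bN (fun t xi => t * f1 t (t * xi))).
      intros s xi. apply cont_mult; [cont|apply s1].
    - apply (continuous_RInt_weight _ (2 * M) (- X) X ltac:(lra) rQ bQ (fun t xi => t * f2 t (t * xi))).
      intros s xi. apply cont_mult; [cont|apply s2]. }
  assert (hsx : forall (f : R -> R) t, (forall x : R, continuous f x) -> forall xi : R, continuous (fun xi => f (t * xi)) xi).
  { intros f t hf xi. apply (continuous_comp (fun xi => t * xi) f); [cont|apply hf]. }
  assert (hinner : forall t, 0 < t ->
     RInt (fun x => eta (w (x / t)) * Derive (fun s => phi s x) t + G (w (x / t)) * Derive (fun y => phi t y) x) (- K) K = A t).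
  { intros t ht.
    assert (hti : 0 < / t) by (apply Rinv_0_lt_compat; lra).
    set (g := fun xi => dev eta xi * (t * f1 t (t * xi)) + dev G xi * (t * f2 t (t * xi))).
    assert (r1 : regulated (fun xi => dev eta xi * (t * f1 t (t * xi)))).
    { apply regulated_mult; [assumption|]. apply regulated_continuous. intros xi.
      apply cont_mult; [cont|]. apply (hsx (f1 t)); apply hf1x. }
    assert (r2 : regulated (fun xi => dev G xi * (t * f2 t (t * xi)))).
    { apply regulated_mult; [assumption|]. apply regulated_continuous. intros xi.
      apply cont_mult; [cont|]. apply (hsx (f2 t)); apply hf2x. }
    assert (hg : regulated g) by (apply regulated_plus; assumption).
    assert (r3 : regulated (fun x => data eta x * f1 t x)).
    { apply regulated_mult; [assumption|]. apply regulated_continuous. apply hf1x. }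
    assert (r4 : regulated (fun x => data G x * f2 t x)).
    { apply regulated_mult; [assumption|]. apply regulated_continuous. apply hf2x. }
    rewrite (RInt_ext _ (fun x => data eta x * f1 t x + data G x * f2 t x + / t * g (/ t * x))).
    2:{ intros x _.
        rewrite (is_derive_unique (fun s : R => phi s x) _ _ (d1 t x)).
        rewrite (is_derive_unique (fun y : R => phi t y) _ _ (d2 t x)).
        rewrite (dev_split eta t x ht), (dev_split G t x ht).
        unfold g. replace (/ t * x) with (x / t) by (unfold Rdiv; ring).
        replace (t * (x / t)) with x by (field; lra). eqR. field. lra. }
    assert (r5 : regulated (fun x => / t * g (/ t * x))).
    { apply regulated_mult; [apply regulated_continuous; intros; cont|].
      apply regulated_scale; assumption. }
    rewrite RInt_plus_R; [|apply ex_RInt_regulated, regulated_plus; assumption|apply ex_RInt_regulated; assumption].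
    rewrite RInt_plus_R by (apply ex_RInt_regulated; assumption).
    rewrite RInt_rescale by assumption.
    unfold A. f_equal.
    rewrite <- RInt_plus_R by (apply ex_RInt_regulated; assumption). fold g.
    replace (/ t * - K) with (- (K / t)) by (unfold Rdiv; ring).
    replace (/ t * K) with (K / t) by (unfold Rdiv; ring).
    assert (hKt : 0 < K / t) by (apply Rdiv_lt_0_compat; assumption).
    pose proof (Rmax_l (K / t) X). pose proof (Rmax_r (K / t) X).
    rewrite <- (RInt_support g (K / t) (Rmax (K / t) X)); [|lra|assumption|].
    - apply RInt_support; [lra|assumption|]. intros xi hxi. unfold g.
      rewrite (dev_out eta), (dev_out G) by assumption. ring.
    - intros xi hxi.
      assert (hk : K < Rabs (t * xi)).
      { rewrite Rabs_mult, (Rabs_pos_eq t) by lra.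
        apply Rmult_lt_compat_l with (r := t) in hxi; [|assumption].
        replace (t * (K / t)) with K in hxi by (field; lra). assumption. }
      destruct (hout t (t * xi) hk) as [_ [k1 k2]]. unfold g. rewrite k1, k2. ring. }
  (* The defect is what remains of the balance. *)
  assert (hrest : forall t, A t - B' t = defect (fun xi => phi t (t * xi))).
  { intros t.
    set (psi := fun xi => phi t (t * xi)). set (psi' := fun xi => t * f2 t (t * xi)).
    assert (hpsi : forall xi : R, is_derive psi xi (psi' xi)).
    { intros xi. evar_last.
      - apply (is_derive_comp (phi t) (fun xi => t * xi)); [apply d2|]. auto_derive; [trivial|reflexivity].
      - unfold scal, psi'; simpl. unfold mult; simpl. eqR. ring. }
    assert (hpsi' : forall xi : R, continuous psi' xi).
    { intros xi. apply cont_mult; [cont|]. apply (hsx (f2 t)). apply hf2x. }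
    assert (hpsic : forall xi : R, continuous psi xi) by (intros; apply (hsx (phi t)); apply hcx).
    specialize (hdef psi psi' hpsi hpsi').
    assert (rc : forall f, (forall x : R, continuous f x) -> regulated f) by (intros; apply regulated_continuous; assumption).
    assert (rid : regulated (fun x => x)) by (apply rc; intros; cont).
    (* The piecewise constant part. *)
    assert (hd1 : RInt (fun x => data G x * f2 t x) (- K) K = (G Ua - G Ub) * phi t 0).
    { rewrite (RInt_split _ (- K) 0 K) by (apply ex_RInt_regulated, regulated_mult; [assumption|apply rc, hf2x]).
      rewrite (RInt_ext _ (fun x => G Ua * f2 t x) (- K) 0).
      2:{ intros x. rewrite Rmax_right by lra. intros hx. unfold data. destruct (Rlt_dec x 0); [reflexivity|lra]. }
      rewrite (RInt_ext _ (fun x => G Ub * f2 t x) 0 K).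
      2:{ intros x. rewrite Rmin_left by lra. intros hx. unfold data. destruct (Rlt_dec x 0); [lra|reflexivity]. }
      rewrite !RInt_scal_R by (apply cont_ex_RInt, hf2x).
      rewrite !(RInt_fundamental (phi t) (f2 t)) by auto.
      rewrite (hbx t K), (hbx t (- K)) by (rewrite ?Rabs_Ropp; apply Rabs_pos_eq; lra). eqR. ring. }
    assert (hd2 : RInt (fun xi => (data G xi - xi * data eta xi) * psi' xi - data eta xi * psi xi) (- X) X
       = (G Ub - X * eta Ub) * psi X - (G Ua + X * eta Ua) * psi (- X) + (G Ua - G Ub) * psi 0).
    { assert (hconst : forall g n a b, RInt (fun xi => (g - xi * n) * psi' xi - n * psi xi) a b
         = (g - b * n) * psi b - (g - a * n) * psi a).
      { intros g n a b. apply (RInt_fundamental (fun xi => (g - xi * n) * psi xi)).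
        - intros xi. evar_last.
          + apply (is_derive_mult (fun xi => g - xi * n) psi); [|apply hpsi|intros; apply Rmult_comm].
            auto_derive; [trivial|reflexivity].
          + unfold plus, mult; simpl. eqR. ring.
        - intros xi. cont; auto. }
      rewrite (RInt_split _ (- X) 0 X).
      2,3: apply ex_RInt_regulated, regulated_minus; apply regulated_mult; auto;
           apply regulated_minus; [assumption|apply regulated_mult; assumption].
      rewrite (RInt_ext _ (fun xi => (G Ua - xi * eta Ua) * psi' xi - eta Ua * psi xi) (- X) 0).
      2:{ intros x. rewrite Rmax_right by lra. intros hx. unfold data. destruct (Rlt_dec x 0); [reflexivity|lra]. }
      rewrite (RInt_ext _ (fun xi => (G Ub - xi * eta Ub) * psi' xi - eta Ub * psi xi) 0 X).
      2:{ intros x. rewrite Rmin_left by lra. intros hx. unfold data. destruct (Rlt_dec x 0); [lra|reflexivity]. }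
      rewrite !hconst. eqR. ring. }
    replace (phi t 0) with (psi 0) in hd1 by (unfold psi; f_equal; ring).
    assert (rN0 : regulated (fun xi => (G (w xi) - xi * eta (w xi)) * psi' xi - eta (w xi) * psi xi)).
    { apply regulated_minus; apply regulated_mult; auto. apply regulated_minus; [assumption|apply regulated_mult; assumption]. }
    assert (rD0 : regulated (fun xi => (data G xi - xi * data eta xi) * psi' xi - data eta xi * psi xi)).
    { apply regulated_minus; apply regulated_mult; auto. apply regulated_minus; [assumption|apply regulated_mult; assumption]. }
    assert (x1 : regulated (fun xi => dev eta xi * (t * f1 t (t * xi)))).
    { apply regulated_mult; [assumption|]. apply rc. intros xi. apply cont_mult; [cont|]. apply (hsx (f1 t)); apply hf1x. }
    assert (x2 : regulated (fun xi => dev G xi * (t * f2 t (t * xi)))) by (apply regulated_mult; [assumption|apply rc; assumption]).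
    assert (x3 : regulated (fun xi => dev eta xi * (phi t (t * xi) + t * (f1 t (t * xi) + f2 t (t * xi) * xi)))).
    { apply regulated_mult; [assumption|]. apply rc. intros xi. apply cont_plus; [apply hpsic|]. apply cont_mult; [cont|].
      apply cont_plus; [apply (hsx (f1 t)); apply hf1x|]. apply cont_mult; [apply (hsx (f2 t)); apply hf2x|cont]. }
    assert (hsum : RInt (fun xi => dev eta xi * (t * f1 t (t * xi))) (- X) X
        + RInt (fun xi => dev G xi * (t * f2 t (t * xi))) (- X) X
        - RInt (fun xi => dev eta xi * (phi t (t * xi) + t * (f1 t (t * xi) + f2 t (t * xi) * xi))) (- X) X
        = RInt (fun xi => (G (w xi) - xi * eta (w xi)) * psi' xi - eta (w xi) * psi xi) (- X) X
        - RInt (fun xi => (data G xi - xi * data eta xi) * psi' xi - data eta xi * psi xi) (- X) X).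
    { rewrite <- RInt_plus_R by (apply ex_RInt_regulated; assumption).
      rewrite <- RInt_minus_R; [|apply ex_RInt_regulated, regulated_plus; assumption|apply ex_RInt_regulated; assumption].
      rewrite <- RInt_minus_R by (apply ex_RInt_regulated; assumption).
      apply RInt_ext. intros xi _. unfold dev, psi, psi'. eqR. ring. }
    unfold A, B'. rewrite hd1. rewrite hdef, hd2 in hsum. lra. }
  unfold weak_balance.
  rewrite (RInt_ext _ A 0 K).
  2:{ intros t. rewrite Rmin_left by lra. intros ht. apply hinner. lra. }
  rewrite (RInt_ext (fun t => defect _) (fun t => A t - B' t)) by (intros; symmetry; apply hrest).
  rewrite RInt_minus_R by (apply cont_ex_RInt; assumption).
  rewrite (RInt_fundamental B B') by assumption.
  assert (hBK : B K = 0).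
  { unfold B. rewrite !RInt_zero; [ring| |]; intros x _; rewrite hbt; ring. }
  assert (hB0 : B 0 = RInt (fun x => eta (riemann_data Ua Ub x) * phi 0 x) (- K) K).
  { unfold B. rewrite (RInt_zero _ (- X) X) by (intros; ring). rewrite Rplus_0_r.
    apply RInt_ext. intros x _. unfold data, riemann_data. destruct (Rlt_dec x 0); reflexivity. }
  rewrite hBK, hB0. eqR. ring.
Qed.

End SelfSimilar.

(** * Fields with two waves *)

Lemma regulated_bounded (f : R -> R) (a b : R) :
  a <= b -> regulated f -> exists M, forall x, a <= x <= b -> Rabs (f x) <= M.
Proof.
  intros hab hf.
  apply (interval_induction (fun u v => exists M, forall x, u <= x <= v -> Rabs (f x) <= M)); [assumption| |].
  - intros x y z _ _ [M1 h1] [M2 h2]. exists (Rmax M1 M2). intros t ht.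
    destruct (Rle_lt_dec t y).
    + eapply Rle_trans; [apply h1; lra|apply Rmax_l].
    + eapply Rle_trans; [apply h2; lra|apply Rmax_r].
  - intros x _. destruct (hf x) as [[l hl] [r hr]].
    destruct (proj1 (left_limit_eps _ _ _) hl 1 ltac:(lra)) as [d1 [hd1 k1]].
    destruct (proj1 (right_limit_eps _ _ _) hr 1 ltac:(lra)) as [d2 [hd2 k2]].
    exists (Rmin d1 d2). split; [apply Rmin_pos; assumption|].
    pose proof (Rmin_l d1 d2). pose proof (Rmin_r d1 d2).
    intros y z _ _ h1 h2 h3 h4. exists (Rabs l + Rabs r + Rabs (f x) + 1).
    pose proof (Rabs_pos l). pose proof (Rabs_pos r). pose proof (Rabs_pos (f x)).
    intros t ht. destruct (Rtotal_order t x) as [h|[h|h]].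
    + specialize (k1 t ltac:(lra)). pose proof (Rabs_triang_inv (f t) l). lra.
    + subst t. lra.
    + specialize (k2 t ltac:(lra)). pose proof (Rabs_triang_inv (f t) r). lra.
Qed.

Definition has_limits (w : R -> R * R) : Prop :=
  forall x, (exists U, filterlim w (at_left x) (locally U)) /\
            (exists U, filterlim w (at_right x) (locally U)).

Definition glue (a : R) (f g : R -> R * R) (x : R) : R * R :=
  if Rlt_dec x a then f x else g x.

Lemma left_limit_ext (f g : R -> R * R) (x d : R) (U : R * R) : 0 < d ->
  (forall y, x - d < y < x -> f y = g y) ->
  filterlim f (at_left x) (locally U) -> filterlim g (at_left x) (locally U).
Proof.
  intros hd h. apply filterlim_ext_loc. exists (mkposreal d hd). intros y hy hyx.
  change (Rabs (y - x) < d) in hy. apply Rabs_def2 in hy. apply h. lra.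
Qed.

Lemma right_limit_ext (f g : R -> R * R) (x d : R) (U : R * R) : 0 < d ->
  (forall y, x < y < x + d -> f y = g y) ->
  filterlim f (at_right x) (locally U) -> filterlim g (at_right x) (locally U).
Proof.
  intros hd h. apply filterlim_ext_loc. exists (mkposreal d hd). intros y hy hyx.
  change (Rabs (y - x) < d) in hy. apply Rabs_def2 in hy. apply h. lra.
Qed.

Lemma has_limits_glue (a : R) (f g : R -> R * R) :
  has_limits f -> has_limits g -> has_limits (glue a f g).
Proof.
  intros hf hg x. destruct (hf x) as [[Ul h1] [Ur h2]]. destruct (hg x) as [[Vl k1] [Vr k2]].
  unfold glue. split.
  - destruct (Rle_lt_dec x a) as [h|h].
    + exists Ul. apply (left_limit_ext f _ x 1); [lra| |assumption].
      intros y hy. destruct (Rlt_dec y a); [reflexivity|lra].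
    + exists Vl. apply (left_limit_ext g _ x (x - a)); [lra| |assumption].
      intros y hy. destruct (Rlt_dec y a); [lra|reflexivity].
  - destruct (Rlt_le_dec x a) as [h|h].
    + exists Ur. apply (right_limit_ext f _ x (a - x)); [lra| |assumption].
      intros y hy. destruct (Rlt_dec y a); [reflexivity|lra].
    + exists Vr. apply (right_limit_ext g _ x 1); [lra| |assumption].
      intros y hy. destruct (Rlt_dec y a); [lra|reflexivity].
Qed.

Lemma has_limits_continuous (f : R -> R * R) : (forall x, continuous f x) -> has_limits f.
Proof.
  intros hf x. split; exists (f x); apply filterlim_filter_le_1 with (2 := hf x); apply filter_le_within.
Qed.

(** The rarefaction fan of the family [s] issued, at speed [a], from a state
    of density [r]: there the velocity is [xi + s c]. *)
Definition fan (c s a r : R) (xi : R) : R * R :=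
  (r * exp (- s * (xi - a) / c), r * exp (- s * (xi - a) / c) * (xi + s * c)).

Lemma continuous_pair (f g : R -> R) (x : R) :
  continuous f x -> continuous g x -> continuous (fun y => (f y, g y)) x.
Proof.
  intros hf hg. apply filterlim_locally. intros e. apply filter_and.
  - exact (proj1 (filterlim_locally f (f x)) hf e).
  - exact (proj1 (filterlim_locally g (g x)) hg e).
Qed.

Lemma continuous_fan (c s a r x : R) : 0 < c -> continuous (fan c s a r) x.
Proof.
  intros hc. unfold fan. apply continuous_pair; cont; lra.
Qed.

Lemma conserved_constant (g n a b : R) (psi psi' : R -> R) :
  (forall x : R, is_derive psi x (psi' x)) -> (forall x : R, continuous psi' x) ->
  RInt (fun xi => (g - xi * n) * psi' xi - n * psi xi) a b
  = (g - b * n) * psi b - (g - a * n) * psi a.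
Proof.
  intros hpsi hpsi'.
  assert (hc : forall x, continuous psi x).
  { intros x. apply (ex_derive_continuous (V := R_NormedModule)). eexists; apply hpsi. }
  apply (RInt_fundamental (fun xi => (g - xi * n) * psi xi)).
  - intros xi. evar_last.
    + apply (is_derive_mult (fun xi => g - xi * n) psi); [|apply hpsi|intros; apply Rmult_comm].
      auto_derive; [trivial|reflexivity].
    + unfold plus, mult; simpl. eqR. ring.
  - intros xi. cont; auto.
Qed.

(** [h' + n = 0] along a fan, in integrated form. *)
Lemma conserved_smooth (h n : R -> R) (a b : R) (psi psi' : R -> R) :
  (forall x : R, is_derive h x (- n x)) -> (forall x : R, continuous n x) ->
  (forall x : R, is_derive psi x (psi' x)) -> (forall x : R, continuous psi' x) ->
  RInt (fun xi => h xi * psi' xi - n xi * psi xi) a b = h b * psi b - h a * psi a.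
Proof.
  intros hh hn hpsi hpsi'.
  apply (RInt_fundamental (fun xi => h xi * psi xi)).
  - intros xi. evar_last.
    + apply (is_derive_mult h psi); [apply hh|apply hpsi|intros; apply Rmult_comm].
    + unfold plus, mult; simpl. eqR. ring.
  - intros xi.
    assert (continuous psi xi) by (apply (ex_derive_continuous (V := R_NormedModule)); eexists; apply hpsi).
    assert (continuous h xi) by (apply (ex_derive_continuous (V := R_NormedModule)); eexists; apply hh).
    cont; auto.
Qed.

(** The balance law of the pair [(eta, G)] holds pointwise inside the fans. *)
Definition smooth_along_fan (c : R) (eta G : R * R -> R) : Prop :=
  forall s a r, s * s = 1 -> 0 < r -> forall x,
    is_derive (fun xi => G (fan c s a r xi) - xi * eta (fan c s a r xi)) x (- eta (fan c s a r x)).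

Lemma is_derive_fan_density (c s a r x : R) : c <> 0 ->
  is_derive (fun xi => r * exp (- s * (xi - a) / c)) x (- s / c * (r * exp (- s * (x - a) / c))).
Proof. intros hc. auto_derive; [trivial|]. unfold Rdiv, Rminus. eqR. ring. Qed.

Lemma mass_along_fan (c : R) : 0 < c -> smooth_along_fan c (fun U => fst U) (fun U => snd U).
Proof.
  intros hc s a r hs hr x. unfold fan. simpl fst. simpl snd.
  apply (is_derive_ext (fun xi => (s * c) * (r * exp (- s * (xi - a) / c)))); [intros t; eqR; ring|].
  evar_last; [apply is_derive_scal, is_derive_fan_density; lra|].
  eqR. replace (- (r * exp (- s * (x - a) / c))) with (- (s * s) * (r * exp (- s * (x - a) / c))) by (rewrite hs; ring).
  field. lra.
Qed.

Lemma momentum_along_fan (c : R) : 0 < c -> smooth_along_fan c (fun U => snd U) (momentum_flux c).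
Proof.
  intros hc s a r hs hr x. unfold momentum_flux, fan. simpl fst. simpl snd.
  apply (is_derive_ext (fun xi => (r * exp (- s * (xi - a) / c)) * (s * c * xi + 2 * c ^ 2))).
  { intros t. pose proof (exp_pos (- s * (t - a) / c)). eqR.
    replace (2 * c ^ 2) with ((1 + s * s) * c ^ 2) by (rewrite hs; ring). field. lra. }
  evar_last.
  - apply (is_derive_mult (fun xi => r * exp (- s * (xi - a) / c)) (fun xi => s * c * xi + 2 * c ^ 2));
      [apply is_derive_fan_density; lra|auto_derive; [trivial|reflexivity]|intros; apply Rmult_comm].
  - unfold plus, mult; simpl. eqR. set (R0 := r * exp (- s * (x - a) / c)).
    replace (- (R0 * (x + s * c))) with (- R0 * ((s * s) * x + 2 * s * c - s * c)) by (rewrite hs; ring).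
    field. lra.
Qed.

Lemma energy_along_fan (c : R) : 0 < c -> smooth_along_fan c (energy c) (energy_flux c).
Proof.
  intros hc s a r hs hr x. unfold energy_flux, energy, fan. simpl fst. simpl snd.
  set (d := fun xi => r * exp (- s * (xi - a) / c)).
  assert (hd : forall t, 0 < d t) by (intros t; apply Rmult_lt_0_compat; [assumption|apply exp_pos]).
  assert (hln : forall t, ln (d t) = ln r - s * (t - a) / c).
  { intros t. unfold d. rewrite ln_mult, ln_exp by (assumption || apply exp_pos). field. lra. }
  apply (is_derive_ext (fun xi => d xi *
     (s * c * ((xi + s * c) ^ 2 / 2 + c ^ 2 * (ln r - s * (xi - a) / c)) + c ^ 2 * (xi + s * c)))).
  { intros t. specialize (hd t). fold (d t). rewrite hln. eqR. field. lra. }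
  evar_last.
  - apply (is_derive_mult d (fun xi => s * c * ((xi + s * c) ^ 2 / 2 + c ^ 2 * (ln r - s * (xi - a) / c)) + c ^ 2 * (xi + s * c)));
      [apply is_derive_fan_density; lra|auto_derive; [trivial|reflexivity]|intros; apply Rmult_comm].
  - unfold plus, mult; simpl. eqR. fold (d x). rewrite hln. specialize (hd x).
    assert (hss : s ^ 2 = 1) by (rewrite <- hs; ring).
    assert (hsss : s ^ 3 = s) by (replace (s ^ 3) with (s * s * s) by ring; rewrite hs; ring).
    assert (hs4 : s ^ 4 = 1) by (replace (s ^ 4) with (s ^ 2 * s ^ 2) by ring; rewrite hss; ring).
    field_simplify_eq; [|lra]. rewrite ?hs4, ?hsss, ?hss. ring.
Qed.

(** The contribution of a shock to the balance, in terms of the two states. *)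
Definition jump_defect (eta G : R * R -> R) (s1 s2 : R) (U1 U2 : R * R) : R :=
  if Rlt_dec s1 s2 then 0 else (G U1 - s1 * eta U1) - (G U2 - s1 * eta U2).

Lemma joined_fan_ends (c s s1 s2 r1 q1 r2 q2 : R) : s1 < s2 -> joined c s s1 s2 r1 q1 r2 q2 ->
  fan c s s1 r1 s1 = (r1, q1) /\ fan c s s1 r1 s2 = (r2, q2).
Proof.
  intros hlt [[h _]|[_ [h1 [h2 h3]]]]; [lra|]. unfold fan. split.
  - replace (- s * (s1 - s1) / c) with 0 by (unfold Rdiv; ring). rewrite exp_0. f_equal; lra.
  - rewrite <- h3. f_equal. lra.
Qed.

(** Integration by parts across a fan leaves the boundary terms only; a shock has an
    empty interval, and its boundary terms differ by [jump_defect]. *)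
Lemma balance_across_wave (c s s1 s2 r1 q1 r2 q2 : R) (eta G : R * R -> R) (psi psi' : R -> R) :
  0 < c -> s * s = 1 -> 0 < r1 -> s1 <= s2 ->
  smooth_along_fan c eta G -> (forall U, 0 < fst U -> continuous eta U) ->
  joined c s s1 s2 r1 q1 r2 q2 ->
  (forall x : R, is_derive psi x (psi' x)) -> (forall x : R, continuous psi' x) ->
  RInt (fun xi => (G (fan c s s1 r1 xi) - xi * eta (fan c s s1 r1 xi)) * psi' xi
                  - eta (fan c s s1 r1 xi) * psi xi) s1 s2
  = (G (r2, q2) - s2 * eta (r2, q2)) * psi s2 - (G (r1, q1) - s1 * eta (r1, q1)) * psi s1
    + jump_defect eta G s1 s2 (r1, q1) (r2, q2) * psi s1.
Proof.
  intros hc hs hr1 hs12 hsm heta hj hpsi hpsi'. unfold jump_defect.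
  destruct (Rlt_dec s1 s2) as [hlt|hge].
  - destruct (joined_fan_ends c s s1 s2 r1 q1 r2 q2 hlt hj) as [e1 e2].
    rewrite (conserved_smooth (fun xi => G (fan c s s1 r1 xi) - xi * eta (fan c s s1 r1 xi))
      (fun xi => eta (fan c s s1 r1 xi))); try assumption.
    + rewrite e1, e2. eqR. ring.
    + intros x. apply hsm; assumption.
    + intros x. apply (continuous_comp (fan c s s1 r1) eta); [apply continuous_fan; assumption|].
      apply heta. simpl. apply Rmult_lt_0_compat; [assumption|apply exp_pos].
  - replace s2 with s1 by lra. rewrite RInt_point. change (@zero _) with 0. eqR. ring.
Qed.

Definition two_wave (c s1 s2 t1 t2 rL qL rM qM rb qb : R) : R -> R * R :=
  glue s1 (fun _ => (rL, qL)) (glue s2 (fan c 1 s1 rL)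
    (glue t1 (fun _ => (rM, qM)) (glue t2 (fan c (-1) t1 rM) (fun _ => (rb, qb))))).

Section TwoWave.
Variables (c s1 s2 t1 t2 rL qL rM qM rb qb : R).
Hypothesis hc : 0 < c.
Hypothesis h12 : s1 <= s2.
Hypothesis h23 : s2 <= t1.
Hypothesis h34 : t1 <= t2.
Hypothesis hrL : 0 < rL.
Hypothesis hrM : 0 < rM.
Hypothesis hrb : 0 < rb.
Hypothesis j1 : joined c 1 s1 s2 rL qL rM qM.
Hypothesis j2 : joined c (-1) t1 t2 rM qM rb qb.

Let w : R -> R * R := two_wave c s1 s2 t1 t2 rL qL rM qM rb qb.

Lemma two_wave_limits : has_limits w.
Proof.
  unfold w, two_wave.
  repeat apply has_limits_glue; apply has_limits_continuous; intros x;
    try apply continuous_const; apply continuous_fan; assumption.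
Qed.

Lemma two_wave_left (x : R) : x < s1 -> w x = (rL, qL).
Proof. intros h. unfold w, two_wave, glue. destruct (Rlt_dec x s1); [reflexivity|lra]. Qed.

Lemma two_wave_right (x : R) : t2 <= x -> w x = (rb, qb).
Proof.
  intros h. unfold w, two_wave, glue.
  destruct (Rlt_dec x s1); [lra|]. destruct (Rlt_dec x s2); [lra|].
  destruct (Rlt_dec x t1); [lra|]. destruct (Rlt_dec x t2); [lra|reflexivity].
Qed.

Lemma two_wave_middle (x : R) : s2 <= x < t1 -> w x = (rM, qM).
Proof.
  intros h. unfold w, two_wave, glue.
  destruct (Rlt_dec x s1); [lra|]. destruct (Rlt_dec x s2); [lra|].
  destruct (Rlt_dec x t1); [reflexivity|lra].
Qed.

Lemma two_wave_slow (x : R) : s1 <= x < s2 -> w x = fan c 1 s1 rL x.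
Proof.
  intros h. unfold w, two_wave, glue.
  destruct (Rlt_dec x s1); [lra|]. destruct (Rlt_dec x s2); [reflexivity|lra].
Qed.

Lemma two_wave_fast (x : R) : t1 <= x < t2 -> w x = fan c (-1) t1 rM x.
Proof.
  intros h. unfold w, two_wave, glue.
  destruct (Rlt_dec x s1); [lra|]. destruct (Rlt_dec x s2); [lra|].
  destruct (Rlt_dec x t1); [lra|]. destruct (Rlt_dec x t2); [reflexivity|lra].
Qed.

Lemma two_wave_cases (P : R -> R * R -> Prop) :
  (forall x, x < s1 -> P x (rL, qL)) -> (forall x, s1 <= x < s2 -> P x (fan c 1 s1 rL x)) ->
  (forall x, s2 <= x < t1 -> P x (rM, qM)) -> (forall x, t1 <= x < t2 -> P x (fan c (-1) t1 rM x)) ->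
  (forall x, t2 <= x -> P x (rb, qb)) -> forall x, P x (w x).
Proof.
  intros p1 p2 p3 p4 p5 x.
  destruct (Rlt_le_dec x s1) as [h|h]; [rewrite two_wave_left by assumption; auto|].
  destruct (Rlt_le_dec x s2) as [h'|h']; [rewrite two_wave_slow by lra; auto|].
  destruct (Rlt_le_dec x t1) as [k|k]; [rewrite two_wave_middle by lra; auto|].
  destruct (Rlt_le_dec x t2) as [k'|k']; [rewrite two_wave_fast by lra; auto|].
  rewrite two_wave_right by assumption; auto.
Qed.

Lemma two_wave_density_bound : exists m, 0 < m /\ forall x, m <= fst (w x).
Proof.
  set (m1 := rL * exp (- (s2 - s1) / c)). set (m2 := rM * exp (- (t2 - t1) / c)).
  assert (0 < m1) by (apply Rmult_lt_0_compat; [assumption|apply exp_pos]).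
  assert (0 < m2) by (apply Rmult_lt_0_compat; [assumption|apply exp_pos]).
  assert (hexp : forall x y, x <= y -> exp x <= exp y).
  { intros x y [h|h]; [left; apply exp_increasing; assumption|rewrite h; lra]. }
  exists (Rmin (Rmin m1 m2) (Rmin (Rmin rL rM) rb)). split; [repeat apply Rmin_pos; assumption|].
  pose proof (Rmin_l (Rmin m1 m2) (Rmin (Rmin rL rM) rb)). pose proof (Rmin_r (Rmin m1 m2) (Rmin (Rmin rL rM) rb)).
  pose proof (Rmin_l m1 m2). pose proof (Rmin_r m1 m2). pose proof (Rmin_l (Rmin rL rM) rb).
  pose proof (Rmin_r (Rmin rL rM) rb). pose proof (Rmin_l rL rM). pose proof (Rmin_r rL rM).
  apply (two_wave_cases (fun _ U => _ <= fst U)); intros x hx; simpl fst; try lra.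
  - apply Rle_trans with m1; [lra|]. apply Rmult_le_compat_l; [lra|]. apply hexp.
    unfold Rdiv. apply Rmult_le_compat_r; [left; apply Rinv_0_lt_compat; assumption|lra].
  - apply Rle_trans with m2; [lra|]. apply Rmult_le_compat_l; [lra|]. apply hexp.
    unfold Rdiv. apply Rmult_le_compat_r; [left; apply Rinv_0_lt_compat; assumption|lra].
Qed.

Lemma two_wave_regulated (F : R * R -> R) :
  (forall U, 0 < fst U -> continuous F U) -> regulated (fun x => F (w x)).
Proof.
  intros hF. destruct two_wave_density_bound as [m [hm hb]].
  intros x. destruct (two_wave_limits x) as [[Ul h1] [Ur h2]].
  assert (hp : forall U (Fi : (R -> Prop) -> Prop), ProperFilter Fi -> filterlim w Fi (locally U) -> 0 < fst U).
  { intros U Fi hFi hU. apply Rlt_le_trans with m; [assumption|].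
    apply (filterlim_le (F := Fi) (fun _ => m) (fun x => fst (w x)) m (fst U)).
    - apply filter_forall. intros; apply hb.
    - apply filterlim_const.
    - apply (limit_map (fun U => fst U) w); [apply continuous_fst_R|assumption]. }
  split; eexists; (apply limit_map; [|eassumption]); apply hF.
  - apply (hp Ul (at_left x)); [apply at_left_proper_filter|assumption].
  - apply (hp Ur (at_right x)); [apply at_right_proper_filter|assumption].
Qed.

Lemma two_wave_bounded (F : R * R -> R) :
  (forall U, 0 < fst U -> continuous F U) -> exists M, forall x, Rabs (F (w x)) <= M.
Proof.
  intros hF.
  destruct (regulated_bounded (fun x => F (w x)) (s1 - 1) (t2 + 1) ltac:(lra) (two_wave_regulated F hF)) as [M hM].
  exists M. intros x.
  destruct (Rlt_le_dec x (s1 - 1)).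
  - rewrite two_wave_left by lra. rewrite <- (two_wave_left (s1 - 1)) by lra. apply hM. lra.
  - destruct (Rlt_le_dec (t2 + 1) x); [|apply hM; lra].
    rewrite two_wave_right by lra. rewrite <- (two_wave_right (t2 + 1)) by lra. apply hM. lra.
Qed.

(** The whole balance is the production at the two shocks. *)
Lemma two_wave_balance (eta G : R * R -> R) (K : R) (phi : R -> R -> R) :
  (forall U, 0 < fst U -> continuous eta U) -> (forall U, 0 < fst U -> continuous G U) ->
  smooth_along_fan c eta G -> test_function K phi ->
  weak_balance eta G w (rL, qL) (rb, qb) K phi =
  RInt (fun t => jump_defect eta G s1 s2 (rL, qL) (rM, qM) * phi t (t * s1)
               + jump_defect eta G t1 t2 (rM, qM) (rb, qb) * phi t (t * t1)) 0 K.
Proof.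
  intros heta hG hsm hphi.
  destruct (two_wave_bounded eta heta) as [M1 hM1]. destruct (two_wave_bounded G hG) as [M2 hM2].
  set (X := Rabs s1 + Rabs t2 + 1).
  pose proof (Rle_abs (- s1)) as a1. rewrite Rabs_Ropp in a1.
  pose proof (Rle_abs t2) as a2. pose proof (Rabs_pos s1). pose proof (Rabs_pos t2).
  pose proof (Rle_abs s1). pose proof (Rle_abs (- t2)) as a3. rewrite Rabs_Ropp in a3.
  rewrite (weak_balance_self_similar eta G w (rL, qL) (rb, qb) (Rmax M1 M2) X)
    with (defect := fun psi => jump_defect eta G s1 s2 (rL, qL) (rM, qM) * psi s1
               + jump_defect eta G t1 t2 (rM, qM) (rb, qb) * psi t1); try assumption.
  - reflexivity.
  - unfold X; lra.
  - apply two_wave_regulated; assumption.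
  - apply two_wave_regulated; assumption.
  - intros; eapply Rle_trans; [apply hM1|apply Rmax_l].
  - intros; eapply Rle_trans; [apply hM2|apply Rmax_r].
  - intros x hx. apply two_wave_left. unfold X in hx. lra.
  - intros x hx. apply two_wave_right. unfold X in hx. lra.
  - intros psi psi' hpsi hpsi'.
    assert (hc0 : forall x : R, continuous psi x).
    { intros x. apply (ex_derive_continuous (V := R_NormedModule)). eexists; apply hpsi. }
    assert (hex : forall u v, ex_RInt (fun xi => (G (w xi) - xi * eta (w xi)) * psi' xi - eta (w xi) * psi xi) u v).
    { intros u v. apply ex_RInt_regulated.
      assert (rc : forall f, (forall x : R, continuous f x) -> regulated f) by (intros; apply regulated_continuous; assumption).
      pose proof (two_wave_regulated eta heta). pose proof (two_wave_regulated G hG).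
      apply regulated_minus; apply regulated_mult; auto. apply regulated_minus; [assumption|].
      apply regulated_mult; [apply rc; intros; cont|assumption]. }
    rewrite (RInt_split _ (- X) s1 X), (RInt_split _ s1 s2 X), (RInt_split _ s2 t1 X), (RInt_split _ t1 t2 X) by apply hex.
    rewrite (RInt_ext _ (fun xi => (G (rL, qL) - xi * eta (rL, qL)) * psi' xi - eta (rL, qL) * psi xi) (- X) s1).
    2:{ intros x. rewrite Rmin_left, Rmax_right by (unfold X; lra). intros hx. rewrite two_wave_left by lra. reflexivity. }
    rewrite (RInt_ext _ (fun xi => (G (fan c 1 s1 rL xi) - xi * eta (fan c 1 s1 rL xi)) * psi' xi
                  - eta (fan c 1 s1 rL xi) * psi xi) s1 s2).
    2:{ intros x. rewrite Rmin_left, Rmax_right by lra. intros hx. rewrite two_wave_slow by lra. reflexivity. }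
    rewrite (RInt_ext _ (fun xi => (G (rM, qM) - xi * eta (rM, qM)) * psi' xi - eta (rM, qM) * psi xi) s2 t1).
    2:{ intros x. rewrite Rmin_left, Rmax_right by lra. intros hx. rewrite two_wave_middle by lra. reflexivity. }
    rewrite (RInt_ext _ (fun xi => (G (fan c (-1) t1 rM xi) - xi * eta (fan c (-1) t1 rM xi)) * psi' xi
                  - eta (fan c (-1) t1 rM xi) * psi xi) t1 t2).
    2:{ intros x. rewrite Rmin_left, Rmax_right by lra. intros hx. rewrite two_wave_fast by lra. reflexivity. }
    rewrite (RInt_ext _ (fun xi => (G (rb, qb) - xi * eta (rb, qb)) * psi' xi - eta (rb, qb) * psi xi) t2 X).
    2:{ intros x. rewrite Rmin_left, Rmax_right by (unfold X; lra). intros hx. rewrite two_wave_right by lra. reflexivity. }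
    rewrite !conserved_constant by assumption.
    rewrite (balance_across_wave c 1 s1 s2 rL qL rM qM eta G psi psi') by (try assumption; ring).
    rewrite (balance_across_wave c (-1) t1 t2 rM qM rb qb eta G psi psi') by (try assumption; ring).
    eqR. ring.
Qed.

End TwoWave.

(** Across a shock mass and momentum are conserved, and energy is dissipated
    because the gas is compressed. *)
Lemma joined_jump (c s s1 s2 r1 q1 r2 q2 : R) :
  0 < c -> s = 1 \/ s = -1 -> 0 < r1 -> 0 < r2 -> joined c s s1 s2 r1 q1 r2 q2 ->
  jump_defect (fun U => fst U) (fun U => snd U) s1 s2 (r1, q1) (r2, q2) = 0 /\
  jump_defect (fun U => snd U) (momentum_flux c) s1 s2 (r1, q1) (r2, q2) = 0 /\
  0 <= jump_defect (energy c) (energy_flux c) s1 s2 (r1, q1) (r2, q2).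
Proof.
  intros hc hs h1 h2 hj. unfold jump_defect. destruct (Rlt_dec s1 s2) as [hlt|hge]; [lra|].
  destruct hj as [[_ [hp [hq hi]]]|[h _]]; [|lra].
  set (a := q1 - s1 * r1) in *.
  assert (e1 : q1 = a + s1 * r1) by (unfold a; ring). assert (e2 : q2 = a + s1 * r2) by lra.
  assert (hp' : a ^ 2 = c ^ 2 * (r1 * r2)) by (rewrite hp; field; lra).
  clearbody a. subst q1 q2. simpl fst. simpl snd. split; [ring|]. split.
  - unfold momentum_flux. simpl fst; simpl snd.
    replace ((a + s1 * r1) ^ 2 / r1) with (a ^ 2 / r1 + 2 * s1 * a + s1 ^ 2 * r1) by (field; lra).
    replace ((a + s1 * r2) ^ 2 / r2) with (a ^ 2 / r2 + 2 * s1 * a + s1 ^ 2 * r2) by (field; lra).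
    rewrite hp'. field. lra.
  - assert (hf : forall r, 0 < r -> energy_flux c (r, a + s1 * r) - s1 * energy c (r, a + s1 * r) =
       a * (a ^ 2 / (2 * r ^ 2) + c ^ 2 * ln r) + s1 * (a ^ 2 / r + c ^ 2 * r) + a * (s1 ^ 2 / 2 + c ^ 2)).
    { intros r hr. unfold energy_flux, energy. simpl fst; simpl snd. field. lra. }
    rewrite !hf by assumption. rewrite hp'.
    assert (c2 : 0 < c ^ 2) by (apply pow_lt; assumption).
    assert (hz : forall z, 1 <= z -> 0 <= z - / z - 2 * ln z).
    { intros z hz. pose proof (two_ln_gap_incr 1 z ltac:(lra)) as h. rewrite ln_1, Rinv_1 in h. lra. }
    assert (hd : forall r r', 0 < r -> 0 < r' ->
       c ^ 2 * (r * r') / (2 * r ^ 2) + c ^ 2 * ln r - (c ^ 2 * (r * r') / (2 * r' ^ 2) + c ^ 2 * ln r')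
       = c ^ 2 / 2 * (r' / r - / (r' / r) - 2 * ln (r' / r))).
    { intros r r' hr hr'. rewrite ln_div by assumption. field. lra. }
    enough (hE : 0 <= a * (c ^ 2 * (r1 * r2) / (2 * r1 ^ 2) + c ^ 2 * ln r1
        - (c ^ 2 * (r1 * r2) / (2 * r2 ^ 2) + c ^ 2 * ln r2))).
    { replace (c ^ 2 * (r1 * r2) / r1 + c ^ 2 * r1) with (c ^ 2 * (r1 * r2) / r2 + c ^ 2 * r2) by (field; lra). lra. }
    assert (p1 : 0 < c * r1) by (apply Rmult_lt_0_compat; assumption).
    assert (p2 : 0 < c * r2) by (apply Rmult_lt_0_compat; assumption).
    destruct hs; subst s.
    + rewrite hd by assumption. apply Rmult_le_pos; [lra|]. apply Rmult_le_pos; [lra|].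
      apply hz. apply Rle_div_r; [assumption|]. apply Rmult_le_reg_l with c; [assumption|lra].
    + replace (c ^ 2 * (r1 * r2) / (2 * r1 ^ 2) + c ^ 2 * ln r1 - (c ^ 2 * (r1 * r2) / (2 * r2 ^ 2) + c ^ 2 * ln r2))
        with (- (c ^ 2 * (r2 * r1) / (2 * r2 ^ 2) + c ^ 2 * ln r2 - (c ^ 2 * (r2 * r1) / (2 * r1 ^ 2) + c ^ 2 * ln r1)))
        by (rewrite (Rmult_comm r2 r1); ring).
      rewrite hd by assumption.
      rewrite <- Rmult_opp_opp, Ropp_involutive. apply Rmult_le_pos; [lra|]. apply Rmult_le_pos; [lra|].
      apply hz. apply Rle_div_r; [assumption|]. apply Rmult_le_reg_l with c; [assumption|lra].
Qed.

(** Mass and momentum have no defect at the shocks, and the defect of the energy is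
    nonnegative. *)
Lemma two_wave_solution (c s1 s2 t1 t2 rL qL rM qM rb qb : R) :
  0 < c -> s1 <= s2 -> s2 <= t1 -> t1 <= t2 -> 0 < rL -> 0 < rM -> 0 < rb ->
  joined c 1 s1 s2 rL qL rM qM -> joined c (-1) t1 t2 rM qM rb qb ->
  riemann_solution c (rL, qL) (rb, qb) (two_wave c s1 s2 t1 t2 rL qL rM qM rb qb).
Proof.
  intros hc h12 h23 h34 hrL hrM hrb j1 j2.
  set (w := two_wave c s1 s2 t1 t2 rL qL rM qM rb qb).
  assert (cf : forall U : R * R, 0 < fst U -> continuous (fun U : R * R => fst U) U) by (intros; apply continuous_fst_R).
  assert (cs : forall U : R * R, 0 < fst U -> continuous (fun U : R * R => snd U) U) by (intros; apply continuous_snd_R).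
  destruct (joined_jump c 1 s1 s2 rL qL rM qM hc (or_introl eq_refl) hrL hrM j1) as [a1 [a2 a3]].
  destruct (joined_jump c (-1) t1 t2 rM qM rb qb hc (or_intror eq_refl) hrM hrb j2) as [b1 [b2 b3]].
  constructor.
  - destruct (two_wave_density_bound c s1 s2 t1 t2 rL qL rM qM rb qb) as [m [hm hb]]; try assumption.
    destruct (two_wave_bounded c s1 s2 t1 t2 rL qL rM qM rb qb) with (F := fun U : R * R => fst U) as [M1 h1]; try assumption.
    destruct (two_wave_bounded c s1 s2 t1 t2 rL qL rM qM rb qb) with (F := fun U : R * R => snd U) as [M2 h2]; try assumption.
    exists m, (Rmax M1 M2). split; [assumption|]. intros xi. split; [split|].
    + apply hb.
    + eapply Rle_trans; [apply Rle_abs|]. eapply Rle_trans; [apply h1|apply Rmax_l].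
    + eapply Rle_trans; [apply h2|apply Rmax_r].
  - intros xi. apply two_wave_limits. assumption.
  - intros xi. apply two_wave_limits. assumption.
  - intros K phi hphi.
    change (weak_balance (fun U : R * R => fst U) (fun U : R * R => snd U) w (rL, qL) (rb, qb) K phi = 0).
    unfold w. rewrite two_wave_balance; try assumption.
    + rewrite a1, b1. apply RInt_zero. intros; ring.
    + apply mass_along_fan; assumption.
  - intros K phi hphi.
    change (weak_balance (fun U : R * R => snd U) (momentum_flux c) w (rL, qL) (rb, qb) K phi = 0).
    unfold w. rewrite two_wave_balance; try assumption.
    + rewrite a2, b2. apply RInt_zero. intros; ring.
    + intros; apply continuous_momentum_flux; assumption.
    + apply momentum_along_fan; assumption.
  - intros K phi hphi hpos. unfold w. rewrite two_wave_balance; try assumption.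
    + destruct hphi as [hK [[f1 [f2 hC1]] hsupp]].
      apply RInt_ge_0; [lra| |].
      * apply cont_ex_RInt. intros t.
        assert (hct : forall k, continuous (fun t => phi t (t * k)) t).
        { intros k. apply (continuous_comp_2 (fun t => t) (fun t => t * k) phi); [cont|cont|].
          apply (differentiable_continuous phi t (t * k) (f1 t (t * k)) (f2 t (t * k))).
          apply C1_differentiable; try (apply hC1; trivial).
          apply filter_forall. intros p. apply hC1; trivial. }
        cont; apply hct.
      * intros t ht. apply Rplus_le_le_0_compat; (apply Rmult_le_pos; [assumption|apply hpos; lra]).
    + intros; apply continuous_energy; assumption.
    + intros; apply continuous_energy_flux; assumption.
    + apply energy_along_fan; assumption.
Qed.

(** * The Riemann problem *)

Lemma hug_1 : hug 1 = 0.
Proof. rewrite hug_rarefaction, ln_1 by lra. reflexivity. Qed.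

(** The slow curve of the left state decreases and the fast curve of the right state
    increases, both over the whole line, since [hug] grows at least like a
    logarithm at both ends: they cross. *)
Lemma riemann_middle_density (c rL uL rb ub : R) :
  0 < c -> 0 < rL -> 0 < rb ->
  exists r, 0 < r /\ wave_velocity c rL uL r = - wave_velocity c rb (- ub) r.
Proof.
  intros hc hL hb.
  set (N := Rabs (uL - ub) / c).
  assert (hN : c * N = Rabs (uL - ub)) by (unfold N; field; lra).
  assert (hN0 : 0 <= N) by (apply Rdiv_le_0_compat; [apply Rabs_pos|assumption]).
  pose proof (Rle_abs (uL - ub)). pose proof (Rle_abs (- (uL - ub))). rewrite Rabs_Ropp in *.
  set (f := fun y => wave_velocity c rL uL (exp y) + wave_velocity c rb (- ub) (exp y)).
  assert (hf : continuity f).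
  { intros y. apply continuity_pt_filterlim.
    apply (cont_plus (fun y => wave_velocity c rL uL (exp y)) (fun y => wave_velocity c rb (- ub) (exp y)));
      apply (continuous_comp exp); try (apply wave_velocity_continuous; [assumption|apply exp_pos]);
      apply (cont_exp (fun y => y)), continuous_id. }
  assert (hug_low : forall x, x <= exp (- N) -> 0 < x -> hug x <= - N).
  { intros x hx hx0. assert (exp (- N) <= 1) by (rewrite <- exp_0; destruct hN0 as [h|h]; [left; apply exp_increasing; lra|rewrite <- h, Ropp_0; lra]).
    rewrite hug_rarefaction by lra. rewrite <- (ln_exp (- N)). apply ln_le; assumption. }
  assert (hug_high : forall x, exp N <= x -> N <= hug x).
  { intros x hx. pose proof (exp_ge_1 N hN0).
    pose proof (hug_incr_ln 1 x ltac:(lra)) as h1. rewrite hug_1, ln_1 in h1.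
    assert (N <= ln x); [|lra]. rewrite <- (ln_exp N) at 1. apply ln_le; [apply exp_pos|assumption]. }
  set (y0 := ln (Rmin rL rb) - N). set (y1 := ln (Rmax rL rb) + N).
  pose proof (Rmin_pos _ _ hL hb). pose proof (Rmin_l rL rb). pose proof (Rmin_r rL rb).
  pose proof (Rmax_l rL rb). pose proof (Rmax_r rL rb).
  assert (e0 : exp y0 = Rmin rL rb * exp (- N)).
  { unfold y0, Rminus. rewrite exp_plus, exp_ln by assumption. reflexivity. }
  assert (e1 : exp y1 = Rmax rL rb * exp N).
  { unfold y1. rewrite exp_plus, exp_ln by lra. reflexivity. }
  assert (f0 : 0 <= f y0).
  { unfold f, wave_velocity. rewrite e0.
    assert (k : forall r, 0 < r -> Rmin rL rb <= r -> hug (Rmin rL rb * exp (- N) / r) <= - N).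
    { intros r hr hm. pose proof (exp_pos (- N)). apply hug_low.
      - apply Rle_div_l; [assumption|]. rewrite Rmult_comm. apply Rmult_le_compat_l; lra.
      - apply Rdiv_lt_0_compat; [apply Rmult_lt_0_compat|]; assumption. }
    pose proof (k rL hL ltac:(lra)). pose proof (k rb hb ltac:(lra)). nra. }
  assert (f1 : f y1 <= 0).
  { unfold f, wave_velocity. rewrite e1.
    assert (k : forall r, 0 < r -> r <= Rmax rL rb -> N <= hug (Rmax rL rb * exp N / r)).
    { intros r hr hm. pose proof (exp_pos N). apply hug_high.
      apply Rle_div_r; [assumption|]. rewrite Rmult_comm. apply Rmult_le_compat_r; lra. }
    pose proof (k rL hL ltac:(lra)). pose proof (k rb hb ltac:(lra)). nra. }
  destruct (IVT_gen f y0 y1 0 hf) as [y [_ hy]].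
  { rewrite Rmin_right, Rmax_left; lra. }
  exists (exp y). split; [apply exp_pos|]. unfold f in hy. lra.
Qed.

(** A rarefaction towards lower densities, a shock towards higher ones. *)
Lemma joined_slow (c rL uL rM : R) : 0 < c -> 0 < rL -> 0 < rM ->
  let uM := wave_velocity c rL uL rM in
  exists s1 s2, s1 <= s2 /\ s2 < uM /\ joined c 1 s1 s2 rL (uL * rL) rM (uM * rM) /\
    ((rM < rL /\ s1 < s2 /\ s1 = uL - c /\ s2 = uM - c) \/
     (rL <= rM /\ s1 = s2 /\ s1 = uL - c * sqrt (rM / rL))).
Proof.
  intros hc hL hM uM. destruct (Rlt_le_dec rM rL) as [h|h].
  - exists (uL - c), (uM - c).
    assert (hlt : rM / rL < 1) by (apply Rlt_div_l; lra).
    assert (h0 : 0 < rM / rL) by (apply Rdiv_lt_0_compat; assumption).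
    assert (hu : uM = uL - c * ln (rM / rL)).
    { unfold uM, wave_velocity. rewrite hug_rarefaction by lra. reflexivity. }
    assert (hln : ln (rM / rL) < 0) by (rewrite <- ln_1; apply ln_increasing; assumption).
    assert (hs : uL - c < uM - c) by nra.
    split; [lra|]. split; [lra|]. split; [|left; auto].
    right. split; [assumption|]. split; [ring|]. split; [ring|].
    replace (- (1) * (uM - c - (uL - c)) / c) with (ln (rM / rL)) by (rewrite hu; field; lra).
    rewrite exp_ln by assumption. field. lra.
  - set (m := sqrt (rM / rL)).
    assert (h1 : 1 <= rM / rL) by (apply Rle_div_r; lra).
    assert (hm : 1 <= m) by (unfold m; rewrite <- sqrt_1; apply sqrt_le_1; lra).
    assert (hmm : rM = m * m * rL) by (unfold m; rewrite sqrt_sqrt by lra; field; lra).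
    assert (hu : uM = uL - c * (m - / m)).
    { unfold uM, wave_velocity. rewrite hug_shock by assumption. reflexivity. }
    assert (hi : 0 < / m) by (apply Rinv_0_lt_compat; lra).
    assert (hcL : 0 < c * rL) by (apply Rmult_lt_0_compat; assumption).
    exists (uL - c * m), (uL - c * m).
    assert (hci : 0 < c * / m) by (apply Rmult_lt_0_compat; assumption).
    split; [lra|]. split; [rewrite hu; lra|]. split; [|right; auto].
    left. split; [reflexivity|].
    replace (uL * rL - (uL - c * m) * rL) with (c * rL * m) by ring.
    split; [rewrite hmm; field; lra|]. split; [rewrite hu, hmm; field; lra|].
    assert (0 <= c * rL * m * (m - 1)) by (apply Rmult_le_pos; [apply Rmult_le_pos|]; lra).
    split; [nra|]. rewrite hmm. lra.
Qed.

Lemma joined_reflect (c s s' s1 s2 r1 q1 r2 q2 : R) : 0 < c -> 0 < r1 -> 0 < r2 -> s' = - s ->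
  joined c s s1 s2 r1 q1 r2 q2 -> joined c s' (- s2) (- s1) r2 (- q2) r1 (- q1).
Proof.
  intros hc h1 h2 hs' [[hs [hp [hq hi]]]|[hs [k1 [k2 k3]]]]; subst s'.
  - left. subst s2. split; [reflexivity|]. split; [|split; [lra|split; lra]].
    rewrite Rmult_comm, hp, hq. field. lra.
  - right. split; [lra|]. split; [lra|]. split; [lra|].
    rewrite k3, Rmult_assoc, <- exp_plus.
    replace (- s * (s2 - s1) / c + - - s * (- s1 - - s2) / c) with 0 by (field; lra).
    rewrite exp_0. ring.
Qed.

(** The mirror image of [joined_slow]. *)
Lemma joined_fast (c rb ub rM : R) : 0 < c -> 0 < rb -> 0 < rM ->
  let uM := - wave_velocity c rb (- ub) rM in
  exists t1 t2, t1 <= t2 /\ uM < t1 /\ joined c (-1) t1 t2 rM (uM * rM) rb (ub * rb) /\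
    ((rM < rb /\ t1 < t2 /\ t2 = ub + c) \/
     (rb <= rM /\ t1 = t2 /\ t2 = ub + c * sqrt (rM / rb))).
Proof.
  intros hc hb hM uM.
  destruct (joined_slow c rb (- ub) rM hc hb hM) as [s1 [s2 [h1 [h2 [h3 h4]]]]].
  exists (- s2), (- s1). split; [lra|]. split; [unfold uM; lra|]. split.
  - apply (joined_reflect c 1 (-1)) in h3; try assumption; [|ring].
    replace (uM * rM) with (- (wave_velocity c rb (- ub) rM * rM)) by (unfold uM; ring).
    replace (ub * rb) with (- (- ub * rb)) by ring. assumption.
  - destruct h4 as [[k1 [k2 [k3 k4]]]|[k1 [k2 k3]]]; [left|right]; repeat split; lra.
Qed.

Section Traces.
Variables (c s1 s2 t1 t2 rL qL rM qM rb qb x : R).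
Hypothesis h12 : s1 <= s2.
Hypothesis h23 : s2 <= t1.
Hypothesis h34 : t1 <= t2.
Let w := two_wave c s1 s2 t1 t2 rL qL rM qM rb qb.

Lemma trace_left : x <= s1 -> filterlim w (at_left x) (locally (rL, qL)).
Proof.
  intros h. apply (left_limit_ext (fun _ => (rL, qL)) _ x 1); [lra| |apply filterlim_const].
  intros y hy. symmetry. apply two_wave_left. lra.
Qed.

Lemma trace_middle : s2 < x <= t1 -> filterlim w (at_left x) (locally (rM, qM)).
Proof.
  intros h. apply (left_limit_ext (fun _ => (rM, qM)) _ x (x - s2)); [lra| |apply filterlim_const].
  intros y hy. symmetry. apply two_wave_middle; lra.
Qed.

Lemma trace_right : t2 < x -> filterlim w (at_left x) (locally (rb, qb)).
Proof.
  intros h. apply (left_limit_ext (fun _ => (rb, qb)) _ x (x - t2)); [lra| |apply filterlim_const].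
  intros y hy. symmetry. apply two_wave_right; lra.
Qed.

Lemma trace_slow_end : 0 < c -> s1 < s2 -> x = s2 -> joined c 1 s1 s2 rL qL rM qM ->
  filterlim w (at_left x) (locally (rM, qM)).
Proof.
  intros hc h hx hj. subst x.
  rewrite <- (proj2 (joined_fan_ends c 1 s1 s2 rL qL rM qM h hj)).
  apply (left_limit_ext (fan c 1 s1 rL) _ s2 (s2 - s1)); [lra| |].
  - intros y hy. symmetry. apply two_wave_slow; lra.
  - apply filterlim_filter_le_1 with (2 := continuous_fan c 1 s1 rL s2 hc). apply filter_le_within.
Qed.

Lemma trace_fast_end : 0 < c -> t1 < t2 -> x = t2 -> joined c (-1) t1 t2 rM qM rb qb ->
  filterlim w (at_left x) (locally (rb, qb)).
Proof.
  intros hc h hx hj. subst x.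
  rewrite <- (proj2 (joined_fan_ends c (-1) t1 t2 rM qM rb qb h hj)).
  apply (left_limit_ext (fan c (-1) t1 rM) _ t2 (t2 - t1)); [lra| |].
  - intros y hy. symmetry. apply two_wave_fast; lra.
  - apply filterlim_filter_le_1 with (2 := continuous_fan c (-1) t1 rM t2 hc). apply filter_le_within.
Qed.

End Traces.

Lemma joined_trivial (c s r u : R) : s = 1 \/ s = -1 -> 0 < c -> joined c s (u - s * c) (u - s * c) r (u * r) r (u * r).
Proof.
  intros hs hc. left. split; [reflexivity|].
  replace (u * r - (u - s * c) * r) with (s * c * r) by ring.
  split; [|split; [reflexivity|lra]]. destruct hs; subst s; field; lra.
Qed.

(** Each accessible state is realised by a two-wave field: it is the left state, the
    middle state, or the right state in the last case and when it is the sonic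
    end of a fast fan. The middle density is compared with that of the trace by
    the monotonicity of the wave curves, which locates the waves with respect to
    the particle. *)
Lemma accessible_V_minus (c r0 a0 v rho alpha : R) :
  0 < c -> 0 < r0 -> accessible c r0 a0 rho alpha -> V_minus c r0 a0 v (rho, alpha).
Proof.
  intros hc h0 [hrho hacc].
  set (u0 := a0 / r0 + v).
  assert (hq0 : a0 + v * r0 = u0 * r0) by (unfold u0; field; lra).
  assert (hphi : forall x, wave_velocity c r0 u0 x = phi c r0 a0 x + v).
  { intros x. unfold phi, wave_velocity, u0. ring. }
  (* Any Riemann solution with the right trace will do. *)
  assert (hgoal : forall q rb qb w, q = alpha + v * rho -> 0 < rb ->
     riemann_solution c (r0, u0 * r0) (rb, qb) w ->
     filterlim w (at_left v) (locally (rho, q)) -> V_minus c r0 a0 v (rho, alpha)).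
  { intros q rb qb w hq hrb hs hl. exists rho, q. split; [|f_equal; lra].
    exists (rb, qb), w. rewrite hq0. auto. }
  (* The trace is the middle state: no fast wave is needed. *)
  assert (hmid : forall s1 s2 u, s1 <= s2 -> s2 < u -> alpha = rho * (u - v) -> v <= u + c ->
      joined c 1 s1 s2 r0 (u0 * r0) rho (u * rho) -> (s2 < v \/ (s1 < s2 /\ v = s2)) ->
      V_minus c r0 a0 v (rho, alpha)).
  { intros s1 s2 u h12 h2u ha hv hj hs2.
    assert (ht : u - -1 * c = u + c) by ring.
    pose proof (joined_trivial c (-1) rho u (or_intror eq_refl) hc) as jt. rewrite ht in jt.
    apply (hgoal (u * rho) rho (u * rho) (two_wave c s1 s2 (u + c) (u + c) r0 (u0 * r0) rho (u * rho) rho (u * rho))).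
    - rewrite ha. ring.
    - assumption.
    - apply two_wave_solution; try assumption; lra.
    - destruct hs2 as [hs2|[hs2 hv2]].
      + apply trace_middle; lra.
      + apply trace_slow_end; try assumption; lra. }
  destruct hacc as [[hsup [hr ha]]|[[ha [hc1 hc2]]|[hsup hlt]]].
  - subst rho alpha.
    assert (hu : c < u0 - v).
    { unfold u0. replace (a0 / r0 + v - v) with (a0 / r0) by ring. apply Rlt_div_r; lra. }
    pose proof (joined_trivial c 1 r0 u0 (or_introl eq_refl) hc) as js.
    pose proof (joined_trivial c (-1) r0 u0 (or_intror eq_refl) hc) as jt.
    apply (hgoal (u0 * r0) r0 (u0 * r0) (two_wave c (u0 - 1 * c) (u0 - 1 * c) (u0 - -1 * c) (u0 - -1 * c) r0 (u0 * r0) r0 (u0 * r0) r0 (u0 * r0))).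
    + lra.
    + assumption.
    + apply two_wave_solution; try assumption; lra.
    + apply trace_left. lra.
  - destruct (Rle_lt_dec (- c) (phi c r0 a0 rho)) as [hge|hlt].
    + rewrite Rmax_left in ha by assumption.
      set (u := wave_velocity c r0 u0 rho).
      assert (hu : u - v = phi c r0 a0 rho) by (unfold u; rewrite hphi; ring).
      assert (hau : alpha = rho * (u - v)) by (rewrite hu; assumption).
      destruct (joined_slow c r0 u0 rho hc h0 hrho) as [s1 [s2 [h12 [h2u [hj hcase]]]]].
      fold u in h2u, hj, hcase.
      destruct hcase as [[k1 [k2 [k3 k4]]]|[k1 [k2 k3]]].
      * apply (hmid s1 s2 u); try assumption; try lra.
      * (* the shock has negative speed in the frame of the particle, unless
           it is void and the left state is sonic *)
        assert (h1 : 1 <= rho / r0) by (apply Rle_div_r; lra).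
        assert (hsq : 1 <= sqrt (rho / r0)).
        { rewrite <- sqrt_1. apply sqrt_le_1; lra. }
        destruct (Rle_lt_dec a0 (c * r0)) as [hsub|hsuper].
        -- assert (hu0 : u0 - v <= c).
           { unfold u0. replace (a0 / r0 + v - v) with (a0 / r0) by ring. apply Rle_div_l; lra. }
           destruct k1 as [k1|k1].
           ++ assert (1 < sqrt (rho / r0)).
              { rewrite <- sqrt_1. apply sqrt_lt_1; try lra. apply Rlt_div_r; lra. }
              apply (hmid s1 s2 u); try assumption; try lra. left. nra.
           ++ assert (hr1 : rho / r0 = 1) by (rewrite <- k1; field; lra).
              rewrite hr1, sqrt_1 in k3.
              destruct (Rlt_le_dec s2 v) as [hs|hs]; [apply (hmid s1 s2 u); auto; lra|].
              assert (huu : u = u0).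
              { unfold u, wave_velocity. rewrite hr1, hug_1. ring. }
              pose proof (joined_trivial c (-1) r0 u0 (or_intror eq_refl) hc) as jt.
              rewrite <- k1, huu in hj.
              apply (hgoal (u0 * r0) r0 (u0 * r0) (two_wave c s1 s2 (u0 - -1 * c) (u0 - -1 * c) r0 (u0 * r0) r0 (u0 * r0) r0 (u0 * r0))).
              ** rewrite ha, <- hu, huu, k1. ring.
              ** assumption.
              ** apply two_wave_solution; try assumption; lra.
              ** rewrite <- k1. apply trace_left. lra.
        -- specialize (hc2 hsuper). unfold conj_density in hc2.
           assert (hs : a0 / (c * r0) < sqrt (rho / r0)).
           { assert (hpos : 0 < a0 / (c * r0)).
             { apply Rdiv_lt_0_compat; [|apply Rmult_lt_0_compat; assumption].
               apply Rlt_trans with (c * r0); [apply Rmult_lt_0_compat; assumption|assumption]. }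
             rewrite <- (sqrt_pow2 (a0 / (c * r0))) by lra. apply sqrt_lt_1; [apply pow2_ge_0|lra|].
             apply (proj1 (Rlt_div_r _ rho r0 h0)).
             replace ((a0 / (c * r0)) ^ 2 * r0) with (a0 ^ 2 / (c ^ 2 * r0)) by (field; lra). assumption. }
           apply (hmid s1 s2 u); try assumption; try lra. left. rewrite <- k2, k3. unfold u0.
           apply Rmult_lt_compat_l with (r := c) in hs; [|assumption].
           replace (c * (a0 / (c * r0))) with (a0 / r0) in hs by (field; lra). lra.
    + rewrite Rmax_right in ha by lra.
      set (ub := v - c).
      destruct (riemann_middle_density c r0 u0 rho ub hc h0 hrho) as [rM [hrM hmide]].
      destruct (joined_slow c r0 u0 rM hc h0 hrM) as [s1 [s2 [h12 [h2u [hj1 _]]]]].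
      destruct (joined_fast c rho ub rM hc hrho hrM) as [t1 [t2 [k12 [k2u [hj2 hcase]]]]].
      rewrite <- hmide in k2u, hj2.
      assert (hM : rM < rho).
      { apply Rnot_le_lt. intros hle.
        assert (hat : wave_velocity c rho (- ub) rho = - ub).
        { unfold wave_velocity. replace (rho / rho) with 1 by (field; lra). rewrite hug_1. ring. }
        assert (wave_velocity c r0 u0 rM <= wave_velocity c r0 u0 rho).
        { destruct hle as [hle|hle]; [left; apply wave_velocity_decr; auto|subst rM; lra]. }
        assert (wave_velocity c rho (- ub) rM <= - ub).
        { rewrite <- hat at 2. destruct hle as [hle|hle]; [left; apply wave_velocity_decr; auto|subst rM; lra]. }
        rewrite (hphi rho) in H. unfold ub in *. lra. }
      destruct hcase as [[m1 [m2 m3]]|[m1 _]]; [|lra].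
      apply (hgoal (ub * rho) rho (ub * rho) (two_wave c s1 s2 t1 t2 r0 (u0 * r0) rM (wave_velocity c r0 u0 rM * rM) rho (ub * rho))).
      * rewrite ha. unfold ub. ring.
      * assumption.
      * apply two_wave_solution; try assumption; lra.
      * apply trace_fast_end; try assumption; unfold ub in *; lra.
  - set (ub := alpha / rho + v). set (rh := conj_density c alpha rho) in *.
    assert (hcr : 0 < c * rho) by (apply Rmult_lt_0_compat; assumption).
    assert (hrh : rh / rho = (- alpha / (c * rho)) ^ 2) by (unfold rh, conj_density; field; lra).
    assert (hm : 1 < - alpha / (c * rho)) by (apply Rlt_div_r; lra).
    assert (hrh0 : 0 < rh).
    { unfold rh, conj_density. apply Rdiv_lt_0_compat; [nra|apply Rmult_lt_0_compat; [apply pow_lt|]; assumption]. }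
    assert (hsq : sqrt (rh / rho) = - alpha / (c * rho)) by (rewrite hrh; apply sqrt_pow2; lra).
    (* The fast shock joining density [rh] to the state is stationary. *)
    assert (hat : wave_velocity c rho (- ub) rh = - (v + alpha / rh)).
    { unfold wave_velocity. rewrite hug_shock, hsq by (rewrite hrh; nra).
      unfold ub. replace rh with (alpha ^ 2 / (c ^ 2 * rho)) by reflexivity. field. repeat split; lra. }
    destruct (riemann_middle_density c r0 u0 rho ub hc h0 hrho) as [rM [hrM hmide]].
    destruct (joined_slow c r0 u0 rM hc h0 hrM) as [s1 [s2 [h12 [h2u [hj1 _]]]]].
    destruct (joined_fast c rho ub rM hc hrho hrM) as [t1 [t2 [k12 [k2u [hj2 hcase]]]]].
    rewrite <- hmide in k2u, hj2.
    assert (hM : rM < rh).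
    { apply Rnot_le_lt. intros hle.
      assert (wave_velocity c r0 u0 rM <= wave_velocity c r0 u0 rh).
      { destruct hle as [hle|hle]; [left; apply wave_velocity_decr; auto|rewrite hle; lra]. }
      assert (wave_velocity c rho (- ub) rM <= - (v + alpha / rh)).
      { rewrite <- hat. destruct hle as [hle|hle]; [left; apply wave_velocity_decr; auto|rewrite hle; lra]. }
      rewrite (hphi rh) in H.
      assert (phi c r0 a0 rh < alpha / rh); [|lra].
      apply Rlt_div_r; [assumption|]. lra. }
    apply (hgoal (ub * rho) rho (ub * rho) (two_wave c s1 s2 t1 t2 r0 (u0 * r0) rM (wave_velocity c r0 u0 rM * rM) rho (ub * rho))).
    + unfold ub. field. lra.
    + assumption.
    + apply two_wave_solution; try assumption; lra.
    + apply trace_right; try lra.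
      assert (hur : - (alpha / rho) = c * (- alpha / (c * rho))) by (field; lra).
      destruct hcase as [[m1 [m2 m3]]|[m1 [m2 m3]]]; rewrite m3; unfold ub.
      * nra.
      * assert (sqrt (rM / rho) < - alpha / (c * rho)); [|nra].
        rewrite <- hsq. apply sqrt_lt_1.
        -- left. apply Rdiv_lt_0_compat; assumption.
        -- rewrite hrh. apply pow2_ge_0.
        -- apply Rmult_lt_compat_r; [apply Rinv_0_lt_compat|]; assumption.
Qed.

Lemma V_minus_iff (c r0 a0 v rho alpha : R) :
  0 < c -> 0 < r0 -> V_minus c r0 a0 v (rho, alpha) <-> accessible c r0 a0 rho alpha.
Proof.
  intros hc h0. split; [apply V_minus_accessible|apply accessible_V_minus]; assumption.
Qed.

(** * Reflection *)

Definition mirror (U : R * R) : R * R := (fst U, - snd U).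

Lemma continuous_mirror (U : R * R) : continuous mirror U.
Proof.
  apply filterlim_locally. intros e. apply filter_and.
  - exact (proj1 (filterlim_locally _ _) (continuous_fst_R U) e).
  - exact (proj1 (filterlim_locally _ _) (cont_opp _ _ (continuous_snd_R U)) e).
Qed.

Lemma opp_at_left (x : R) : filterlim Ropp (at_left x) (at_right (- x)).
Proof.
  intros P [d hd]. exists d. intros y hy hyx. apply hd; [|lra].
  change (Rabs (- y - - x) < d). change (Rabs (y - x) < d) in hy.
  replace (- y - - x) with (- (y - x)) by ring. rewrite Rabs_Ropp. assumption.
Qed.

Lemma opp_at_right (x : R) : filterlim Ropp (at_right x) (at_left (- x)).
Proof.
  intros P [d hd]. exists d. intros y hy hyx. apply hd; [|lra].
  change (Rabs (- y - - x) < d). change (Rabs (y - x) < d) in hy.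
  replace (- y - - x) with (- (y - x)) by ring. rewrite Rabs_Ropp. assumption.
Qed.

(** The classification of the profiles in terms of the fields that are known to be
    solutions, with the same one-sided limits. *)
Lemma two_waves_of_solution (c : R) (Ua Ub : R * R) (w : R -> R * R) :
  0 < c -> riemann_solution c Ua Ub w ->
  exists s1 s2 t1 t2 rL qL rM qM rb qb,
    (s1 <= s2 /\ s2 <= t1 /\ t1 <= t2) /\ (0 < rL /\ 0 < rM /\ 0 < rb) /\
    joined c 1 s1 s2 rL qL rM qM /\ joined c (-1) t1 t2 rM qM rb qb /\
    Ua = (rL, qL) /\ Ub = (rb, qb) /\
    forall x U, let w' := two_wave c s1 s2 t1 t2 rL qL rM qM rb qb in
      (filterlim w (at_left x) (locally U) -> filterlim w' (at_left x) (locally U)) /\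
      (filterlim w (at_right x) (locally U) -> filterlim w' (at_right x) (locally U)).
Proof.
  intros hc hsol.
  destruct (profile_of_solution c _ _ _ hc hsol) as [rm [rp [al [hpf [hw hdata]]]]].
  destruct (two_wave_structure c rm rp al hc hpf) as
    [s1 [s2 [t1 [t2 [rL [qL [rM [qM [rb [qb [[h12 [h23 h34]] [[pL [pM pb]] [zL [j1 [j2 [_ [_ [_ [_ [_ [r1 [r2 [r3 r4]]]]]]]]]]]]]]]]]]]]]]].
  exists s1, s2, t1, t2, rL, qL, rM, qM, rb, qb.
  split; [lra|]. split; [auto|]. split; [assumption|]. split; [assumption|].
  split; [|split].
  - apply (hdata (-1) _ (- s1)); [left; auto|]. intros x hx. apply zL. lra.
  - apply (hdata 1 _ t2); [right; auto|]. intros x hx. apply r4. lra.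
  - intros x U w'.
    assert (hw' : forall y, w' y = (rp y, al y + y * rp y)).
    { intros y. destruct (Rlt_le_dec y s1) as [k1|k1].
      { unfold w'. rewrite two_wave_left by assumption. destruct (zL y k1) as [e1 e2]. rewrite e1, e2. f_equal; ring. }
      destruct (Rlt_le_dec y s2) as [k2|k2].
      { unfold w'. rewrite two_wave_slow by lra. destruct (r1 y (conj k1 k2)) as [e1 e2]. rewrite e1. unfold fan.
        replace (- (1) * (y - s1) / c) with (- (y - s1) / c) by (field; lra). rewrite <- e2. f_equal; ring. }
      destruct (Rlt_le_dec y t1) as [k3|k3].
      { unfold w'. rewrite two_wave_middle by lra. destruct (r2 y (conj k2 k3)) as [e1 e2]. rewrite e1, e2. f_equal; ring. }
      destruct (Rlt_le_dec y t2) as [k4|k4].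
      { unfold w'. rewrite two_wave_fast by lra. destruct (r3 y (conj k3 k4)) as [e1 e2]. rewrite e1. unfold fan.
        replace (- -1 * (y - t1) / c) with ((y - t1) / c) by (field; lra). rewrite <- e2. f_equal; ring. }
      unfold w'. rewrite two_wave_right by lra. destruct (r4 y k4) as [e1 e2]. rewrite e1, e2. f_equal; ring. }
    assert (hal : forall y, continuous al y) by apply (pf_alpha_cont _ _ _ _ hpf).
    destruct (hw x) as [wl wr].
    assert (hpair : forall (Fi : (R -> Prop) -> Prop) r, Filter Fi -> filterlim rp Fi (locally r) ->
       filterlim al Fi (locally (al x)) -> filterlim (fun y => y) Fi (locally x) ->
       filterlim w' Fi (locally (r, al x + x * r))).
    { intros Fi r hFi hr ha hx.
      apply (filterlim_ext (fun y => (rp y, al y + y * rp y))); [intros; symmetry; apply hw'|].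
      assert (hq : filterlim (fun y => al y + y * rp y) Fi (locally (al x + x * r))).
      { eapply filterlim_comp_2; [exact ha| |apply (filterlim_plus (V := R_NormedModule))].
        eapply filterlim_comp_2; [exact hx|exact hr|apply (filterlim_mult (K := R_AbsRing))]. }
      apply filterlim_locally. intros e. apply filter_and.
      - exact (proj1 (filterlim_locally _ _) hr e).
      - exact (proj1 (filterlim_locally _ _) hq e). }
    split; intros hU.
    + assert (hl : filterlim w' (at_left x) (locally (rm x, al x + x * rm x))).
      { apply hpair; [apply at_left_proper_filter|apply (pf_left _ _ _ _ hpf)| |].
        - apply continuous_at_left, hal.
        - apply (continuous_at_left (fun y => y)), continuous_id. }
      rewrite (filterlim_locally_unique (K := R_AbsRing) (V := prod_NormedModule R_AbsRing R_NormedModule R_NormedModule)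
             (F := at_left x) w _ _ hU wl). exact hl.
    + assert (hl : filterlim w' (at_right x) (locally (rp x, al x + x * rp x))).
      { apply hpair; [apply at_right_proper_filter|apply (pf_right _ _ _ _ hpf)| |].
        - apply continuous_at_right, hal.
        - apply (continuous_at_right (fun y => y)), continuous_id. }
      rewrite (filterlim_locally_unique (K := R_AbsRing) (V := prod_NormedModule R_AbsRing R_NormedModule R_NormedModule)
             (F := at_right x) w _ _ hU wr). exact hl.
Qed.

(** Reflection of the line exchanges the two families of waves. *)
Lemma two_wave_mirror (c s1 s2 t1 t2 rL qL rM qM rb qb x : R) :
  0 < c -> s1 <= s2 -> s2 <= t1 -> t1 <= t2 ->
  joined c 1 s1 s2 rL qL rM qM -> joined c (-1) t1 t2 rM qM rb qb ->
  x <> s1 -> x <> s2 -> x <> t1 -> x <> t2 ->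
  two_wave c (- t2) (- t1) (- s2) (- s1) rb (- qb) rM (- qM) rL (- qL) (- x) =
  mirror (two_wave c s1 s2 t1 t2 rL qL rM qM rb qb x).
Proof.
  intros hc h12 h23 h34 j1 j2 n1 n2 n3 n4.
  assert (hfan : forall s a a' r r', r' * exp (s * (- x - a') / c) = r * exp (- s * (x - a) / c) ->
     fan c (- s) a' r' (- x) = mirror (fan c s a r x)).
  { intros s a a' r r' h. unfold mirror, fan. simpl fst. simpl snd.
    replace (- - s * (- x - a') / c) with (s * (- x - a') / c) by (field; lra).
    rewrite h. f_equal. ring. }
  destruct (Rlt_le_dec x s1) as [k1|k1].
  { rewrite (two_wave_left c s1), (two_wave_right c (- t2)) by lra. reflexivity. }
  destruct (Rlt_le_dec x s2) as [k2|k2].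
  { rewrite (two_wave_slow c s1), (two_wave_fast c (- t2)) by lra.
    replace (-1) with (- (1)) by ring. apply hfan.
    destruct j1 as [[h _]|[_ [_ [_ h]]]]; [lra|]. rewrite h, Rmult_assoc, <- exp_plus. do 2 f_equal. field. lra. }
  destruct (Rlt_le_dec x t1) as [k3|k3].
  { rewrite !two_wave_middle by lra. reflexivity. }
  destruct (Rlt_le_dec x t2) as [k4|k4].
  { rewrite (two_wave_fast c s1), (two_wave_slow c (- t2)) by lra.
    replace 1 with (- -1) at 1 by ring. apply hfan.
    destruct j2 as [[h _]|[_ [_ [_ h]]]]; [lra|]. rewrite h, Rmult_assoc, <- exp_plus. do 2 f_equal. field. lra. }
  rewrite (two_wave_right c s1), (two_wave_left c (- t2)) by lra. reflexivity.
Qed.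

Lemma avoid_four (x a b d e : R) : exists r, 0 < r /\
  forall y, 0 < Rabs (y - x) < r -> y <> a /\ y <> b /\ y <> d /\ y <> e.
Proof.
  assert (h : forall z, exists r, 0 < r /\ forall y, 0 < Rabs (y - x) < r -> y <> z).
  { intros z. destruct (Req_dec z x) as [hz|hz].
    - exists 1. split; [lra|]. intros y hy hyz. subst y z. rewrite Rminus_diag, Rabs_R0 in hy. lra.
    - exists (Rabs (z - x)). split; [apply Rabs_pos_lt; lra|]. intros y hy hyz. subst y. lra. }
  destruct (h a) as [r1 [p1 k1]]. destruct (h b) as [r2 [p2 k2]].
  destruct (h d) as [r3 [p3 k3]]. destruct (h e) as [r4 [p4 k4]].
  pose proof (Rmin_l (Rmin r1 r2) (Rmin r3 r4)). pose proof (Rmin_r (Rmin r1 r2) (Rmin r3 r4)).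
  pose proof (Rmin_l r1 r2). pose proof (Rmin_r r1 r2). pose proof (Rmin_l r3 r4). pose proof (Rmin_r r3 r4).
  exists (Rmin (Rmin r1 r2) (Rmin r3 r4)). split; [repeat apply Rmin_pos; assumption|].
  intros y hy. repeat split; [apply k1|apply k2|apply k3|apply k4]; lra.
Qed.

(** It is enough to reflect two-wave fields, for which the entropy solution is known
    explicitly; no change of variables in the weak form is needed. *)
Lemma mirror_solution (c : R) (Ua Ub : R * R) (w : R -> R * R) :
  0 < c -> riemann_solution c Ua Ub w ->
  exists w', riemann_solution c (mirror Ub) (mirror Ua) w' /\
    forall x U,
      (filterlim w (at_left x) (locally U) -> filterlim w' (at_right (- x)) (locally (mirror U))) /\
      (filterlim w (at_right x) (locally U) -> filterlim w' (at_left (- x)) (locally (mirror U))).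
Proof.
  intros hc hsol.
  destruct (two_waves_of_solution c _ _ _ hc hsol) as
    [s1 [s2 [t1 [t2 [rL [qL [rM [qM [rb [qb [[h12 [h23 h34]] [[pL [pM pb]] [j1 [j2 [ha [hb h]]]]]]]]]]]]]]]].
  subst Ua Ub.
  exists (two_wave c (- t2) (- t1) (- s2) (- s1) rb (- qb) rM (- qM) rL (- qL)). split.
  { apply two_wave_solution; try assumption; try lra.
    - apply (joined_reflect c (-1)); try assumption. ring.
    - apply (joined_reflect c 1); try assumption. ring. }
  intros x U. destruct (h x U) as [hl hr].
  destruct (avoid_four x s1 s2 t1 t2) as [r [hr0 havoid]].
  (* Near [- x] but not at it, the reflected field is the mirror image. *)
  assert (heq : forall y, 0 < Rabs (y - - x) < r ->
     mirror (two_wave c s1 s2 t1 t2 rL qL rM qM rb qb (- y)) =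
     two_wave c (- t2) (- t1) (- s2) (- s1) rb (- qb) rM (- qM) rL (- qL) y).
  { intros y hy. replace (y - - x) with (- (- y - x)) in hy by ring. rewrite Rabs_Ropp in hy.
    destruct (havoid (- y) hy) as [n1 [n2 [n3 n4]]].
    rewrite <- two_wave_mirror by assumption. f_equal. ring. }
  split; intros hU.
  - apply (right_limit_ext (fun y => mirror (two_wave c s1 s2 t1 t2 rL qL rM qM rb qb (- y))) _ (- x) r); [assumption| |].
    + intros y hy. apply heq. rewrite Rabs_pos_eq; lra.
    + eapply filterlim_comp; [|apply continuous_mirror].
      eapply filterlim_comp; [apply opp_at_right|]. rewrite Ropp_involutive. apply hl. assumption.
  - apply (left_limit_ext (fun y => mirror (two_wave c s1 s2 t1 t2 rL qL rM qM rb qb (- y))) _ (- x) r); [assumption| |].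
    + intros y hy. apply heq. rewrite Rabs_left1; lra.
    + eapply filterlim_comp; [|apply continuous_mirror].
      eapply filterlim_comp; [apply opp_at_left|]. rewrite Ropp_involutive. apply hr. assumption.
Qed.

Lemma V_plus_mirror (c r0 a0 v rho alpha : R) : 0 < c ->
  V_plus c r0 a0 v (rho, alpha) <-> V_minus c r0 (- a0) (- v) (rho, - alpha).
Proof.
  intros hc.
  assert (hm : forall r a, mirror (r, a + v * r) = (r, - a + - v * r)).
  { intros r a. unfold mirror. simpl. f_equal. ring. }
  split.
  - intros [r [q [[Ua [w [hUa [hsol hlim]]]] heq]]]. injection heq as hr ha.
    destruct (mirror_solution c _ _ w hc hsol) as [w' [hsol' hw']].
    exists r, (- q). split; [|f_equal; [assumption|rewrite ha; ring]].
    exists (mirror Ua), w'. split; [exact hUa|]. split; [rewrite <- hm; exact hsol'|].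
    apply (proj2 (hw' v (r, q))). exact hlim.
  - intros [r [q [[Ub [w [hUb [hsol hlim]]]] heq]]]. injection heq as hr ha.
    destruct (mirror_solution c _ _ w hc hsol) as [w' [hsol' hw']].
    exists r, (- q). split; [|f_equal; [assumption|lra]].
    exists (mirror Ub), w'. split; [exact hUb|]. split.
    + replace (r0, a0 + v * r0) with (mirror (r0, - a0 + - v * r0)); [exact hsol'|].
      unfold mirror. simpl. f_equal. ring.
    + rewrite <- (Ropp_involutive v). apply (proj1 (hw' (- v) (r, q))). exact hlim.
Qed.

Lemma V_plus_iff (c r0 a0 v rho alpha : R) :
  0 < c -> 0 < r0 -> V_plus c r0 a0 v (rho, alpha) <-> accessible c r0 (- a0) rho (- alpha).
Proof.
  intros hc h0. rewrite V_plus_mirror by assumption. apply V_minus_iff; assumption.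
Qed.

(** * The potential [F] *)

Definition clamp (a b x : R) : R := Rmax a (Rmin x b).

Lemma clamp_in (a b x : R) : a <= b -> a <= clamp a b x <= b.
Proof.
  intros h. unfold clamp. split; [apply Rmax_l|]. apply Rmax_lub; [assumption|apply Rmin_r].
Qed.

Lemma clamp_id (a b x : R) : a <= x <= b -> clamp a b x = x.
Proof. intros h. unfold clamp. rewrite Rmin_left, Rmax_right by lra. reflexivity. Qed.

Lemma continuous_clamp (a b x : R) : continuous (clamp a b) x.
Proof. unfold clamp. cont. Qed.

(** The theorem for globally continuous functions, applied to [f] composed with the
    projection onto the segment. *)
Lemma IVT_on (f : R -> R) (a b y : R) :
  a <= b -> (forall x, a <= x <= b -> continuous f x) ->
  Rmin (f a) (f b) <= y <= Rmax (f a) (f b) -> exists x, a <= x <= b /\ f x = y.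
Proof.
  intros hab hf hy.
  destruct (IVT_gen (fun x => f (clamp a b x)) a b y) as [x [hx1 hx2]].
  - intros x. apply continuity_pt_filterlim. apply (continuous_comp (clamp a b) f).
    + apply continuous_clamp.
    + apply hf. apply clamp_in. assumption.
  - rewrite !clamp_id by lra. assumption.
  - exists (clamp a b x). split; [apply clamp_in; assumption|assumption].
Qed.

Section Potential.
Variables (c : R) (D : R -> R -> R).
Hypothesis hc : 0 < c.
Hypothesis hD : drag_force D.

Lemma drag_abs_pos (r a : R) : 0 < r -> a <> 0 -> 0 < Rabs (D r a).
Proof.
  intros hr ha. apply Rabs_pos_lt.
  destruct (Rtotal_order a 0) as [h|[h|h]].
  - pose proof (drag_neg D hD r a hr h). lra.
  - contradiction.
  - pose proof (drag_pos D hD r a hr h). lra.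
Qed.

Lemma drag_continuous (r a : R) : 0 < r -> continuous (fun p : R * R => D (fst p) (snd p)) (r, a).
Proof.
  intros hr. destruct (drag_C1 D hD) as [f1 [f2 h]].
  apply (differentiable_continuous D r a (f1 r a) (f2 r a)).
  apply C1_differentiable; try (apply h; assumption).
  exists (mkposreal r hr). intros [r' a'] [h1 _]. simpl in *.
  apply h. change (Rabs (r' - r) < r) in h1. apply Rabs_def2 in h1. lra.
Qed.

Definition slope (a r : R) : R := 1 / Rabs (D r a) * (c ^ 2 - a ^ 2 / r ^ 2).

Lemma slope_continuous_2d (a r : R) : 0 < r -> a <> 0 ->
  continuous (fun p : R * R => slope (fst p) (snd p)) (a, r).
Proof.
  intros hr ha. unfold slope.
  assert (h : continuous (fun p : R * R => D (snd p) (fst p)) (a, r)).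
  { apply (continuous_comp_2 (fun p : R * R => snd p) (fun p : R * R => fst p) D); [cont|cont|].
    apply drag_continuous. assumption. }
  pose proof (drag_abs_pos r a hr ha).
  apply cont_mult.
  - apply cont_div; [cont|apply cont_abs; exact h|simpl; lra].
  - apply cont_minus; [cont|]. apply cont_div; [cont|cont|]. apply pow_nonzero. simpl. lra.
Qed.

Lemma slope_continuous (a r : R) : 0 < r -> a <> 0 -> continuous (slope a) r.
Proof.
  intros hr ha. apply (continuous_comp_2 (fun _ => a) (fun y => y) slope); [cont|cont|].
  apply slope_continuous_2d; assumption.
Qed.

Lemma ex_RInt_slope (a r s : R) : a <> 0 -> 0 < r -> 0 < s -> ex_RInt (slope a) r s.
Proof.
  intros ha hr hs. apply (ex_RInt_continuous (V := R_CompleteNormedModule)). intros x hx.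
  apply slope_continuous; [|assumption]. unfold Rmin in hx. destruct (Rle_dec r s); lra.
Qed.

Variable a : R.
Hypothesis ha : 0 < a.

Let sonic_pos : 0 < a / c.
Proof. apply Rdiv_lt_0_compat; assumption. Qed.

Lemma F_slope (r s : R) : 0 < r -> 0 < s -> F c D a s - F c D a r = RInt (slope a) r s.
Proof.
  intros hr hs. unfold F. fold (slope a). rewrite (Rabs_pos_eq a) by lra.
  rewrite (RInt_split (slope a) (a / c) r s) by (apply ex_RInt_slope; lra). eqR. ring.
Qed.

Lemma F_sonic : F c D a (a / c) = 0.
Proof. unfold F. rewrite (Rabs_pos_eq a) by lra. rewrite RInt_point. reflexivity. Qed.

Lemma F_derive (r : R) : 0 < r -> is_derive (F c D a) r (slope a r).
Proof.
  intros hr. unfold F. fold (slope a). rewrite (Rabs_pos_eq a) by lra.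
  apply (is_derive_RInt (slope a) (fun s => RInt (slope a) (a / c) s) (a / c)).
  - exists (mkposreal r hr). intros s hs. change (Rabs (s - r) < r) in hs. apply Rabs_def2 in hs.
    apply (RInt_correct (V := R_CompleteNormedModule)). apply ex_RInt_slope; lra.
  - apply slope_continuous; lra.
Qed.

Lemma F_continuous (r : R) : 0 < r -> continuous (F c D a) r.
Proof.
  intros hr. apply (ex_derive_continuous (V := R_NormedModule)). eexists. apply F_derive. assumption.
Qed.

(** Shows the sign of the slope, hence that [F] decreases up to the sonic density
    [a / c] and increases beyond it. *)
Lemma slope_factor (r : R) : 0 < r ->
  slope a r = (c * r - a) * ((c * r + a) / r ^ 2 / Rabs (D r a)).
Proof.
  intros hr. pose proof (drag_abs_pos r a hr ltac:(lra)). unfold slope. field. lra.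
Qed.

Let factor_pos (r : R) : 0 < r -> 0 < (c * r + a) / r ^ 2 / Rabs (D r a).
Proof.
  intros hr. pose proof (drag_abs_pos r a hr ltac:(lra)).
  assert (0 < c * r) by (apply Rmult_lt_0_compat; assumption).
  apply Rdiv_lt_0_compat; [|assumption]. apply Rdiv_lt_0_compat; [lra|apply pow_lt; assumption].
Qed.

Lemma slope_pos (r : R) : a / c < r -> 0 < slope a r.
Proof.
  intros hr. rewrite slope_factor by lra. apply Rmult_lt_0_compat; [|apply factor_pos; lra].
  apply Rlt_div_l in hr; lra.
Qed.

Lemma F_incr (r s : R) : a / c <= r -> r < s -> F c D a r < F c D a s.
Proof.
  intros hr hs. enough (0 < F c D a s - F c D a r) by lra. rewrite F_slope by lra.
  apply RInt_gt_0; [assumption| |].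
  - intros x hx. apply slope_pos. lra.
  - intros x hx. apply slope_continuous; lra.
Qed.

Lemma F_decr (r s : R) : 0 < r -> r < s -> s <= a / c -> F c D a s < F c D a r.
Proof.
  intros hr hs h. enough (0 < - (F c D a s - F c D a r)) by lra. rewrite F_slope by lra.
  replace (- RInt (slope a) r s) with (RInt (fun x => -1 * slope a x) r s)
    by (rewrite RInt_scal_R by (apply ex_RInt_slope; lra); eqR; ring).
  apply RInt_gt_0; [assumption| |].
  - intros x hx. rewrite slope_factor by lra. pose proof (factor_pos x ltac:(lra)).
    assert (c * x < a). { apply Rlt_le_trans with (c * (a / c)); [apply Rmult_lt_compat_l; lra|apply Req_le; field; lra]. }
    nra.
  - intros x hx. apply cont_mult; [cont|apply slope_continuous; lra].
Qed.

Lemma F_ge0 (r : R) : 0 < r -> 0 <= F c D a r.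
Proof.
  intros hr. rewrite <- F_sonic. destruct (Rtotal_order r (a / c)) as [h|[h|h]].
  - left. apply F_decr; lra.
  - rewrite h. lra.
  - left. apply F_incr; lra.
Qed.

Lemma F_incr_inv (r s : R) : a / c <= r -> a / c <= s -> F c D a r < F c D a s -> r < s.
Proof.
  intros hr hs h. apply Rnot_le_lt. intros hle. destruct hle as [hle|hle].
  - pose proof (F_incr s r hs hle). lra.
  - subst s. lra.
Qed.

Lemma F_decr_inv (r s : R) : 0 < r -> 0 < s -> r <= a / c -> s <= a / c -> F c D a r <= F c D a s -> s <= r.
Proof.
  intros hr hs h1 h2 h. apply Rnot_lt_le. intros hlt. pose proof (F_decr r s hr hlt h2). lra.
Qed.

Lemma conj_pos (r : R) : 0 < r -> 0 < conj_density c a r.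
Proof.
  intros hr. apply Rdiv_lt_0_compat; [apply pow_lt; assumption|].
  apply Rmult_lt_0_compat; [apply pow_lt|]; assumption.
Qed.

Lemma conj_sonic : conj_density c a (a / c) = a / c.
Proof. unfold conj_density. field. lra. Qed.

Lemma conj_ge (r : R) : 0 < r -> r <= a / c -> a / c <= conj_density c a r.
Proof.
  intros hr h. unfold conj_density.
  assert (hk : 0 < c ^ 2 * r) by (apply Rmult_lt_0_compat; [apply pow_lt|]; assumption).
  apply (proj1 (Rle_div_r (a / c) (a ^ 2) (c ^ 2 * r) hk)).
  replace (a / c * (c ^ 2 * r)) with (a * (c * r)) by (field; lra).
  apply Rle_div_r in h; [|assumption]. nra.
Qed.

Lemma conj_gt (r : R) : 0 < r -> r < a / c -> a / c < conj_density c a r.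
Proof.
  intros hr h. unfold conj_density.
  assert (hk : 0 < c ^ 2 * r) by (apply Rmult_lt_0_compat; [apply pow_lt|]; assumption).
  apply (proj1 (Rlt_div_r (a / c) (a ^ 2) (c ^ 2 * r) hk)).
  replace (a / c * (c ^ 2 * r)) with (a * (c * r)) by (field; lra).
  apply Rlt_div_r in h; [|assumption]. nra.
Qed.

Lemma conj_derive (r : R) : 0 < r -> is_derive (conj_density c a) r (- (a ^ 2 / (c ^ 2 * r ^ 2))).
Proof.
  intros hr. unfold conj_density. auto_derive.
  - assert (0 < c ^ 2) by (apply pow_lt; assumption). simpl in H. apply Rmult_integral_contrapositive_currified; lra.
  - field. lra.
Qed.

Lemma conj_continuous (r : R) : 0 < r -> continuous (conj_density c a) r.
Proof.
  intros hr. apply (ex_derive_continuous (V := R_NormedModule)). eexists. apply conj_derive. assumption.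
Qed.

(** A shock moved downstream inside the particle: since [|D|] decreases with
    the density, the variation of [F] behind the shock exceeds that ahead of
    it. *)
Lemma F_conj_gap (r s : R) : 0 < r -> r <= s -> s <= a / c ->
  F c D a r - F c D a s <= F c D a (conj_density c a r) - F c D a (conj_density c a s).
Proof.
  intros hr hrs hs.
  enough (F c D a r - F c D a (conj_density c a r) <= F c D a s - F c D a (conj_density c a s)) by lra.
  apply (is_derive_ge0_le (fun x => F c D a x - F c D a (conj_density c a x))
    (fun x => slope a x - - (a ^ 2 / (c ^ 2 * x ^ 2)) * slope a (conj_density c a x))); [assumption| |].
  - intros x hx. apply (is_derive_minus (V := R_NormedModule)); [apply F_derive; lra|].
    apply (is_derive_comp (F c D a) (conj_density c a)).
    + apply F_derive, conj_pos. lra.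
    + apply conj_derive. lra.
  - intros x hx.
    assert (hxc : x <= conj_density c a x) by (pose proof (conj_ge x ltac:(lra) ltac:(lra)); lra).
    pose proof (drag_abs_decr D hD x (conj_density c a x) a ltac:(lra) hxc) as hdec.
    pose proof (drag_abs_pos (conj_density c a x) a (conj_pos x ltac:(lra)) ltac:(lra)) as hp.
    pose proof (drag_abs_pos x a ltac:(lra) ltac:(lra)) as hp'.
    assert (hfac : a ^ 2 / (c ^ 2 * x ^ 2) * (c ^ 2 - a ^ 2 / (conj_density c a x) ^ 2) = a ^ 2 / x ^ 2 - c ^ 2).
    { unfold conj_density. field. lra. }
    unfold slope.
    replace (1 / Rabs (D x a) * (c ^ 2 - a ^ 2 / x ^ 2) - - (a ^ 2 / (c ^ 2 * x ^ 2)) *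
       (1 / Rabs (D (conj_density c a x) a) * (c ^ 2 - a ^ 2 / (conj_density c a x) ^ 2)))
      with ((1 / Rabs (D (conj_density c a x) a) - 1 / Rabs (D x a)) * (a ^ 2 / x ^ 2 - c ^ 2))
      by (replace (c ^ 2 - a ^ 2 / x ^ 2) with (- (a ^ 2 / x ^ 2 - c ^ 2)) by ring; rewrite <- hfac; ring).
    apply Rmult_le_pos.
    + unfold Rdiv. rewrite !Rmult_1_l.
      pose proof (Rinv_le_contravar _ _ hp hdec). lra.
    + apply Rle_minus_r. rewrite Rplus_0_l. apply (proj1 (Rle_div_r (c ^ 2) (a ^ 2) (x ^ 2) (pow_lt x 2 ltac:(lra)))).
      assert (c * x <= a). { apply Rle_trans with (c * (a / c)); [apply Rmult_le_compat_l; lra|apply Req_le; field; lra]. }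
      assert (0 < c * x) by (apply Rmult_lt_0_compat; lra).
      replace (c ^ 2 * x ^ 2) with ((c * x) ^ 2) by ring. nra.
Qed.

End Potential.

(** The slope of [F] increases when the mass flux decreases. *)
Lemma F_gap_decr (c : R) (D : R -> R -> R) (a1 a2 p1 p2 q1 q2 : R) :
  0 < c -> drag_force D -> 0 < a1 -> a1 < a2 ->
  a1 / c <= q1 -> q1 <= q2 -> a2 / c <= q2 -> q2 < p2 -> p2 <= p1 ->
  F c D a2 p2 - F c D a2 q2 < F c D a1 p1 - F c D a1 q1.
Proof.
  intros hc hD h0 h12 hq1 hq hq2 hqp hp.
  assert (s1 : 0 < a1 / c) by (apply Rdiv_lt_0_compat; lra).
  assert (s2 : 0 < a2 / c) by (apply Rdiv_lt_0_compat; lra).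
  assert (m1 : F c D a1 p2 <= F c D a1 p1).
  { destruct hp as [hp|hp]; [left; apply F_incr; try assumption; lra|rewrite hp; lra]. }
  assert (m2 : F c D a1 q1 <= F c D a1 q2).
  { destruct hq as [hq|hq]; [left; apply F_incr; assumption|rewrite hq; lra]. }
  enough (F c D a2 p2 - F c D a2 q2 < F c D a1 p2 - F c D a1 q2) by lra.
  rewrite !F_slope by (try assumption; lra).
  apply RInt_lt; [assumption| | |].
  - intros x hx. apply slope_continuous; try assumption; lra.
  - intros x hx. apply slope_continuous; try assumption; lra.
  - intros x hx. unfold slope.
    assert (hx0 : 0 < x) by lra.
    pose proof (drag_pos D hD x a1 hx0 h0). pose proof (drag_incr D hD x a1 a2 hx0 ltac:(lra)).
    rewrite !Rabs_pos_eq by lra.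
    assert (i1 : 0 < 1 / D x a2) by (apply Rdiv_lt_0_compat; lra).
    assert (i2 : 1 / D x a2 <= 1 / D x a1).
    { unfold Rdiv. rewrite !Rmult_1_l. apply Rinv_le_contravar; lra. }
    assert (k1 : 0 <= c ^ 2 - a2 ^ 2 / x ^ 2).
    { apply Rle_minus_r. rewrite Rplus_0_l. apply (proj2 (Rle_div_l (a2 ^ 2) (c ^ 2) (x ^ 2) (pow_lt x 2 hx0))).
      assert (a2 <= c * x). { apply Rle_trans with (c * (a2 / c)); [apply Req_le; field; lra|apply Rmult_le_compat_l; lra]. }
      replace (c ^ 2 * x ^ 2) with ((c * x) ^ 2) by ring. nra. }
    assert (k2 : a1 ^ 2 / x ^ 2 < a2 ^ 2 / x ^ 2).
    { apply Rmult_lt_compat_r; [apply Rinv_0_lt_compat, pow_lt; assumption|nra]. }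
    apply Rle_lt_trans with (1 / D x a1 * (c ^ 2 - a2 ^ 2 / x ^ 2)).
    + apply Rmult_le_compat_r; assumption.
    + apply Rmult_lt_compat_l; lra.
Qed.

(** Rescaling the interval of integration to [[0, 1]] makes the gap of [F]
    depend continuously on its three arguments. *)
Lemma continuous_F_gap (c : R) (D : R -> R -> R) (A P Q : R -> R) (t0 : R) :
  0 < c -> drag_force D ->
  (forall t, continuous A t) -> (forall t, continuous P t) -> (forall t, continuous Q t) ->
  (forall t, 0 < A t /\ 0 < P t /\ 0 < Q t) ->
  continuous (fun t => F c D (A t) (P t) - F c D (A t) (Q t)) t0.
Proof.
  intros hc hD hA hP hQ hpos.
  set (h := fun t s => (P t - Q t) * slope c D (A t) ((P t - Q t) * clamp 0 1 s + Q t)).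
  assert (hin : forall t s, 0 < (P t - Q t) * clamp 0 1 s + Q t).
  { intros t s. pose proof (clamp_in 0 1 s ltac:(lra)) as hs. destruct (hpos t) as [_ [h1 h2]].
    replace ((P t - Q t) * clamp 0 1 s + Q t) with (P t * clamp 0 1 s + Q t * (1 - clamp 0 1 s)) by ring.
    destruct (proj1 hs) as [k|k].
    - apply Rplus_lt_le_0_compat; [apply Rmult_lt_0_compat|apply Rmult_le_pos]; lra.
    - rewrite <- k. lra. }
  assert (hcont : forall t s, continuous (fun p : R * R => h (fst p) (snd p)) (t, s)).
  { intros t s.
    assert (c1 : forall B : R -> R, (forall t, continuous B t) -> continuous (fun p : R * R => B (fst p)) (t, s)).
    { intros B hB. apply (continuous_comp (fun p : R * R => fst p) B); [cont|apply hB]. }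
    assert (c2 : continuous (fun p : R * R => clamp 0 1 (snd p)) (t, s)).
    { apply (continuous_comp (fun p : R * R => snd p) (clamp 0 1)); [cont|apply continuous_clamp]. }
    pose proof (c1 P hP). pose proof (c1 Q hQ). pose proof (c1 A hA).
    unfold h. apply cont_mult; [cont|].
    apply (continuous_comp_2 (fun p : R * R => A (fst p))
      (fun p : R * R => (P (fst p) - Q (fst p)) * clamp 0 1 (snd p) + Q (fst p)) (slope c D)); [cont|cont|].
    apply slope_continuous_2d; [assumption|apply hin|]. destruct (hpos t). simpl. lra. }
  apply (continuous_ext (fun t => RInt (fun s => 1 * h t s) 0 1)).
  - intros t. destruct (hpos t) as [h0 [h1 h2]].
    rewrite F_slope by assumption.
    rewrite (RInt_ext _ (fun s => (P t - Q t) * slope c D (A t) ((P t - Q t) * s + Q t))).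
    2:{ intros s. rewrite Rmin_left, Rmax_right by lra. intros hs. unfold h. rewrite clamp_id by lra.
        rewrite Rmult_1_l. reflexivity. }
    assert (hex : ex_RInt (slope c D (A t)) ((P t - Q t) * 0 + Q t) ((P t - Q t) * 1 + Q t)).
    { apply ex_RInt_slope; try assumption; lra. }
    assert (hcl : RInt (fun s => (P t - Q t) * slope c D (A t) ((P t - Q t) * s + Q t)) 0 1
      = RInt (slope c D (A t)) ((P t - Q t) * 0 + Q t) ((P t - Q t) * 1 + Q t))
      by exact (RInt_comp_lin (slope c D (A t)) (P t - Q t) (Q t) 0 1 hex).
    rewrite hcl. f_equal; ring.
  - apply (continuous_RInt_weight (fun _ => 1) 1 0 1); [lra| | |exact hcont].
    + apply regulated_continuous. intros; cont.
    + intros x. rewrite Rabs_R1. lra.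
Qed.

(** * Coupling by the particle *)

(** Two states coupled by the particle carry the same mass flux [a] in its frame,
    so that the germ is a condition on three numbers. *)
Definition germ_cases (c : R) (D : R -> R -> R) (a r1 r2 : R) : Prop :=
  (a = 0 /\ r1 = r2)
  \/
  (0 < a /\ 0 <= (a / c - r2) * (a / c - r1) /\ F c D a r1 - F c D a r2 = 1)
  \/
  (a < 0 /\ 0 <= (Rabs a / c - r2) * (Rabs a / c - r1) /\ F c D a r2 - F c D a r1 = 1)
  \/
  (c * r1 < a /\ a / c <= r2 /\
   exists rho theta : R,
     r1 <= rho < a / c /\ 0 <= theta <= 1 /\
     F c D a r1 - F c D a rho = theta /\
     F c D a (a ^ 2 / (c ^ 2 * rho)) - F c D a r2 = 1 - theta)
  \/
  (a < - c * r2 /\ Rabs a / c <= r1 /\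
   exists rho theta : R,
     r2 <= rho < Rabs a / c /\ 0 <= theta <= 1 /\
     F c D a r2 - F c D a rho = theta /\
     F c D a (a ^ 2 / (c ^ 2 * rho)) - F c D a r1 = 1 - theta).

Lemma germ_unshift (c : R) (D : R -> R -> R) (v r1 a1 r2 a2 : R) :
  germ c D v (unshift v (r1, a1)) (unshift v (r2, a2)) <->
  0 < r1 /\ 0 < r2 /\ a1 = a2 /\ germ_cases c D a1 r1 r2.
Proof.
  unfold germ, unshift, germ_cases. simpl fst. simpl snd. cbv zeta.
  replace (a1 + v * r1 - v * r1) with a1 by ring.
  replace (a2 + v * r2 - v * r2) with a2 by ring.
  split; intros [h1 [h2 [h3 h4]]]; (split; [assumption|]; split; [assumption|]; split; [assumption|]);
  (destruct h4 as [h4|h4]; [left|right; exact h4]).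
  - tauto.
  - destruct h4 as [h4 h5]. subst. auto.
Qed.

(** By [V_minus_iff], [V_plus_iff] and [germ_unshift], the pairs looked for. *)
Definition coupled (c : R) (D : R -> R -> R) (rL aL rR aR r1 r2 a : R) : Prop :=
  accessible c rL aL r1 a /\ accessible c rR (- aR) r2 (- a) /\ germ_cases c D a r1 r2.

Lemma phi_level (c r0 a0 k : R) : 0 < c -> 0 < r0 -> exists r, 0 < r /\ phi c r0 a0 r = k.
Proof.
  intros hc h0.
  destruct (riemann_middle_density c r0 (a0 / r0 - k) r0 (- (a0 / r0 - k)) hc h0 h0) as [r [hr h]].
  exists r. split; [assumption|]. rewrite Ropp_involutive in h. unfold phi. unfold wave_velocity in *. lra.
Qed.

(** The conjugate of a supersonic left state is reached along the slow curve by a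
    stationary shock, which conserves the flux. *)
Lemma phi_conj (c r0 a0 : R) : 0 < c -> 0 < r0 -> c * r0 < a0 ->
  conj_density c a0 r0 * phi c r0 a0 (conj_density c a0 r0) = a0.
Proof.
  intros hc h0 h. assert (hcr : 0 < c * r0) by (apply Rmult_lt_0_compat; assumption).
  assert (hm : 1 < a0 / (c * r0)) by (apply (proj1 (Rlt_div_r 1 a0 (c * r0) hcr)); lra).
  assert (hr : conj_density c a0 r0 / r0 = (a0 / (c * r0)) ^ 2) by (unfold conj_density; field; lra).
  unfold phi, wave_velocity. rewrite hug_shock by (rewrite hr; nra).
  rewrite hr, sqrt_pow2 by lra. unfold conj_density. field. lra.
Qed.

Section Positive.
Variables (c : R) (D : R -> R -> R) (rL aL rR aR : R).
Hypothesis hc : 0 < c.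
Hypothesis hD : drag_force D.
Hypothesis hrL : 0 < rL.
Hypothesis hrR : 0 < rR.

(** Velocities along the slow curve of the left state, and along the backward
    fast curve of the right state. *)
Let f (r : R) : R := phi c rL aL r.
Let g (r : R) : R := - phi c rR (- aR) r.

(** The mass flux along the fast curve, continued by sonic states. *)
Let flux (r : R) : R := r * Rmin (g r) c.

Lemma slow_decr (r s : R) : 0 < r < s -> f s < f r.
Proof. intros h. apply wave_velocity_decr; assumption. Qed.

Lemma fast_incr (r s : R) : 0 < r < s -> g r < g s.
Proof. intros h. apply Ropp_lt_contravar. apply wave_velocity_decr; assumption. Qed.

Lemma slow_flux_decr (r s : R) : 0 < r < s -> f r <= c -> s * f s < r * f r.
Proof. intros h. apply wave_flux_decr; assumption. Qed.

Lemma flux_incr (r s : R) : 0 < r < s -> 0 < flux r -> flux r < flux s.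
Proof.
  intros h hr. unfold flux in *.
  assert (hm : 0 < Rmin (g r) c) by (apply Rmult_lt_reg_l with r; lra).
  assert (hm2 : Rmin (g r) c <= Rmin (g s) c) by (apply Rle_min_compat_r; left; apply fast_incr; assumption).
  nra.
Qed.

Lemma flux_incr_inv (r s : R) : 0 < r -> 0 < s -> 0 < flux r -> 0 < flux s -> flux r < flux s -> r < s.
Proof.
  intros hr hs h1 h2 h. apply Rnot_le_lt. intros [hle|hle]; [|subst; lra].
  pose proof (flux_incr s r ltac:(lra) h2). lra.
Qed.

Lemma flux_inj (r s : R) : 0 < r -> 0 < s -> 0 < flux r -> flux r = flux s -> r = s.
Proof.
  intros hr hs h1 h. destruct (Rtotal_order r s) as [k|[k|k]]; [|assumption|].
  - pose proof (flux_incr r s ltac:(lra) h1). lra.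
  - pose proof (flux_incr s r ltac:(lra) ltac:(lra)). lra.
Qed.

Lemma flux_le_sonic (r : R) : 0 < r -> flux r <= c * r.
Proof.
  intros hr. unfold flux. rewrite Rmult_comm. apply Rmult_le_compat_r; [lra|apply Rmin_r].
Qed.

Lemma sonic_le (a r : R) : a <= c * r -> a / c <= r.
Proof. intros h. apply (proj2 (Rle_div_l a r c hc)). lra. Qed.

Lemma minus_cases (r a : R) : 0 < a -> accessible c rL aL r a ->
  (c * r < a /\ r = rL /\ a = aL) \/
  (a = r * f r /\ f r <= c /\ (c * rL < aL -> conj_density c aL rL < r)).
Proof.
  intros ha [hr [h|[[h1 [h2 h3]]|[h _]]]]; [left; assumption| |].
  - right. split; [|split; assumption]. fold (f r) in h1. rewrite h1. f_equal.
    unfold Rmax in *. destruct (Rle_dec (f r) (- c)); [|reflexivity]. exfalso. nra.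
  - exfalso. nra.
Qed.

Lemma minus_sub (r a : R) : 0 < r -> 0 < a -> a = r * f r -> f r <= c ->
  (c * rL < aL -> conj_density c aL rL < r) -> accessible c rL aL r a.
Proof.
  intros hr ha h1 h2 h3. split; [assumption|]. right. left. split; [|split; assumption].
  fold (f r). rewrite Rmax_left; [assumption|]. assert (0 < f r) by (apply Rmult_lt_reg_l with r; lra). lra.
Qed.

Lemma conj_opp (a r : R) : conj_density c (- a) r = conj_density c a r.
Proof. unfold conj_density. f_equal. ring. Qed.

(** Besides the subsonic and sonic branch, a trace may be supersonic, provided that
    all the waves then lie on the right of the particle. *)
Lemma plus_cases (r a : R) : 0 < a -> accessible c rR (- aR) r (- a) ->
  a = flux r \/ (c * r < a /\ a < flux (conj_density c a r)).
Proof.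
  intros ha [hr [[h _]|[[h1 [h2 h3]]|[h1 h2]]]].
  - exfalso. nra.
  - left. unfold flux, g. set (p := phi c rR (- aR) r) in *.
    assert (hm : Rmin (- p) c = - Rmax p (- c)).
    { unfold Rmin, Rmax. destruct (Rle_dec (- p) c), (Rle_dec p (- c)); lra. }
    rewrite hm. lra.
  - right. split; [lra|]. rewrite conj_opp in h2.
    assert (hlt : r < a / c) by (apply (proj1 (Rlt_div_r r a c hc)); lra).
    pose proof (conj_gt c hc a ha r hr hlt) as hq. set (q := conj_density c a r) in *.
    assert (a < c * q). { apply Rmult_lt_compat_l with (r := c) in hq; [|assumption]. replace (c * (a / c)) with a in hq by (field; lra). assumption. }
    unfold flux, g. unfold Rmin. destruct (Rle_dec (- phi c rR (- aR) q) c); lra.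
Qed.

Lemma plus_sub (r a : R) : 0 < r -> 0 < a -> a = flux r -> accessible c rR (- aR) r (- a).
Proof.
  intros hr ha h. split; [assumption|]. right. left. unfold flux, g in h.
  set (p := phi c rR (- aR) r) in *.
  assert (hm : Rmin (- p) c = - Rmax p (- c)).
  { unfold Rmin, Rmax. destruct (Rle_dec (- p) c), (Rle_dec p (- c)); lra. }
  assert (hpos : 0 < Rmin (- p) c) by (apply Rmult_lt_reg_l with r; lra).
  assert (hp : p < 0). { pose proof (Rmin_l (- p) c). lra. }
  split; [rewrite hm in h; lra|]. split; [lra|].
  (* behind its stationary shock the right state has negative velocity *)
  intros hsup. apply Rnot_le_lt. intros hle.
  pose proof (phi_conj c rR (- aR) hc hrR hsup) as hk.
  assert (hq : 0 < conj_density c (- aR) rR) by lra.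
  assert (0 < phi c rR (- aR) (conj_density c (- aR) rR)).
  { apply Rmult_lt_reg_l with (conj_density c (- aR) rR); [assumption|].
    rewrite hk. assert (0 < c * rR) by (apply Rmult_lt_0_compat; assumption). lra. }
  destruct hle as [hle|hle].
  - pose proof (wave_velocity_decr c rR (- aR / rR) r (conj_density c (- aR) rR) hc hrR ltac:(lra)) as hd.
    unfold p, phi in *. lra.
  - rewrite <- hle in H. unfold p in hp. lra.
Qed.

Lemma plus_super (r a : R) : 0 < r -> 0 < a -> c * r < a -> a < flux (conj_density c a r) ->
  accessible c rR (- aR) r (- a).
Proof.
  intros hr ha h1 h2. split; [assumption|]. right. right. split; [lra|]. rewrite conj_opp.
  pose proof (conj_pos c hc a ha r hr) as hq. set (q := conj_density c a r) in *.
  assert (flux q <= q * g q) by (apply Rmult_le_compat_l; [lra|apply Rmin_l]).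
  unfold g in H. lra.
Qed.

(** Every coupled pair with positive flux yields subsonic densities [p > q],
    by replacing supersonic traces by their images through a stationary
    shock; by [F_conj_gap] this can only increase the gap of [F]. *)
Lemma representative (r1 r2 a : R) : 0 < a -> coupled c D rL aL rR aR r1 r2 a ->
  exists p q, a / c <= p /\ a / c <= q /\ a = p * f p /\ f p <= c /\ a <= flux q /\
    1 <= F c D a p - F c D a q /\
    ((r1 = p /\ r2 = q /\ a = flux q /\ F c D a p - F c D a q = 1 /\
        (c * rL < aL -> conj_density c aL rL < p)) \/
     (r1 = rL /\ a = aL /\ c * rL < aL /\ p = conj_density c aL rL)).
Proof.
  intros ha [hm [hp hg]].
  assert (s0 : 0 < a / c) by (apply Rdiv_lt_0_compat; assumption).
  assert (sc : c * (a / c) = a) by (field; lra).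
  pose proof (proj1 hm) as hr1. pose proof (proj1 hp) as hr2.
  apply minus_cases in hm; [|assumption]. apply plus_cases in hp; [|assumption].
  destruct hm as [[h1 [h2 h3]]|[h1 [h2 h3]]].
  - (* the left trace is the left state itself *)
    subst r1. rewrite <- h3 in *.
    assert (hrLs : rL < a / c) by (apply (proj1 (Rlt_div_r rL a c hc)); lra).
    assert (hp0 : a / c <= conj_density c a rL) by (apply conj_ge; try assumption; lra).
    assert (hflux : conj_density c a rL * f (conj_density c a rL) = a).
    { unfold f. rewrite <- h3. apply phi_conj; assumption. }
    assert (hfc : f (conj_density c a rL) <= c).
    { apply Rmult_le_reg_l with (conj_density c a rL); [lra|]. rewrite hflux.
      apply Rle_trans with (c * (a / c)); [lra|]. rewrite Rmult_comm. apply Rmult_le_compat_r; lra. }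
    exists (conj_density c a rL).
    assert (hk : exists q, a / c <= q /\ a <= flux q /\ 1 <= F c D a (conj_density c a rL) - F c D a q).
    { destruct hg as [[h _]|[[_ [k1 k2]]|[[h _]|[[_ [k1 [rho [th [k2 [k3 [k4 k5]]]]]]]|[h _]]]]]; try (exfalso; nra).
      - assert (hr2s : r2 <= a / c) by nra.
        exists (conj_density c a r2). split; [apply conj_ge; assumption|]. split.
        + destruct hp as [hp|[_ hp]]; [|lra].
          pose proof (flux_le_sonic r2 hr2).
          assert (r2 = a / c) by (apply Rle_antisym; [assumption|apply sonic_le; lra]).
          rewrite H0, conj_sonic by assumption. rewrite <- H0. lra.
        + rewrite <- k2. apply F_conj_gap; try assumption.
          apply Rnot_lt_le. intros hlt. pose proof (F_decr c D hc hD a ha r2 rL hr2 hlt ltac:(lra)). lra.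
      - exists r2. split; [assumption|]. split.
        + destruct hp as [hp|[hp _]]; [lra|]. exfalso.
          assert (a <= c * r2) by (rewrite <- sc at 1; apply Rmult_le_compat_l; lra). lra.
        + pose proof (F_conj_gap c D hc hD a ha rL rho hrL ltac:(lra) ltac:(lra)) as hgap.
          unfold conj_density in hgap at 2. lra. }
    destruct hk as [q [k1 [k2 k3]]]. exists q. split; [assumption|]. split; [assumption|].
    split; [lra|]. split; [assumption|]. split; [assumption|]. split; [assumption|].
    right. split; [reflexivity|]. split; [reflexivity|]. split; [assumption|reflexivity].
  - assert (hr1s : a / c <= r1) by (apply sonic_le; rewrite h1; nra).
    assert (hr1c : a <= c * r1) by (rewrite h1; nra).
    destruct hg as [[h _]|[[_ [k1 k2]]|[[h _]|[[h _]|[h _]]]]]; try (exfalso; nra).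
    assert (hr2s : a / c <= r2).
    { apply Rnot_lt_le. intros hlt. assert (r1 = a / c) by nra. subst r1.
      rewrite F_sonic in k2 by assumption. pose proof (F_ge0 c D hc hD a ha r2 hr2). lra. }
    assert (hp' : a = flux r2).
    { destruct hp as [hp|[hp _]]; [assumption|]. exfalso.
      assert (a <= c * r2) by (rewrite <- sc at 1; apply Rmult_le_compat_l; lra). lra. }
    exists r1, r2. repeat (split; [first [assumption|lra]|]). left. auto.
Qed.

(** A positive flux forces the slow curve to vanish beyond the fast one. *)
Lemma positive_order (r1 r2 a zL zR : R) : 0 < a -> coupled c D rL aL rR aR r1 r2 a ->
  0 < zL -> 0 < zR -> f zL = 0 -> g zR = 0 -> zR < zL.
Proof.
  intros ha hcp hzL hzR fz gz.
  destruct (representative r1 r2 a ha hcp) as [p [q [h1 [h2 [h3 [h4 [h5 [h6 _]]]]]]]].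
  assert (s0 : 0 < a / c) by (apply Rdiv_lt_0_compat; assumption).
  assert (hqp : q < p) by (apply (F_incr_inv c D hc hD a ha); try assumption; lra).
  assert (hfp : 0 < f p) by (apply Rmult_lt_reg_l with p; lra).
  assert (hgq : 0 < g q).
  { assert (0 < Rmin (g q) c) by (apply Rmult_lt_reg_l with q; [lra|unfold flux in h5; lra]).
    pose proof (Rmin_l (g q) c). lra. }
  assert (p < zL).
  { apply Rnot_le_lt. intros [hle|hle]; [pose proof (slow_decr zL p ltac:(lra)); lra|subst; lra]. }
  assert (zR < q).
  { apply Rnot_le_lt. intros [hle|hle]; [pose proof (fast_incr q zR ltac:(lra)); lra|subst; lra]. }
  lra.
Qed.

(** A larger flux means larger densities at the exit and smaller ones at the entrance,
    by the monotonicity of the two wave curves, and a smaller slope of [F]: the gap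
    of [F] would be strictly smaller. A supersonic left state pins the flux at
    its own value, the largest possible one. *)
Lemma positive_flux_le (r1 r2 a r1' r2' a' : R) : 0 < a -> 0 < a' ->
  coupled c D rL aL rR aR r1 r2 a -> coupled c D rL aL rR aR r1' r2' a' -> ~ a < a'.
Proof.
  intros ha ha' h h' hlt.
  destruct (representative r1 r2 a ha h) as [p [q [h1 [h2 [h3 [h4 [h5 [h6 h7]]]]]]]].
  destruct (representative r1' r2' a' ha' h') as [p' [q' [k1 [k2 [k3 [k4 [k5 [k6 k7]]]]]]]].
  assert (s0 : 0 < a / c) by (apply Rdiv_lt_0_compat; assumption).
  assert (s0' : 0 < a' / c) by (apply Rdiv_lt_0_compat; assumption).
  assert (hbound : c * rL < aL -> a' <= aL).
  { intros hsup. destruct k7 as [[_ [_ [_ [_ k7]]]]|[_ [k7 _]]]; [|lra].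
    specialize (k7 hsup). rewrite k3, <- (phi_conj c rL aL hc hrL hsup).
    assert (hq0 : 0 < conj_density c aL rL).
    { apply conj_pos; try assumption. assert (0 < c * rL) by (apply Rmult_lt_0_compat; assumption). lra. }
    left. apply slow_flux_decr; [lra|].
    apply Rmult_le_reg_l with (conj_density c aL rL); [assumption|]. unfold f. rewrite phi_conj by assumption.
    assert (hge : aL / c <= conj_density c aL rL).
    { apply conj_ge; try assumption.
      - assert (0 < c * rL) by (apply Rmult_lt_0_compat; assumption). lra.
      - left. apply (proj1 (Rlt_div_r rL aL c hc)). lra. }
    apply (proj1 (Rle_div_l aL (conj_density c aL rL) c hc)) in hge. lra. }
  destruct h7 as [[_ [_ [h7 [h8 _]]]]|[_ [h7 [h8 _]]]]; [|specialize (hbound h8); lra].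
  assert (hqq : q < q') by (apply flux_incr_inv; lra).
  assert (hpp : p' < p).
  { apply Rnot_le_lt. intros [hle|hle].
    - pose proof (slow_flux_decr p p' ltac:(lra) h4). lra.
    - subst p'. lra. }
  assert (hqp' : q' < p') by (apply (F_incr_inv c D hc hD a' ha'); try assumption; lra).
  pose proof (F_gap_decr c D a a' p p' q q' hc hD ha hlt h2 ltac:(lra) k2 hqp' ltac:(lra)). lra.
Qed.

(** Equal fluxes leave a choice only when the left state, being supersonic, is its own
    trace; the two kinds of exit traces then exclude each other by
    [F_conj_gap]. *)
Lemma positive_unique (r1 r2 a r1' r2' a' : R) : 0 < a -> 0 < a' ->
  coupled c D rL aL rR aR r1 r2 a -> coupled c D rL aL rR aR r1' r2' a' ->
  r1 = r1' /\ r2 = r2' /\ a = a'.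
Proof.
  intros ha ha' h h'.
  assert (haa : a = a').
  { destruct (Rtotal_order a a') as [hl|[hl|hl]]; [|assumption|]; exfalso.
    - apply (positive_flux_le r1 r2 a r1' r2' a'); assumption.
    - apply (positive_flux_le r1' r2' a' r1 r2 a); assumption. }
  subst a'.
  assert (s0 : 0 < a / c) by (apply Rdiv_lt_0_compat; assumption).
  assert (sc : c * (a / c) = a) by (field; lra).
  destruct (representative r1 r2 a ha h) as [p [q [h1 [h2 [h3 [h4 [h5 [h6 h7]]]]]]]].
  destruct (representative r1' r2' a ha h') as [p' [q' [k1 [k2 [k3 [k4 [k5 [k6 k7]]]]]]]].
  assert (hpp : p = p').
  { destruct (Rtotal_order p p') as [hl|[hl|hl]]; [|assumption|]; exfalso.
    - pose proof (slow_flux_decr p p' ltac:(lra) h4). lra.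
    - pose proof (slow_flux_decr p' p ltac:(lra) k4). lra. }
  subst p'.
  destruct h7 as [[e1 [e2 [e3 [e4 e5]]]]|[e1 [e2 [e3 e4]]]];
  destruct k7 as [[i1 [i2 [i3 [i4 i5]]]]|[i1 [i2 [i3 i4]]]].
  - subst. split; [reflexivity|]. split; [|reflexivity]. apply flux_inj; lra.
  - specialize (e5 i3). lra.
  - specialize (i5 e3). lra.
  - (* both left traces are the left state *)
    split; [lra|]. split; [|reflexivity]. subst r1 r1'.
    destruct h as [_ [hp hg]]. destruct h' as [_ [hp' hg']].
    pose proof (proj1 hp) as hr. pose proof (proj1 hp') as hr'.
    apply plus_cases in hp; [|assumption]. apply plus_cases in hp'; [|assumption].
    assert (hrLs : rL < a / c) by (apply (proj1 (Rlt_div_r rL a c hc)); lra).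
    (* Either the flow stays supersonic, or it becomes subsonic at the exit,
       after a shock at density [rho] or, for [rho = a / c], continuously. *)
    assert (hkind : forall r, 0 < r -> (a = flux r \/ c * r < a /\ a < flux (conj_density c a r)) ->
      germ_cases c D a rL r ->
      (r < a / c /\ a < flux (conj_density c a r) /\ F c D a rL - F c D a r = 1) \/
      (a / c <= r /\ a = flux r /\
         exists rho, 0 < rho <= a / c /\ F c D a rL - F c D a rho <= 1 /\
           F c D a (conj_density c a rho) - F c D a r = 1 - (F c D a rL - F c D a rho))).
    { intros r hr0 hpl hgm.
      assert (hsub : a / c <= r -> a = flux r).
      { intros hle. destruct hpl as [hpl|[hpl _]]; [assumption|]. exfalso.
        assert (a <= c * r) by (rewrite <- sc at 1; apply Rmult_le_compat_l; lra). lra. }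
      destruct hgm as [[j _]|[[_ [j1 j2]]|[[j _]|[[_ [j1 [rho [th [j2 [j3 [j4 j5]]]]]]]|[j _]]]]]; try (exfalso; nra).
      - assert (hrs : r <= a / c) by nra. destruct hrs as [hrs|hrs].
        + left. split; [assumption|]. split; [|assumption].
          destruct hpl as [hpl|[_ hpl]]; [|assumption]. exfalso.
          pose proof (flux_le_sonic r hr0).  assert (c * r < a) by (rewrite <- sc; apply Rmult_lt_compat_l; lra). lra.
        + right. split; [lra|]. split; [apply hsub; lra|].
          exists r. split; [lra|]. split; [lra|]. rewrite hrs, conj_sonic by assumption. rewrite <- hrs. lra.
      - right. split; [assumption|]. split; [apply hsub; assumption|].
        exists rho. split; [lra|]. split; [lra|]. unfold conj_density. lra. }
    assert (hmix : forall r s, 0 < r -> 0 < s ->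
       r < a / c /\ a < flux (conj_density c a r) /\ F c D a rL - F c D a r = 1 ->
       a / c <= s /\ a = flux s /\
         (exists rho, 0 < rho <= a / c /\ F c D a rL - F c D a rho <= 1 /\
           F c D a (conj_density c a rho) - F c D a s = 1 - (F c D a rL - F c D a rho)) -> False).
    { intros r s hr0 hs0 [j1 [j2 j3]] [l1 [l2 [rho [l3 [l4 l5]]]]].
      assert (hrho : rho <= r) by (apply (F_decr_inv c D hc hD a ha); try assumption; lra).
      pose proof (F_conj_gap c D hc hD a ha rho r ltac:(lra) hrho ltac:(lra)) as hgap.
      assert (hq : a / c < conj_density c a r) by (apply conj_gt; assumption).
      assert (hsq : s < conj_density c a r) by (apply flux_incr_inv; lra).
      pose proof (F_incr c D hc hD a ha s (conj_density c a r) l1 hsq). lra. }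
    destruct (hkind r2 hr hp hg) as [m|m]; destruct (hkind r2' hr' hp' hg') as [m'|m'].
    + apply Rle_antisym; apply (F_decr_inv c D hc hD a ha); try assumption; lra.
    + exfalso. apply (hmix r2 r2'); assumption.
    + exfalso. apply (hmix r2' r2); assumption.
    + destruct m as [_ [m _]]. destruct m' as [_ [m' _]]. apply flux_inj; lra.
Qed.

(** A supersonic left trace: by continuity in the position of the shock
    inside the particle. *)
Lemma supersonic_exists (q0 : R) : c * rL < aL -> aL / c <= q0 -> flux q0 = aL ->
  1 <= F c D aL (conj_density c aL rL) - F c D aL q0 ->
  exists r2, coupled c D rL aL rR aR rL r2 aL.
Proof.
  intros hsup hq0 hfl hgap.
  assert (hcr : 0 < c * rL) by (apply Rmult_lt_0_compat; assumption).
  assert (ha : 0 < aL) by lra.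
  assert (s0 : 0 < aL / c) by (apply Rdiv_lt_0_compat; assumption).
  assert (sc : c * (aL / c) = aL) by (field; lra).
  assert (hrLs : rL < aL / c) by (apply (proj1 (Rlt_div_r rL aL c hc)); lra).
  assert (hm : accessible c rL aL rL aL) by (split; [assumption|left; auto]).
  assert (hFc : forall r, 0 < r -> continuous (F c D aL) r) by (intros; apply F_continuous; assumption).
  pose proof (F_ge0 c D hc hD aL ha q0 ltac:(lra)) as hF0.
  assert (hcontu : forall r, rL <= r -> continuous (fun r => F c D aL (conj_density c aL r) - F c D aL r) r).
  { intros r hr. apply cont_minus; [|apply hFc; lra].
    apply (continuous_comp (conj_density c aL) (F c D aL)); [apply conj_continuous|apply hFc, conj_pos]; lra. }
  (* An interior shock at density [rho] with outgoing trace [q0]. *)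
  assert (hshock : forall rho, rL <= rho < aL / c -> F c D aL rL - F c D aL rho <= 1 ->
     F c D aL (conj_density c aL rho) - F c D aL rho = 1 + F c D aL q0 - F c D aL rL ->
     exists r2, coupled c D rL aL rR aR rL r2 aL).
  { intros rho hrho hle heq. exists q0. split; [assumption|]. split; [apply plus_sub; lra|].
    right. right. right. left. split; [assumption|]. split; [assumption|].
    exists rho, (F c D aL rL - F c D aL rho). split; [assumption|].
    split; [split; [|assumption]|split; [reflexivity|]].
    - destruct (proj1 hrho) as [k|k]; [|rewrite k; lra].
      pose proof (F_decr c D hc hD aL ha rL rho hrL k ltac:(lra)). lra.
    - unfold conj_density in heq. lra. }
  destruct (Rle_lt_dec 1 (F c D aL rL)) as [h1|h1].
  - (* the flow may also cross the particle without shock, leaving at [r1] *)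
    destruct (IVT_on (F c D aL) rL (aL / c) (F c D aL rL - 1)) as [r1 [hr1 e1]]; [lra|intros; apply hFc; lra| |].
    { rewrite F_sonic by assumption. rewrite Rmin_right, Rmax_left; lra. }
    destruct (Rlt_le_dec q0 (conj_density c aL r1)) as [hq|hq].
    + assert (hr1s : r1 < aL / c).
      { apply Rnot_le_lt. intros hle. replace r1 with (aL / c) in hq by lra. rewrite conj_sonic in hq by assumption. lra. }
      exists r1. split; [assumption|]. split.
      * apply plus_super; try assumption; try lra.
        -- rewrite <- sc. apply Rmult_lt_compat_l; lra.
        -- rewrite <- hfl at 1. apply flux_incr; lra.
      * right. left. split; [assumption|]. split; [apply Rmult_le_pos; lra|lra].
    + destruct (IVT_on (fun r => F c D aL (conj_density c aL r) - F c D aL r) rL r1 (1 + F c D aL q0 - F c D aL rL))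
        as [rho [hrho erho]]; [lra|intros; apply hcontu; lra| |].
      { assert (hc1 : aL / c <= conj_density c aL r1) by (apply conj_ge; try assumption; lra).
        assert (F c D aL (conj_density c aL r1) <= F c D aL q0).
        { destruct hq as [hq|hq]; [left; apply F_incr; assumption|rewrite hq; lra]. }
        rewrite Rmin_right, Rmax_left; lra. }
      assert (hle : F c D aL rL - F c D aL rho <= 1).
      { destruct (proj2 hrho) as [k|k]; [|subst rho; lra].
        pose proof (F_decr c D hc hD aL ha rho r1 ltac:(lra) k ltac:(lra)). lra. }
      destruct (Rlt_le_dec rho (aL / c)) as [k|k]; [apply (hshock rho); try assumption; lra|].
      (* the flow reaches the sonic state exactly at the exit *)
      replace rho with (aL / c) in erho, hle by lra. rewrite conj_sonic in erho by assumption.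
      rewrite F_sonic in erho, hle by assumption.
      assert (hqs : q0 = aL / c).
      { destruct hq0 as [hq0|hq0]; [|symmetry; assumption].
        pose proof (F_incr c D hc hD aL ha (aL / c) q0 ltac:(lra) hq0) as hi. rewrite F_sonic in hi by assumption. lra. }
      exists q0. split; [assumption|]. split; [apply plus_sub; lra|].
      right. left. split; [assumption|]. rewrite hqs. split; [rewrite Rminus_diag, Rmult_0_l; lra|].
      rewrite F_sonic by assumption. lra.
  - destruct (IVT_on (fun r => F c D aL (conj_density c aL r) - F c D aL r) rL (aL / c) (1 + F c D aL q0 - F c D aL rL))
      as [rho [hrho erho]]; [lra|intros; apply hcontu; lra| |].
    { rewrite conj_sonic, F_sonic by assumption. rewrite Rmin_right, Rmax_left; lra. }
    pose proof (F_ge0 c D hc hD aL ha rho ltac:(lra)).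
    apply (hshock rho); [split; [lra|]|lra|assumption].
    apply Rnot_le_lt. intros k. replace rho with (aL / c) in erho by lra.
    rewrite conj_sonic, F_sonic in erho by assumption. lra.
Qed.

Lemma f_continuous (r : R) : 0 < r -> continuous f r.
Proof. intros hr. apply wave_velocity_continuous; assumption. Qed.

Lemma flux_continuous (r : R) : 0 < r -> continuous flux r.
Proof.
  intros hr. unfold flux, g. apply cont_mult; [cont|]. apply cont_min; [|cont].
  apply cont_opp. apply wave_velocity_continuous; assumption.
Qed.

Lemma flux_inverse (zR : R) : 0 < zR -> g zR = 0 ->
  exists inv : R -> R, forall a, 0 < a -> zR < inv a /\ flux (inv a) = a /\ continuous inv a.
Proof.
  intros hz gz.
  assert (hgpos : forall r, zR < r -> 0 < Rmin (g r) c).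
  { intros r hr. apply Rmin_pos; [|assumption]. rewrite <- gz. apply fast_incr. lra. }
  assert (hfpos : forall r, zR < r -> 0 < flux r).
  { intros r hr. apply Rmult_lt_0_compat; [lra|apply hgpos; assumption]. }
  assert (hex : forall a, exists q, 0 < a -> zR < q /\ flux q = a).
  { intros a. destruct (Rlt_le_dec 0 a) as [ha|ha]; [|exists 0; intros; lra].
    set (m := Rmin (g (zR + 1)) c). assert (hm : 0 < m) by (apply hgpos; lra).
    assert (ham : 0 < a / m) by (apply Rdiv_lt_0_compat; assumption).
    set (top := zR + 1 + a / m).
    assert (hbot : flux zR = 0) by (unfold flux; rewrite gz, Rmin_left by lra; ring).
    assert (htop : a <= flux top).
    { unfold flux. assert (m <= Rmin (g top) c).
      { apply Rle_min_compat_r. left. apply fast_incr. unfold top. lra. }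
      apply Rle_trans with (top * m); [|apply Rmult_le_compat_l; [unfold top; lra|assumption]].
      unfold top. replace ((zR + 1 + a / m) * m) with (a + (zR + 1) * m) by (field; lra).
      assert (0 < (zR + 1) * m) by (apply Rmult_lt_0_compat; lra). lra. }
    destruct (IVT_on flux zR top a) as [q [hq e]].
    - unfold top; lra.
    - intros x hx. apply flux_continuous. lra.
    - rewrite hbot, Rmin_left, Rmax_right; lra.
    - exists q. intros _. split; [|assumption]. destruct (proj1 hq) as [k|k]; [assumption|].
      subst q. lra. }
  set (inv := fun a => proj1_sig (constructive_indefinite_description _ (hex a))).
  assert (hinv : forall a, 0 < a -> zR < inv a /\ flux (inv a) = a).
  { intros a. unfold inv. apply (proj2_sig (constructive_indefinite_description _ (hex a))). }
  exists inv. intros a ha. destruct (hinv a ha) as [h1 h2]. split; [assumption|]. split; [assumption|].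
  (* a strictly monotone function has a continuous inverse *)
  apply continuous_eps. intros e he.
  set (d := Rmin e ((inv a - zR) / 2)).
  assert (hd : 0 < d) by (apply Rmin_pos; lra).
  pose proof (Rmin_l e ((inv a - zR) / 2)) as d1. pose proof (Rmin_r e ((inv a - zR) / 2)) as d2. fold d in d1, d2.
  pose proof (hfpos (inv a - d) ltac:(lra)) as p1.
  pose proof (flux_incr (inv a - d) (inv a) ltac:(lra) p1) as i1.
  pose proof (flux_incr (inv a) (inv a + d) ltac:(lra) ltac:(lra)) as i2.
  exists (Rmin (a - flux (inv a - d)) (flux (inv a + d) - a)). split; [apply Rmin_pos; lra|].
  intros b hb. pose proof (Rmin_l (a - flux (inv a - d)) (flux (inv a + d) - a)).
  pose proof (Rmin_r (a - flux (inv a - d)) (flux (inv a + d) - a)).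
  apply Rabs_def2 in hb.
  assert (hb0 : 0 < b) by lra. destruct (hinv b hb0) as [k1 k2].
  pose proof (flux_incr_inv (inv a - d) (inv b) ltac:(lra) ltac:(lra) p1 ltac:(lra) ltac:(lra)).
  pose proof (flux_incr_inv (inv b) (inv a + d) ltac:(lra) ltac:(lra) ltac:(lra) ltac:(lra) ltac:(lra)).
  apply Rabs_def1; lra.
Qed.

Lemma subsonic_coupled (p q a : R) : 0 < a -> 0 < p -> 0 < q -> a = p * f p -> f p <= c ->
  (c * rL < aL -> conj_density c aL rL < p) -> a = flux q -> F c D a p - F c D a q = 1 ->
  coupled c D rL aL rR aR p q a.
Proof.
  intros ha hp hq h1 h2 h3 h4 h5. split; [apply minus_sub; assumption|]. split; [apply plus_sub; assumption|].
  right. left. split; [assumption|]. split; [|assumption].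
  assert (a / c <= p) by (apply sonic_le; rewrite h1; nra).
  assert (a / c <= q) by (apply sonic_le; pose proof (flux_le_sonic q hq); lra).
  nra.
Qed.

(** The gap of [F] blows up as the flux tends to [0], the drag force being
    then arbitrarily weak on a fixed interval of densities. *)
Lemma positive_exists (zL zR : R) : 0 < zR -> zR < zL -> f zL = 0 -> g zR = 0 ->
  exists r1 r2 a, 0 < a /\ coupled c D rL aL rR aR r1 r2 a.
Proof.
  intros hzR hz fz gz.
  destruct (flux_inverse zR hzR gz) as [inv hinv].
  assert (hfpos : forall p, 0 < p < zL -> 0 < f p) by (intros p hp; rewrite <- fz; apply slow_decr; lra).
  assert (hinvs : forall a, 0 < a -> a / c <= inv a).
  { intros a ha. destruct (hinv a ha) as [h1 [h2 _]]. apply sonic_le.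
    pose proof (flux_le_sonic (inv a) ltac:(lra)). lra. }
  (* Intermediate values between a density [p0] where the gap is below [1]
     and densities close to [zL]. *)
  assert (hmain : forall p0, 0 < p0 < zL -> f p0 <= c ->
     (c * rL < aL -> conj_density c aL rL <= p0) ->
     F c D (p0 * f p0) p0 - F c D (p0 * f p0) (inv (p0 * f p0)) < 1 ->
     exists r1 r2 a, 0 < a /\ coupled c D rL aL rR aR r1 r2 a).
  { intros p0 hp0 hfp0 hcond hlt.
    set (m := (2 * zR + zL) / 3). set (m' := (zR + 2 * zL) / 3).
    assert (hgm : 0 < flux m).
    { apply Rmult_lt_0_compat; [unfold m; lra|]. apply Rmin_pos; [|assumption].
      rewrite <- gz. apply fast_incr. unfold m; lra. }
    assert (hDc : continuous (fun a => Rabs (D m a)) 0).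
    { apply cont_abs. apply (continuous_comp_2 (fun _ => m) (fun y => y) D); [cont|cont|].
      apply drag_continuous; [assumption|unfold m; lra]. }
    set (k := (m' - m) * c ^ 2 / 4).
    assert (hk : 0 < k).
    { unfold k. assert (0 < c ^ 2) by (apply pow_lt; assumption).
      assert (0 < (m' - m) * c ^ 2) by (apply Rmult_lt_0_compat; [unfold m, m'; lra|assumption]). lra. }
    destruct (proj1 (continuous_eps _ _) hDc k hk) as [d [hd hDd]].
    rewrite (drag_zero D hD m) in hDd by (unfold m; lra).
    (* a density [p1] close to [zL], with small flux *)
    set (e := Rmin (Rmin d (flux m)) (c * m / 2)).
    assert (he : 0 < e).
    { repeat apply Rmin_pos; try assumption. assert (0 < c * m) by (apply Rmult_lt_0_compat; [assumption|unfold m; lra]). lra. }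
    assert (hpf : continuous (fun p => p * f p) zL) by (apply cont_mult; [cont|apply f_continuous; lra]).
    destruct (proj1 (continuous_eps _ _) hpf e he) as [d' [hd' hpd]]. rewrite fz in hpd.
    set (p1 := zL - Rmin (Rmin d' (zL - p0)) (zL - m') / 2).
    assert (hmin : 0 < Rmin (Rmin d' (zL - p0)) (zL - m')) by (repeat apply Rmin_pos; unfold m'; lra).
    pose proof (Rmin_l (Rmin d' (zL - p0)) (zL - m')) as q1. pose proof (Rmin_r (Rmin d' (zL - p0)) (zL - m')) as q2.
    pose proof (Rmin_l d' (zL - p0)) as q3. pose proof (Rmin_r d' (zL - p0)) as q4.
    assert (hp1 : p0 < p1 < zL /\ m' < p1) by (unfold p1; lra).
    assert (ha1 : 0 < p1 * f p1) by (apply Rmult_lt_0_compat; [lra|apply hfpos; lra]).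
    set (a1 := p1 * f p1) in *.
    assert (ha1e : a1 < e).
    { specialize (hpd p1). rewrite Rmult_0_r, Rminus_0_r in hpd.
      assert (hab : Rabs (p1 - zL) < d') by (rewrite Rabs_left1; unfold p1; lra).
      specialize (hpd hab). fold a1 in hpd. rewrite Rabs_pos_eq in hpd by lra. assumption. }
    pose proof (Rmin_l (Rmin d (flux m)) (c * m / 2)) as w1. pose proof (Rmin_r (Rmin d (flux m)) (c * m / 2)) as w2.
    pose proof (Rmin_l d (flux m)) as w3. pose proof (Rmin_r d (flux m)) as w4. fold e in w1, w2.
    destruct (hinv a1 ha1) as [v1 [v2 _]].
    assert (hq1 : inv a1 < m) by (apply flux_incr_inv; unfold m in *; lra).
    assert (hbig : 1 < F c D a1 p1 - F c D a1 (inv a1)).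
    { assert (hs1 : a1 / c <= inv a1) by (apply hinvs; assumption).
      assert (hs0 : 0 < a1 / c) by (apply Rdiv_lt_0_compat; assumption).
      assert (F c D a1 m' < F c D a1 p1) by (apply F_incr; try assumption; unfold m, m' in *; lra).
      assert (F c D a1 (inv a1) < F c D a1 m) by (apply F_incr; assumption).
      enough (1 <= F c D a1 m' - F c D a1 m) by lra.
      rewrite F_slope by (try assumption; unfold m, m' in *; lra).
      assert (hDm : Rabs (D m a1) < k).
      { specialize (hDd a1). rewrite Rabs_R0, !Rminus_0_r, Rabs_Rabsolu in hDd. apply hDd.
        rewrite Rabs_pos_eq; lra. }
      assert (hmp : 0 < m) by (unfold m; lra).
      apply Rle_trans with (RInt (fun _ => 1 / k * (c ^ 2 * 3 / 4)) m m').
      - rewrite RInt_const_R. apply Rle_trans with 3; [lra|]. unfold k. apply Req_le. field. unfold m, m'. lra.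
      - apply RInt_le; [unfold m, m'; lra|apply ex_RInt_const|apply ex_RInt_slope; try assumption; unfold m, m' in *; lra|].
        intros x hx. unfold slope.
        assert (hDx : Rabs (D x a1) <= Rabs (D m a1)) by (apply (drag_abs_decr D hD); lra).
        pose proof (drag_abs_pos D hD x a1 ltac:(lra) ltac:(lra)) as hDp.
        apply Rmult_le_compat.
        + unfold Rdiv. rewrite Rmult_1_l. left. apply Rinv_0_lt_compat. assumption.
        + assert (0 <= c ^ 2) by (apply pow2_ge_0). lra.
        + unfold Rdiv. rewrite !Rmult_1_l. apply Rinv_le_contravar; lra.
        + assert (a1 ^ 2 / x ^ 2 <= c ^ 2 / 4); [|lra].
          apply (proj2 (Rle_div_l (a1 ^ 2) (c ^ 2 / 4) (x ^ 2) (pow_lt x 2 ltac:(lra)))).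
          assert (a1 <= c * x / 2) by (apply Rle_trans with (c * m / 2); [lra|]; assert (c * m <= c * x) by (apply Rmult_le_compat_l; lra); lra).
          replace (c ^ 2 / 4 * x ^ 2) with ((c * x / 2) ^ 2) by field. nra. }
    set (P := clamp p0 p1). set (A := fun t => P t * f (P t)). set (Q := fun t => inv (A t)).
    assert (hPin : forall t, p0 <= P t <= p1) by (intros; apply clamp_in; lra).
    assert (hApos : forall t, 0 < A t).
    { intros t. specialize (hPin t). apply Rmult_lt_0_compat; [lra|]. apply hfpos. lra. }
    assert (hPc : forall t, continuous P t) by (intros; apply continuous_clamp).
    assert (hAc : forall t, continuous A t).
    { intros t. apply cont_mult; [apply hPc|]. apply (continuous_comp P f); [apply hPc|].
      apply f_continuous. specialize (hPin t). lra. }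
    assert (hQc : forall t, continuous Q t).
    { intros t. apply (continuous_comp A inv); [apply hAc|]. apply hinv, hApos. }
    assert (eP0 : P p0 = p0) by (apply clamp_id; lra).
    assert (eP1 : P p1 = p1) by (apply clamp_id; lra).
    destruct (IVT_on (fun t => F c D (A t) (P t) - F c D (A t) (Q t)) p0 p1 1) as [t [ht et]].
    - lra.
    - intros t _. apply continuous_F_gap; try assumption. intros s. split; [apply hApos|].
      split; [specialize (hPin s); lra|]. destruct (hinv (A s) (hApos s)) as [h1 _]. unfold Q. lra.
    - unfold Q, A. rewrite eP0, eP1. fold a1. rewrite Rmin_left, Rmax_right; lra.
    - assert (ePt : P t = t) by (apply clamp_id; lra).
      unfold Q, A in et. rewrite ePt in et.
      assert (hat : 0 < t * f t) by (rewrite <- ePt; apply hApos).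
      destruct (hinv (t * f t) hat) as [h1 [h2 _]].
      assert (htp : p0 < t).
      { destruct (proj1 ht) as [h|h]; [assumption|]. rewrite <- h in et. lra. }
      exists t, (inv (t * f t)), (t * f t). split; [assumption|].
      apply subsonic_coupled; try assumption; try lra.
      pose proof (slow_decr p0 t ltac:(lra)). lra. }
  destruct (Rle_lt_dec aL (c * rL)) as [hsub|hsup].
  - destruct (phi_level c rL aL c hc hrL) as [rs [hrs hfs]]. fold (f rs) in hfs.
    assert (hrz : rs < zL).
    { apply Rnot_le_lt. intros [hle|hle]; [pose proof (slow_decr zL rs ltac:(lra)); lra|rewrite hle in fz; lra]. }
    apply (hmain rs); [lra|lra|lra|].
    rewrite hfs. replace (rs * c) with (c * rs) by ring.
    assert (ha : 0 < c * rs) by (apply Rmult_lt_0_compat; assumption).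
    replace rs with (c * rs / c) at 2 by (field; lra). rewrite F_sonic by assumption.
    destruct (hinv (c * rs) ha) as [h1 _].
    pose proof (F_ge0 c D hc hD (c * rs) ha (inv (c * rs)) ltac:(lra)). lra.
  - set (p0 := conj_density c aL rL).
    assert (hcr : 0 < c * rL) by (apply Rmult_lt_0_compat; assumption).
    assert (haL : 0 < aL) by lra.
    assert (hp0 : 0 < p0) by (apply conj_pos; assumption).
    assert (hpf : p0 * f p0 = aL) by (apply phi_conj; assumption).
    assert (hfp : 0 < f p0) by (apply Rmult_lt_reg_l with p0; lra).
    assert (hpz : p0 < zL).
    { apply Rnot_le_lt. intros [hle|hle]; [pose proof (slow_decr zL p0 ltac:(lra)); lra|rewrite hle in fz; lra]. }
    assert (hps : aL / c <= p0).
    { apply conj_ge; try assumption. left. apply (proj1 (Rlt_div_r rL aL c hc)). lra. }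
    assert (hfc : f p0 <= c).
    { apply Rmult_le_reg_l with p0; [assumption|]. rewrite hpf.
      apply (proj1 (Rle_div_l aL p0 c hc)) in hps. lra. }
    destruct (Rlt_le_dec (F c D aL p0 - F c D aL (inv aL)) 1) as [hlt|hge].
    + apply (hmain p0); [lra|assumption|intros; unfold p0; lra|]. rewrite hpf. assumption.
    + destruct (hinv aL haL) as [h1 [h2 _]].
      destruct (supersonic_exists (inv aL) hsup (hinvs aL haL) h2 hge) as [r2 hr2].
      exists rL, r2, aL. split; assumption.
Qed.

End Positive.

(** * Mirror symmetry and the sign of the mass flux *)

Definition mirror_drag (D : R -> R -> R) (r a : R) : R := - D r (- a).

Lemma mirror_drag_force (D : R -> R -> R) : drag_force D -> drag_force (mirror_drag D).
Proof.
  intros hD. unfold mirror_drag. split.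
  - destruct (drag_C1 D hD) as [f1 [f2 h]].
    exists (fun r a => - f1 r (- a)), (fun r a => f2 r (- a)). intros x y hx.
    destruct (h x (- y) hx) as [h1 [h2 [h3 h4]]].
    split; [|split; [|split]].
    + apply (is_derive_opp (fun s : R => D s (- y)) x _ h1).
    + evar_last.
      * apply (is_derive_opp (fun s : R => D x (- s)) y (-1 * f2 x (- y))).
        evar_last; [apply (is_derive_comp (D x) Ropp y (f2 x (- y)) (-1) h2); auto_derive; [trivial|ring]|eqR; reflexivity].
      * exact (ltac:(ring) : - (-1 * f2 x (- y)) = f2 x (- y)).
    + apply cont_opp.
      apply (continuous_comp_2 (fun p : R * R => fst p) (fun p : R * R => - snd p) f1); [cont|cont|assumption].
    + apply (continuous_comp_2 (fun p : R * R => fst p) (fun p : R * R => - snd p) f2); [cont|cont|assumption].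
  - intros r a hr ha. pose proof (drag_neg D hD r (- a) hr ltac:(lra)). lra.
  - intros r a hr ha. pose proof (drag_pos D hD r (- a) hr ltac:(lra)). lra.
  - intros r hr. rewrite Ropp_0, (drag_zero D hD r hr). ring.
  - intros r a1 a2 hr ha. pose proof (drag_incr D hD r (- a2) (- a1) hr ltac:(lra)). lra.
  - intros r1 r2 a h1 h2. rewrite !Rabs_Ropp. apply (drag_abs_decr D hD); assumption.
Qed.

Lemma F_mirror (c : R) (D : R -> R -> R) (a r : R) : F c (mirror_drag D) (- a) r = F c D a r.
Proof.
  unfold F, mirror_drag. rewrite Rabs_Ropp. apply RInt_ext. intros x _.
  rewrite Rabs_Ropp, Ropp_involutive. f_equal. f_equal. f_equal. ring.
Qed.

Lemma coupled_mirror (c : R) (D D' : R -> R -> R) (rL aL rR aR r1 r2 a : R) : 0 < c ->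
  (forall r, F c D' (- a) r = F c D a r) ->
  coupled c D rL aL rR aR r1 r2 a -> coupled c D' rR (- aR) rL (- aL) r2 r1 (- a).
Proof.
  intros hc hF [hm [hp hg]]. unfold coupled. rewrite !Ropp_involutive.
  split; [assumption|]. split; [assumption|].
  assert (h1 : 0 < c * r1) by (apply Rmult_lt_0_compat; [assumption|apply hm]).
  assert (h2 : 0 < c * r2) by (apply Rmult_lt_0_compat; [assumption|apply hp]).
  assert (hsq : (- a) ^ 2 = a ^ 2) by ring.
  unfold germ_cases. rewrite Rabs_Ropp, hsq. setoid_rewrite hF.
  destruct hg as [[h3 h4]|[[h3 [h4 h5]]|[[h3 [h4 h5]]|[[h3 [h4 h5]]|[h3 [h4 h5]]]]]].
  - left. lra.
  - right. right. left. rewrite Rabs_pos_eq by lra.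
    split; [lra|]. split; [lra|assumption].
  - right. left. rewrite Rabs_left in h4 by lra.
    split; [lra|]. split; [lra|assumption].
  - right. right. right. right. rewrite Rabs_pos_eq by lra.
    split; [lra|]. split; assumption.
  - right. right. right. left. rewrite Rabs_left in h4, h5 by lra.
    split; [lra|]. split; assumption.
Qed.

Lemma accessible_no_flux (c r0 a0 r : R) : 0 < c -> 0 < r0 ->
  (accessible c r0 a0 r 0 <-> 0 < r /\ phi c r0 a0 r = 0).
Proof.
  intros hc h0. split.
  - intros [hr h]. split; [assumption|].
    assert (hcr : 0 < c * r) by (apply Rmult_lt_0_compat; assumption).
    destruct h as [[h _]|[[h _]|[h _]]]; [lra| |lra].
    symmetry in h. apply Rmult_integral in h. destruct h as [h|h]; [lra|].
    unfold Rmax in h. destruct (Rle_dec (phi c r0 a0 r) (- c)); lra.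
  - intros [hr h]. split; [assumption|]. right. left. rewrite h, Rmax_left by lra.
    split; [ring|]. split; [lra|]. intros hsup.
    assert (hcr : 0 < c * r0) by (apply Rmult_lt_0_compat; assumption).
    assert (hk : 0 < conj_density c a0 r0) by (apply conj_pos; try assumption; lra).
    pose proof (phi_conj c r0 a0 hc h0 hsup) as hkp.
    assert (0 < phi c r0 a0 (conj_density c a0 r0)) by (apply Rmult_lt_reg_l with (conj_density c a0 r0); lra).
    apply Rnot_le_lt. intros [hle|hle].
    + pose proof (wave_velocity_decr c r0 (a0 / r0) r (conj_density c a0 r0) hc h0 (conj hr hle)).
      unfold phi in *. lra.
    + rewrite <- hle in *. lra.
Qed.

Lemma coupled_no_flux (c : R) (D : R -> R -> R) (rL aL rR aR r1 r2 : R) :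
  0 < c -> 0 < rL -> 0 < rR ->
  (coupled c D rL aL rR aR r1 r2 0 <->
   0 < r1 /\ phi c rL aL r1 = 0 /\ phi c rR (- aR) r1 = 0 /\ r1 = r2).
Proof.
  intros hc hL hR. unfold coupled, germ_cases. rewrite Ropp_0, !accessible_no_flux by assumption.
  rewrite Rabs_R0. split.
  - intros [[h1 h2] [[h3 h4] hg]].
    assert (0 < c * r1) by (apply Rmult_lt_0_compat; assumption).
    assert (0 < c * r2) by (apply Rmult_lt_0_compat; assumption).
    destruct hg as [[_ hg]|[[hg _]|[[hg _]|[[hg _]|[hg _]]]]]; try lra. subst r2. auto.
  - intros [h1 [h2 [h3 h4]]]. subst r2. auto.
Qed.

(** The sign of the mass flux is the sign of [zL - zR], where [zL] and [zR] are
    the densities at which the left and the right states are brought to rest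
    in the frame of the particle. *)
Lemma coupled_exists_unique (c : R) (D : R -> R -> R) (rL aL rR aR : R) :
  0 < c -> drag_force D -> 0 < rL -> 0 < rR ->
  exists r1 r2 a, coupled c D rL aL rR aR r1 r2 a /\
    forall r1' r2' a', coupled c D rL aL rR aR r1' r2' a' -> r1 = r1' /\ r2 = r2' /\ a = a'.
Proof.
  intros hc hD hL hR.
  destruct (phi_level c rL aL 0 hc hL) as [zL [hzL fz]].
  destruct (phi_level c rR (- aR) 0 hc hR) as [zR [hzR gz]].
  assert (gz' : - phi c rR (- aR) zR = 0) by lra.
  assert (fz' : - phi c rL (- - aL) zL = 0) by (rewrite Ropp_involutive; lra).
  set (D' := mirror_drag D). assert (hD' : drag_force D') by (apply mirror_drag_force; assumption).
  assert (to_mirror : forall r1 r2 a, coupled c D rL aL rR aR r1 r2 a ->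
    coupled c D' rR (- aR) rL (- aL) r2 r1 (- a)).
  { intros r1 r2 a. apply coupled_mirror; [assumption|]. intros r. apply F_mirror. }
  assert (of_mirror : forall r1 r2 a, coupled c D' rR (- aR) rL (- aL) r2 r1 a ->
    coupled c D rL aL rR aR r1 r2 (- a)).
  { intros r1 r2 a h. rewrite <- (Ropp_involutive aL), <- (Ropp_involutive aR).
    apply (coupled_mirror c D'); [assumption| |assumption].
    intros r. rewrite <- (F_mirror c D), Ropp_involutive. reflexivity. }
  assert (hpos : forall r1 r2 a, 0 < a -> coupled c D rL aL rR aR r1 r2 a -> zR < zL).
  { intros r1 r2 a ha h. apply (positive_order c D rL aL rR aR hc hD hL hR r1 r2 a); assumption. }
  assert (hneg : forall r1 r2 a, a < 0 -> coupled c D rL aL rR aR r1 r2 a -> zL < zR).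
  { intros r1 r2 a ha h.
    apply (positive_order c D' rR (- aR) rL (- aL) hc hD' hR hL r2 r1 (- a)); try assumption; [lra|].
    apply to_mirror. assumption. }
  assert (hzero : forall r1 r2, coupled c D rL aL rR aR r1 r2 0 -> zL = r1 /\ zR = r1 /\ r1 = r2).
  { assert (inj : forall r0 a0 r s, 0 < r0 -> 0 < r -> 0 < s -> phi c r0 a0 r = 0 -> phi c r0 a0 s = 0 -> r = s).
    { intros r0 a0 r s h0 hr hs er es. unfold phi in er, es.
      destruct (Rtotal_order r s) as [k|[k|k]]; [|assumption|]; exfalso.
      - pose proof (wave_velocity_decr c r0 (a0 / r0) r s hc h0 (conj hr k)). lra.
      - pose proof (wave_velocity_decr c r0 (a0 / r0) s r hc h0 (conj hs k)). lra. }
    intros r1 r2 h. apply coupled_no_flux in h; try assumption. destruct h as [h1 [h2 [h3 h4]]].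
    split; [apply (inj rL aL); assumption|]. split; [apply (inj rR (- aR)); assumption|assumption]. }
  destruct (Rtotal_order zR zL) as [hz|[hz|hz]].
  - destruct (positive_exists c D rL aL rR aR hc hD hL hR zL zR hzR hz fz gz')
      as [r1 [r2 [a [ha h]]]].
    exists r1, r2, a. split; [assumption|]. intros r1' r2' a' h'.
    destruct (Rtotal_order a' 0) as [k|[k|k]].
    + pose proof (hneg _ _ _ k h'). lra.
    + subst a'. apply hzero in h'. lra.
    + apply (positive_unique c D rL aL rR aR hc hD hL hR); assumption.
  - exists zL, zL, 0. split.
    { apply coupled_no_flux; try assumption. split; [assumption|]. split; [assumption|].
      split; [rewrite <- hz; assumption|reflexivity]. }
    intros r1' r2' a' h'. destruct (Rtotal_order a' 0) as [k|[k|k]].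
    + pose proof (hneg _ _ _ k h'). lra.
    + subst a'. apply hzero in h'. lra.
    + pose proof (hpos _ _ _ k h'). lra.
  - destruct (positive_exists c D' rR (- aR) rL (- aL) hc hD' hR hL zR zL hzL hz gz
      fz') as [r2 [r1 [a [ha h]]]].
    exists r1, r2, (- a). split; [apply of_mirror; assumption|]. intros r1' r2' a' h'.
    destruct (Rtotal_order a' 0) as [k|[k|k]].
    + pose proof (to_mirror _ _ _ h') as h2.
      destruct (positive_unique c D' rR (- aR) rL (- aL) hc hD' hR hL _ _ _ _ _ _ ha
        (Ropp_0_gt_lt_contravar a' k) h h2) as [e1 [e2 e3]]. lra.
    + subst a'. apply hzero in h'. lra.
    + pose proof (hpos _ _ _ k h'). lra.
Qed.

Theorem proposition3p13 (c : R) (D : R -> R -> R) (hc : 0 < c)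
    (hD : drag_force D) (v rhoL alphaL rhoR alphaR : R)
    (hrhoL : 0 < rhoL) (hrhoR : 0 < rhoR) (hL : c * rhoL < alphaL)
    (hR : ~ Omega_minus_sup c rhoL alphaL v (rhoR, alphaR)) :
  exists! S : (R * R) * (R * R),
    V_minus c rhoL alphaL v (fst S) /\
    V_plus c rhoR alphaR v (snd S) /\
    germ c D v (unshift v (fst S)) (unshift v (snd S)).
Proof.
  destruct (coupled_exists_unique c D rhoL alphaL rhoR alphaR hc hD hrhoL hrhoR)
    as [r1 [r2 [a [[hm [hp hg]] huniq]]]].
  exists ((r1, a), (r2, a)). split; simpl fst; simpl snd.
  - split; [apply V_minus_iff; assumption|]. split; [apply V_plus_iff; assumption|].
    apply germ_unshift. split; [apply hm|]. split; [apply hp|]. split; [reflexivity|assumption].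
  - intros [[r1' a1] [r2' a2]]. simpl fst. simpl snd. intros [km [kp kg]].
    apply germ_unshift in kg. destruct kg as [_ [_ [ha kg]]]. subst a2.
    apply V_minus_iff in km; try assumption. apply V_plus_iff in kp; try assumption.
    destruct (huniq r1' r2' a1 (conj km (conj kp kg))) as [e1 [e2 e3]]. subst. reflexivity.
Qed.
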